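(* Let $D$ be a division ring with center $F$, and let $G$ be a subnormal subgroup of the multiplicative group $D^*$. If $M$ is a non-abelian solvable maximal subgroup of $G$, then the following conditions hold: (i) There exists a maximal subfield $K$ of $D$ such that $K/F$ is a finite Galois extension with $\mathrm{Gal}(K/F)\cong M/(K^*\cap G)\cong \mathbb{Z}_p$ for some prime $p$, and $[D:F]=p^2$. (ii) The subgroup $K^*\cap G$ is the $FC$-center of $M$, and $K^*\cap G$ is the Fitting subgroup of $M$. Furthermore, for any $x\in M\setminus K$, we have $x^p\in F$ and $D=F[M]=\bigoplus_{i=1}^pKx^i$.
   Context: $K^*$ is the multiplicative group of $K$. For a subset $S\subseteq D$, $F[S]$ denotes the subring of $D$ generated by $S\cup F$. The $FC$-center of a group $M$ is the set of elements of $M$ having only finitely many conjugates in $M$. *)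

(* Defs.v *)
From HB Require Import structures.
From mathcomp Require Import all_boot all_order all_algebra.
From mathcomp Require Import boolp classical_sets cardinality.
Set Implicit Arguments. Unset Strict Implicit. Unset Printing Implicit Defensive.
Import GRing.Theory.
Local Open Scope ring_scope.
Local Open Scope classical_set_scope.

Section Defs.
Variable D : unitRingType.

Definition is_division_ring : Prop := forall x : D, x != 0 -> x \is a GRing.unit.

Definition center : set D := [set x | forall y : D, x * y = y * x].

Definition Dstar : set D := [set x | x != 0].

Definition subgroup (H : set D) : Prop :=
  [/\ H `<=` Dstar, H 1,
      (forall x y, H x -> H y -> H (x * y)) &
      (forall x, H x -> H x^-1)].

Definition normal (H G : set D) : Prop :=
  [/\ subgroup H, subgroup G, H `<=` G &
      (forall g h, G g -> H h -> H (g^-1 * h * g))].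

Definition subnormal (G : set D) : Prop :=
  exists (n : nat) (S : nat -> set D),
    [/\ S 0%N = G, S n = Dstar &
        forall i, (i < n)%N -> normal (S i) (S i.+1)].

Definition maximal_subgroup (M G : set D) : Prop :=
  [/\ subgroup M, M `<=` G, M <> G &
      forall H, subgroup H -> M `<=` H -> H `<=` G -> H = M \/ H = G].

Definition comm (x y : D) : D := x^-1 * y^-1 * x * y.

Definition abelian (H : set D) : Prop :=
  forall x y, H x -> H y -> x * y = y * x.

Definition solvable (H : set D) : Prop :=
  exists (n : nat) (S : nat -> set D),
    [/\ S 0%N = H, S n = [set 1] &
        forall i, (i < n)%N ->
          normal (S i.+1) (S i) /\
          (forall x y, S i x -> S i y -> S i.+1 (comm x y))].

Definition nilpotent (H : set D) : Prop :=
  subgroup H /\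
  exists (n : nat) (Z : nat -> set D),
    [/\ Z 0%N = [set 1], Z n = H &
        forall i, (i < n)%N ->
          [/\ normal (Z i) H, Z i `<=` Z i.+1 &
              forall h z, H h -> Z i.+1 z -> Z i (comm h z)]].

Definition gen (S : set D) : set D :=
  [set x | forall H, subgroup H -> S `<=` H -> H x].

Definition Fitting (M : set D) : set D :=
  gen [set x | exists N, [/\ normal N M, nilpotent N & N x]].

Definition FC_center (M : set D) : set D :=
  [set x | M x /\ finite_set [set y^-1 * x * y | y in M]].

Definition subring (S : set D) : Prop :=
  [/\ S 0, S 1, (forall x, S x -> S (- x)),
      (forall x y, S x -> S y -> S (x + y)) &
      (forall x y, S x -> S y -> S (x * y))].

(* F[S]: the subring generated by S (the caller includes F in S) *)
Definition subring_gen (S : set D) : set D :=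
  [set x | forall R, subring R -> S `<=` R -> R x].

Definition subfield (K : set D) : Prop :=
  [/\ subring K,
      (forall x, K x -> x != 0 -> K x^-1) &
      (forall x y, K x -> K y -> x * y = y * x)].

Definition maximal_subfield (K : set D) : Prop :=
  subfield K /\ forall L, subfield L -> K `<=` L -> L = K.

Definition dim_over (F V : set D) (n : nat) : Prop :=
  exists b : 'I_n -> D,
    [/\ forall i, V (b i),
        (forall c : 'I_n -> D, (forall i, F (c i)) ->
            \sum_(i < n) c i * b i = 0 -> forall i, c i = 0) &
        (forall v, V v -> exists c : 'I_n -> D,
            (forall i, F (c i)) /\ v = \sum_(i < n) c i * b i)].

Definition F_automorphism (F K : set D) (s : D -> D) : Prop :=
  [/\ forall x, K x -> K (s x),
      forall x, F x -> s x = x,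
      forall x y, K x -> K y -> s (x + y) = s x + s y /\ s (x * y) = s x * s y,
      forall y, K y -> exists x, K x /\ s x = y &
      forall x y, K x -> K y -> s x = s y -> x = y].

Definition finite_galois (F K : set D) : Prop :=
  [/\ F `<=` K, exists n, dim_over F K n &
      forall x, K x -> (forall s, F_automorphism F K s -> s x = x) -> F x].

(* Gal(K/F) is isomorphic to Z_p: phi : Z_p -> Gal(K/F) is a group isomorphism
   (automorphisms are identified when they agree on K) *)
Definition gal_iso_Zp (F K : set D) (p : nat) : Prop :=
  exists phi : 'Z_p -> D -> D,
    [/\ forall i, F_automorphism F K (phi i),
        forall s, F_automorphism F K s ->
                  exists i, forall x, K x -> s x = phi i x,
        forall i j, (forall x, K x -> phi i x = phi j x) -> i = j &
        forall i j x, K x -> phi (i + j) x = phi i (phi j x)].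

(* M / N is isomorphic to Z_p: there is a surjective homomorphism M -> Z_p
   with kernel exactly N (first isomorphism theorem) *)
Definition quot_iso_Zp (M N : set D) (p : nat) : Prop :=
  exists f : D -> 'Z_p,
    [/\ forall x y, M x -> M y -> f (x * y) = f x + f y,
        forall z, exists x, M x /\ f x = z &
        forall x, (M x /\ f x = 0) <-> N x].

End Defs.

(* Main.v *)
(* Let F be the center of D. Noncentral subnormal subgroups of a division ring
   generate it, and solvable ones are central; so by maximality of M a normal
   subgroup N of M is abelian or satisfies F(N) = D, where F(N) is the division
   subring generated by F and N.

   Suppose first that M has a noncentral abelian normal subgroup. It is contained
   in a self-centralizing one C, and L = F(C) is a field with L* /\ G = C. If
   C < N <| M with N/C abelian, then D is the division ring of fractions of the
   crossed product L[N], and comparing supports shows that every element of M lies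
   in N. Hence M/C is abelian, and then cyclic of prime order p; a generator x
   gives D = L + L x + ... + L x^(p-1), and Dedekind's and Artin's arguments give
   the Galois theory of L/F.

   Suppose now that every abelian normal subgroup of M is central. The derived
   series of M yields N <| M, nonabelian with central commutators, and B <| M, not
   contained in N, which acts nontrivially on N/F through an abelian group. Fixed
   points in N/F of a stabilizer J of maximal size in B and of its M-conjugates
   either commute or coincide. If they all coincide, they form a normal subgroup
   which is finite modulo F; otherwise G permutes the division rings generated by
   the fixed points, and the kernel of this action is too large.

   In the remaining cases, as for the FC-center and the Fitting subgroup, M is
   finite modulo F and D is finite-dimensional. This is impossible: modulo F, the
   group G is then finitely generated and linear, hence residually finite, whereas
   the index of a noncentral normal subgroup is bounded by the order of M
   modulo F. *)

Require Import Defs.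
From HB Require Import structures.
From mathcomp Require Import all_boot all_order all_algebra.
From mathcomp Require Import boolp classical_sets cardinality.
From mathcomp Require Import galois finfield.
From mathcomp Require Import zify.
Import GRing.Theory.
Local Open Scope ring_scope.
Local Open Scope classical_set_scope.
Set Implicit Arguments. Unset Strict Implicit. Unset Printing Implicit Defensive.

(** * Division rings and their subgroups *)

(** Its substitute is the crossed product [E[N]] of a division subring [E] by a group [N] that is
    abelian modulo [E]: its words grow polynomially, so it satisfies the Ore condition. Numerators
    and denominators with the fewest monomials are then forced to commute with a prescribed group,
    which yields normalizers in [E(y)] and the inclusion of [M] in [F[N]] in the class-two case. The
    results on subnormal subgroups are proved by induction on the depth with a varying ambient
    division ring: passing to the division ring generated by [E] and a single [y] keeps the depth,
    and there the normalizer of [E] is cyclic modulo [E] and its centralizer. The abelian case ends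
    in an Engel condition, refuted by a polynomial identity or by Wedderburn's theorem. *)

Section Units.
Variables (D : unitRingType) (hD : is_division_ring D).
Implicit Types x y z : D.

Lemma mulVd x : x != 0 -> x^-1 * x = 1.
Proof. by move=> /hD ux; rewrite mulVr. Qed.

Lemma muldV x : x != 0 -> x * x^-1 = 1.
Proof. by move=> /hD ux; rewrite divrr. Qed.

Lemma mulKd x y : x != 0 -> x^-1 * (x * y) = y.
Proof. by move=> x0; rewrite mulrA mulVd ?mul1r. Qed.

Lemma mulVKd x y : x != 0 -> x * (x^-1 * y) = y.
Proof. by move=> x0; rewrite mulrA muldV ?mul1r. Qed.

Lemma invd_eq0 x : (x^-1 == 0) = (x == 0).
Proof.
apply/eqP/eqP => [h|->]; last by rewrite invr0.
by rewrite -[x]invrK h invr0.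
Qed.

Lemma muld_eq0 x y : (x * y == 0) = (x == 0) || (y == 0).
Proof.
apply/eqP/orP => [h|[/eqP ->|/eqP ->]]; rewrite ?mul0r ?mulr0 //.
case: (eqVneq x 0) => [_|x0]; [by left|right].
by apply/eqP; rewrite -(mulKd y x0) h mulr0.
Qed.

Lemma muldn0 x y : x != 0 -> y != 0 -> x * y != 0.
Proof. by move=> hx hy; rewrite muld_eq0 negb_or hx. Qed.

Lemma invdn0 x : x != 0 -> x^-1 != 0.
Proof. by rewrite invd_eq0. Qed.

Lemma expdn0 x n : x != 0 -> x ^+ n != 0.
Proof.
by move=> x0; elim: n => [|n IH]; rewrite ?expr0 ?oner_neq0 // exprS muldn0.
Qed.

Lemma expdzn0 x (n : int) : x != 0 -> x ^ n != 0.
Proof. by move=> x0; case: n => n; rewrite /exprz ?invd_eq0 expdn0. Qed.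

Lemma invMd x y : (x * y)^-1 = y^-1 * x^-1.
Proof.
case: (eqVneq x 0) => [->|/hD ux]; first by rewrite mul0r invr0 mulr0.
case: (eqVneq y 0) => [->|/hD uy]; first by rewrite mulr0 invr0 mul0r.
by rewrite invrM.
Qed.

Lemma mulId x y z : z != 0 -> x * z = y * z -> x = y.
Proof. by move=> /hD uz; exact: mulIr. Qed.

Lemma mulDI x y z : z != 0 -> z * x = z * y -> x = y.
Proof. by move=> /hD uz; exact: mulrI. Qed.

End Units.

Ltac gw_step := match goal with
  | hD : is_division_ring ?D |- context [(?x * ?y)^-1] => rewrite (@invMd D hD x y)
  | hD : is_division_ring ?D |- context [?x^-1 * (?x * ?y)] => rewrite (@mulKd D hD x y); [|done]
  | hD : is_division_ring ?D |- context [?x * (?x^-1 * ?y)] => rewrite (@mulVKd D hD x y); [|done]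
  | hD : is_division_ring ?D |- context [?x^-1 * ?x] => rewrite (@mulVd D hD x); [|done]
  | hD : is_division_ring ?D |- context [?x * ?x^-1] => rewrite (@muldV D hD x); [|done]
  end.

(* Free reduction of multiplicative words whose letters are known to be nonzero. *)
Ltac gw := repeat progress (rewrite ?(invrK, invr1, mulr1, mul1r) -?mulrA; try gw_step).

Section Groups.
Variables (D : unitRingType) (hD : is_division_ring D).
Implicit Types (x y z g h : D) (A G H K N X Y E U V S T R : set D).

(** Conjugation from the left, so that [cj] is a left action; [normal_cj] and [normalP] translate
    from the right conjugation used in [normal]. *)
Definition cj g x := g * x * g^-1.

Lemma cjM g x y : g != 0 -> cj g (x * y) = cj g x * cj g y.
Proof. by move=> g0; rewrite /cj; gw. Qed.

Lemma cjD g x y : cj g (x + y) = cj g x + cj g y.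
Proof. by rewrite /cj mulrDr mulrDl. Qed.

Lemma cjN g x : cj g (- x) = - cj g x.
Proof. by rewrite /cj mulrN mulNr. Qed.

Lemma cj0 g : cj g 0 = 0.
Proof. by rewrite /cj mulr0 mul0r. Qed.

Lemma cj1 g : g != 0 -> cj g 1 = 1.
Proof. by move=> g0; rewrite /cj mulr1 muldV. Qed.

Lemma cjV g x : cj g x^-1 = (cj g x)^-1.
Proof. by rewrite /cj !(invMd hD) invrK mulrA. Qed.

Lemma cjJ g h x : cj (g * h) x = cj g (cj h x).
Proof. by rewrite /cj (invMd hD) !mulrA. Qed.

Lemma cjK g x : g != 0 -> cj g^-1 (cj g x) = x.
Proof. by move=> g0; rewrite /cj; gw. Qed.

Lemma cjKV g x : g != 0 -> cj g (cj g^-1 x) = x.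
Proof. by move=> g0; rewrite /cj; gw. Qed.

Lemma cj_eq0 g x : g != 0 -> (cj g x == 0) = (x == 0).
Proof. by move=> g0; rewrite /cj !(muld_eq0 hD) invd_eq0 (negPf g0) orbF. Qed.

Lemma cj_mul g x : g != 0 -> cj g x * g = g * x.
Proof. by move=> g0; rewrite /cj; gw. Qed.

Lemma cj_id g x : g != 0 -> g * x = x * g -> cj g x = x.
Proof. by move=> g0 e; rewrite /cj e; gw. Qed.

Lemma cj_idP g x : g != 0 -> cj g x = x -> g * x = x * g.
Proof. by move=> g0 e; rewrite -(cj_mul x g0) e. Qed.

(** With the inverses on the right, [cmm x y] is the factor by which conjugation by [x] moves [y]
    ([cmm_cj]). *)
Definition cmm x y := x * y * x^-1 * y^-1.

Lemma cmm_comm x y : cmm x y = comm x^-1 y^-1.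
Proof. by rewrite /cmm /comm !invrK. Qed.

Lemma comm_cmm x y : comm x y = cmm x^-1 y^-1.
Proof. by rewrite /cmm /comm !invrK. Qed.

Lemma cmm_cj x y : cmm x y = cj x y * y^-1.
Proof. by []. Qed.

Lemma cmm1P x y : x != 0 -> y != 0 -> cmm x y = 1 -> x * y = y * x.
Proof.
move=> x0 y0 e; apply: cj_idP => //; rewrite -[RHS]mul1r -e cmm_cj.
by rewrite /cj; gw.
Qed.

Lemma cmm_eq1 x y : x != 0 -> y != 0 -> x * y = y * x -> cmm x y = 1.
Proof. by move=> x0 y0 e; rewrite /cmm e; gw. Qed.

Lemma sgn0 H x : subgroup H -> H x -> x != 0.
Proof. by case=> h _ _ _ /h. Qed.
Lemma sg1 H : subgroup H -> H 1. Proof. by case. Qed.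
Lemma sgM H x y : subgroup H -> H x -> H y -> H (x * y).
Proof. by case=> _ _ h _; exact: h. Qed.
Lemma sgV H x : subgroup H -> H x -> H x^-1.
Proof. by case=> _ _ _ h; exact: h. Qed.
Lemma sgX H x n : subgroup H -> H x -> H (x ^+ n).
Proof.
move=> sH Hx; elim: n => [|n IH]; first by rewrite expr0; apply: sg1.
by rewrite exprS; apply: sgM.
Qed.
Lemma sgXz H x (n : int) : subgroup H -> H x -> H (x ^ n).
Proof.
move=> sH Hx; case: n => n; rewrite /exprz; first exact: sgX.
by apply: sgV => //; exact: sgX.
Qed.
Lemma sgcj H g x : subgroup H -> H g -> H x -> H (cj g x).
Proof. by move=> sH Hg Hx; apply: sgM (sgM sH Hg Hx) (sgV sH Hg). Qed.
Lemma sgcmm H g x : subgroup H -> H g -> H x -> H (cmm g x).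
Proof. by move=> sH Hg Hx; rewrite cmm_cj; apply: sgM (sgcj _ _ _) (sgV _ _). Qed.
Lemma sg_mulr H x y : subgroup H -> H x -> x != 0 -> H (x * y) -> H y.
Proof. by move=> sH hx x0 /(sgM sH (sgV sH hx)); rewrite mulKd. Qed.

Lemma normal_cj N G g x : normal N G -> G g -> N x -> N (cj g x).
Proof.
by case=> _ sG _ h Gg Nx; move: (h _ _ (sgV sG Gg) Nx); rewrite /cj invrK.
Qed.

Lemma normalP N G : subgroup N -> subgroup G -> N `<=` G ->
  (forall g x, G g -> N x -> N (cj g x)) -> normal N G.
Proof.
move=> sN sG sub h; split=> // g x Gg Nx.
by move: (h _ _ (sgV sG Gg) Nx); rewrite /cj invrK.
Qed.

Lemma nsgN N G : normal N G -> subgroup N. Proof. by case. Qed.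
Lemma nsgG N G : normal N G -> subgroup G. Proof. by case. Qed.
Lemma nsub N G : normal N G -> N `<=` G. Proof. by case. Qed.

Lemma normal_cmm N G g x : normal N G -> G g -> N x -> N (cmm g x).
Proof.
move=> nN Gg Nx; have sN := nsgN nN; have sG := nsgG nN.
by rewrite cmm_cj; apply: sgM => //; [exact: normal_cj nN _ _|exact: sgV].
Qed.

Lemma normal_cmm' N G g x : normal N G -> G g -> N x -> N (cmm x g).
Proof.
move=> nN Gg Nx; have sN := nsgN nN; have sG := nsgG nN.
have g0 := sgn0 sG Gg.
have -> : cmm x g = x * cj g x^-1 by rewrite /cmm /cj; gw.
by apply: sgM => //; apply: normal_cj nN Gg (sgV sN Nx).
Qed.

Lemma sgI H K : subgroup H -> subgroup K -> subgroup (H `&` K).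
Proof.
move=> sH sK; split.
- by move=> x [Hx _]; exact: sgn0 Hx.
- by split; apply: sg1.
- by move=> x y [? ?] [? ?]; split; apply: sgM.
- by move=> x [? ?]; split; apply: sgV.
Qed.

Lemma normalI N G H : normal N G -> subgroup H -> normal (N `&` H) (G `&` H).
Proof.
move=> nN sH; have sN := nsgN nN; have sG := nsgG nN.
apply: normalP; [exact: sgI|exact: sgI|by move=> x [/(nsub nN) ? ?]|].
move=> g x [Gg Hg] [Nx Hx]; split; [exact: normal_cj nN _ _|exact: sgcj].
Qed.

Lemma sgen_sub S : S `<=` gen S.
Proof. by move=> x Sx H _; apply. Qed.

Lemma gen_min S H : subgroup H -> S `<=` H -> gen S `<=` H.
Proof. by move=> sH SH x; apply. Qed.

Lemma sgDstar : subgroup (@Dstar D).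
Proof.
split=> //.
- exact: oner_neq0.
- by move=> x y hx hy; apply: muldn0.
- by move=> x hx; apply: invdn0.
Qed.

Lemma sg_gen S : S `<=` @Dstar D -> subgroup (gen S).
Proof.
move=> S0; split.
- exact: gen_min sgDstar S0.
- by move=> H sH _; apply: sg1.
- by move=> x y hx hy H sH SH; apply: sgM => //; [apply: hx|apply: hy].
- by move=> x hx H sH SH; apply: sgV => //; apply: hx.
Qed.

Lemma gen_cj S T g : S `<=` @Dstar D -> T `<=` @Dstar D -> g != 0 ->
  (forall x, S x -> gen T (cj g x)) -> forall x, gen S x -> gen T (cj g x).
Proof.
move=> S0 T0 g0 h; have sT := sg_gen T0.
apply: (@gen_min S [set x | gen T (cj g x)]) => //; split.
- by move=> x /= /(sgn0 sT); rewrite cj_eq0.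
- by rewrite /= cj1 //; apply: sg1 sT.
- by move=> x y /= hx hy; rewrite cjM //; apply: sgM sT _ _.
- by move=> x /= hx; rewrite cjV; apply: sgV sT _.
Qed.

(** * Derived series and solvability *)

Definition commutators H : set D :=
  [set z | exists x y, [/\ H x, H y & z = comm x y]].

Definition der H := gen (commutators H).

Lemma commutators_sub H : subgroup H -> commutators H `<=` H.
Proof.
by move=> sH _ [x [y [Hx Hy ->]]]; rewrite comm_cmm; apply: sgcmm => //; exact: sgV.
Qed.

Lemma commutators_n0 H : subgroup H -> commutators H `<=` @Dstar D.
Proof. by move=> sH x /(commutators_sub sH) /(sgn0 sH). Qed.

Lemma sg_der H : subgroup H -> subgroup (der H).
Proof. by move=> sH; apply/sg_gen/commutators_n0. Qed.

Lemma der_sub H : subgroup H -> der H `<=` H.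
Proof. by move=> sH; apply: gen_min => //; exact: commutators_sub. Qed.

Lemma der_comm H x y : H x -> H y -> der H (comm x y).
Proof. by move=> Hx Hy; apply: sgen_sub; exists x, y. Qed.

Lemma der_cmm H x y : subgroup H -> H x -> H y -> der H (cmm x y).
Proof. by move=> sH Hx Hy; rewrite cmm_comm; apply: der_comm; exact: sgV. Qed.

Lemma der_min H K : subgroup H -> subgroup K ->
  (forall x y, H x -> H y -> K (cmm x y)) -> der H `<=` K.
Proof.
move=> sH sK h; apply: gen_min => // _ [x [y [Hx Hy ->]]].
by rewrite comm_cmm; apply: h; apply: sgV.
Qed.

Lemma derS H K : subgroup H -> subgroup K -> H `<=` K -> der H `<=` der K.
Proof.
move=> sH sK HK; apply: der_min => //; first exact: sg_der.
by move=> x y /HK Kx /HK Ky; apply: der_cmm.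
Qed.

Lemma cj_comm g x y : g != 0 -> cj g (comm x y) = comm (cj g x) (cj g y).
Proof. by move=> g0; rewrite /comm !cjM // !cjV. Qed.

Lemma cj_cmm g x y : g != 0 -> cj g (cmm x y) = cmm (cj g x) (cj g y).
Proof. by move=> g0; rewrite /cmm !cjM // !cjV. Qed.

Lemma normal_der N G : normal N G -> normal (der N) G.
Proof.
move=> nN; have sN := nsgN nN; have sG := nsgG nN.
apply: normalP => //; first exact: sg_der.
  by move=> x /(der_sub sN)/(nsub nN).
move=> g x Gg; have g0 := sgn0 sG Gg.
apply: gen_cj => //; try exact: commutators_n0.
move=> _ [y [z [Ny Nz ->]]]; rewrite cj_comm //.
by apply: der_comm; apply: normal_cj nN _ _.
Qed.

Lemma normal_refl G : subgroup G -> normal G G.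
Proof. by move=> sG; apply: normalP => // g x; apply: sgcj. Qed.

Definition derk k H := iter k der H.

Lemma sg_derk k H : subgroup H -> subgroup (derk k H).
Proof. by move=> sH; elim: k => //= k; exact: sg_der. Qed.

Lemma normal_derk k N G : normal N G -> normal (derk k N) G.
Proof. by move=> nN; elim: k => //= k; exact: normal_der. Qed.

Lemma derkS k H K : subgroup H -> subgroup K -> H `<=` K ->
  derk k H `<=` derk k K.
Proof.
by move=> sH sK HK; elim: k => //= k IH; apply: derS => //; apply: sg_derk.
Qed.

(** The derived series replaces an arbitrary chain because its terms stay normal wherever [H] is
    normal ([normal_derk]). *)
Definition solv H := exists k, derk k H `<=` [set 1].

Lemma solvable_solv H : subgroup H -> solvable H -> solv H.
Proof.
move=> sH [n [S [S0 Sn hS]]]; exists n; rewrite -Sn.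
suff: forall k, (k <= n)%N -> subgroup (S k) /\ derk k H `<=` S k.
  by move=> h; have [_ hh] := h n (leqnn n); exact: hh.
elim=> [|k IH] kn; first by rewrite S0; split=> // x.
have [sk dk] := IH (ltnW kn).
have [nk ck] := hS k kn; split; first exact: nsgN nk.
apply: der_min => /=; [exact: sg_derk|exact: nsgN nk|].
move=> x y /dk Sx /dk Sy; rewrite cmm_comm; apply: ck; exact: sgV.
Qed.

Lemma solvS H K : subgroup H -> subgroup K -> H `<=` K -> solv K -> solv H.
Proof.
by move=> sH sK HK [k hk]; exists k => x /(derkS sH sK HK) /hk.
Qed.

(** * Centralizers and division subrings *)

Definition centr S : set D := [set x | forall y, S y -> x * y = y * x].

Definition divring U := subring U /\ forall x, U x -> U x^-1.
Definition star U : set D := [set x | U x /\ x != 0].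
Definition Dgen S : set D := [set x | forall R, divring R -> S `<=` R -> R x].

Section DivringOps.
Variables (U : set D) (dU : divring U).
Lemma dr0 : U 0. Proof. by case: dU => [[]]. Qed.
Lemma dr1 : U 1. Proof. by case: dU => [[]]. Qed.
Lemma drN x : U x -> U (- x). Proof. by case: dU => [[_ _ h _ _] _]; exact: h. Qed.
Lemma drD x y : U x -> U y -> U (x + y).
Proof. by case: dU => [[_ _ _ h _] _]; exact: h. Qed.
Lemma drM x y : U x -> U y -> U (x * y).
Proof. by case: dU => [[_ _ _ _ h] _]; exact: h. Qed.
Lemma drB x y : U x -> U y -> U (x - y).
Proof. by move=> ? ?; apply: drD => //; apply: drN. Qed.
Lemma drV x : U x -> U x^-1. Proof. by case: dU => [_ h]; exact: h. Qed.
Lemma drX x n : U x -> U (x ^+ n).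
Proof.
move=> Ux; elim: n => [|n IH]; rewrite ?expr0 ?exprS; first exact: dr1.
exact: drM.
Qed.
Lemma drXz x (n : int) : U x -> U (x ^ n).
Proof. by move=> Ux; case: n => n; rewrite /exprz; [|apply: drV]; apply: drX. Qed.
Lemma drcj g x : U g -> U x -> U (cj g x).
Proof. by move=> Ug Ux; apply: drM (drM Ug Ux) (drV Ug). Qed.
Lemma drVE x : U x^-1 -> U x. Proof. by move=> /drV; rewrite invrK. Qed.
Lemma dr_sum I (r : seq I) (F : I -> D) :
  (forall i, U (F i)) -> U (\sum_(i <- r) F i).
Proof.
move=> h; elim: r => [|i r IH]; rewrite ?big_nil ?big_cons; first exact: dr0.
exact: drD.
Qed.
Lemma sg_star : subgroup (star U).
Proof.
split.
- by move=> x [].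
- by split; [exact: dr1|exact: oner_neq0].
- by move=> x y [? ?] [? ?]; split; [apply: drM|apply: muldn0].
- by move=> x [? ?]; split; [apply: drV|apply: invdn0].
Qed.
End DivringOps.

Lemma divringT : divring [set: D].
Proof. by []. Qed.

Lemma divringI U E : divring U -> divring E -> divring (U `&` E).
Proof.
move=> dU dE; split; [split|].
- by split; apply: dr0.
- by split; apply: dr1.
- by move=> x [? ?]; split; apply: drN.
- by move=> x y [? ?] [? ?]; split; apply: drD.
- by move=> x y [? ?] [? ?]; split; apply: drM.
- by move=> x [? ?]; split; apply: drV.
Qed.

Lemma commV x y : x * y = y * x -> x^-1 * y = y * x^-1.
Proof.
case: (eqVneq x 0) => [->|x0 e]; first by rewrite invr0 mul0r mulr0.
by apply: (@mulDI D hD _ _ x) => //; gw; rewrite mulrA e; gw.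
Qed.

Lemma divring_centr S : divring (centr S).
Proof.
split; [split|].
- by move=> y _; rewrite mul0r mulr0.
- by move=> y _; rewrite mul1r mulr1.
- by move=> x h y Sy; rewrite mulNr mulrN h.
- by move=> x y h h' z Sz; rewrite mulrDl mulrDr h ?h'.
- by move=> x y h h' z Sz; rewrite -mulrA h' // mulrA h // mulrA.
- by move=> x h y Sy; apply: commV; apply: h.
Qed.

Lemma divring_Dgen S : divring (Dgen S).
Proof.
split; [split|].
- by move=> R dR _; apply: dr0.
- by move=> R dR _; apply: dr1.
- by move=> x h R dR SR; apply: drN => //; apply: h.
- by move=> x y h h' R dR SR; apply: drD => //; [apply: h|apply: h'].
- by move=> x y h h' R dR SR; apply: drM => //; [apply: h|apply: h'].
- by move=> x h R dR SR; apply: drV => //; apply: h.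
Qed.

Lemma Dgen_sub S : S `<=` Dgen S.
Proof. by move=> x Sx R _; apply. Qed.

Lemma Dgen_min S R : divring R -> S `<=` R -> Dgen S `<=` R.
Proof. by move=> dR SR x; apply. Qed.

Lemma abelian_Dgen S : abelian S -> abelian (Dgen S).
Proof.
move=> aS.
have h1 : Dgen S `<=` centr S.
  by apply: Dgen_min => [|x Sx y Sy]; [exact: divring_centr|exact: aS].
have h2 : Dgen S `<=` centr (Dgen S).
  apply: Dgen_min => [|x Sx y Sy]; first exact: divring_centr.
  by rewrite (h1 _ Sy).
by move=> x y Sx Sy; apply: h2.
Qed.

Lemma divring_cj_pre U g : divring U -> g != 0 -> divring [set x | U (cj g x)].
Proof.
move=> dU g0; split; [split|] => /=.
- by rewrite cj0; apply: dr0.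
- by rewrite cj1 //; apply: dr1.
- by move=> x h; rewrite cjN; apply: drN.
- by move=> x y h h'; rewrite cjD; apply: drD.
- by move=> x y h h'; rewrite cjM //; apply: drM.
- by move=> x h; rewrite cjV; apply: drV.
Qed.

Lemma Dgen_cj S T g : g != 0 -> (forall x, S x -> Dgen T (cj g x)) ->
  forall x, Dgen S x -> Dgen T (cj g x).
Proof.
move=> g0 h; apply: (@Dgen_min S [set x | Dgen T (cj g x)]) => //.
by apply: divring_cj_pre => //; exact: divring_Dgen.
Qed.

(** Both inclusions are required, since conjugation may map an infinite set properly into itself. *)
Definition normz E : set D :=
  [set g | [/\ g != 0, forall e, E e -> E (cj g e) &
                       forall e, E e -> E (cj g^-1 e)]].

Lemma sg_normz E : subgroup (normz E).
Proof.
split.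
- by move=> x [].
- split; first exact: oner_neq0.
    by move=> e Ee; rewrite /cj invr1 mul1r mulr1.
  by move=> e Ee; rewrite /cj !invr1 mul1r mulr1.
- move=> x y [x0 h1 h2] [y0 h3 h4]; split; first exact: muldn0.
    by move=> e Ee; rewrite cjJ; apply: h1; apply: h3.
  by move=> e Ee; rewrite (invMd hD) cjJ; apply: h4; apply: h2.
- by move=> x [x0 h1 h2]; split; rewrite ?invrK //; exact: invdn0.
Qed.

Lemma normz_n0 E g : normz E g -> g != 0. Proof. by case. Qed.
Lemma normz_cj E g e : normz E g -> E e -> E (cj g e).
Proof. by case=> _ h _; exact: h. Qed.
Lemma normz_cjV E g e : normz E g -> E e -> E (cj g^-1 e).
Proof. by case=> _ _ h; exact: h. Qed.
Lemma normz_cjE E g e : normz E g -> E (cj g e) -> E e.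
Proof. by move=> h /(normz_cjV h); rewrite cjK //; exact: normz_n0 h. Qed.

Lemma normal_normz N G : normal N G -> G `<=` normz N.
Proof.
move=> nN g Gg; have sG := nsgG nN; split; first exact: sgn0 Gg.
  by move=> e; exact: normal_cj nN _.
by move=> e; apply: normal_cj nN _; exact: sgV.
Qed.

Lemma normz_star E g : divring E -> star E g -> normz E g.
Proof.
move=> dE [Eg g0]; split=> // e Ee; apply: drcj => //; exact: drV.
Qed.

Lemma normz_centr_in E g : g != 0 -> centr E g -> normz E g.
Proof.
move=> g0 h; split => // e Ee.
  by rewrite cj_id ?h.
by rewrite cj_id ?invdn0 //; apply: commV; apply: h.
Qed.

Lemma normz_centr E g : normz E g -> normz (centr E) g.
Proof.
have aux : forall h x, normz E h -> centr E x -> centr E (cj h x).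
  move=> h x nh cx e Ee; have h0 := normz_n0 nh.
  rewrite -[e](cjKV _ h0) -!cjM //; congr cj; apply: cx; exact: normz_cjV.
move=> ng; split; first exact: normz_n0 ng.
  by move=> e; exact: aux.
by move=> e; apply: aux; apply: sgV ng; exact: sg_normz.
Qed.

Lemma normz_Dgen S g : normz S g -> normz (Dgen S) g.
Proof.
move=> ng; split; first exact: normz_n0 ng.
  apply: Dgen_cj => [|x Sx]; first exact: normz_n0 ng.
  by apply: Dgen_sub; exact: normz_cj.
apply: Dgen_cj => [|x Sx]; first by apply/invdn0/(normz_n0 ng).
by apply: Dgen_sub; exact: normz_cjV.
Qed.

Lemma normzU S T g : normz S g -> normz T g -> normz (S `|` T) g.
Proof.
move=> [g0 h1 h2] [_ h3 h4]; split => // e [?|?];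
  by [left; auto|right; auto].
Qed.

Lemma normz_star_sub E : divring E -> normz E `<=` normz (star E).
Proof.
move=> dE g [g0 h1 h2]; split=> // e [Ee e0]; split; auto; rewrite cj_eq0 //.
exact: invdn0.
Qed.

(** Subnormality is taken inside a division ring [U] and with its depth, for inductions in which [U]
    varies: cutting down to [V] preserves the depth ([subnorm_I]). *)
Inductive subnorm U : nat -> set D -> Prop :=
| subnorm_star : subnorm U 0 (star U)
| subnorm_step n X Y : subnorm U n Y -> normal X Y -> subnorm U n.+1 X.

Lemma subnorm_sg U n X : divring U -> subnorm U n X -> subgroup X.
Proof. by move=> dU; case=> [|m Y Z _ nY]; [exact: sg_star|exact: nsgN nY]. Qed.

Lemma subnorm_sub U n X : divring U -> subnorm U n X -> X `<=` star U.
Proof. by move=> dU; elim=> // m Y Z _ IH nY x /(nsub nY) /IH. Qed.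

Lemma subnorm_I U V n X : divring U -> divring V -> V `<=` U ->
  subnorm U n X -> subnorm V n (X `&` V).
Proof.
move=> dU dV VU.
have VE : forall Y, Y `<=` star U -> Y `&` V = Y `&` star V.
  move=> Y YU; apply/seteqP; split=> x [Yx Vx]; split => //; last by case: Vx.
  by split=> //; case: (YU _ Yx).
elim=> [|m Y Z sY IH nY].
  have -> : star U `&` V = star V.
    by apply/seteqP; split=> [x [[? ?] ?]|x [Vx ?]]; do !split => //; exact: VU.
  exact: subnorm_star.
rewrite VE; last by move=> x /(nsub nY)/(subnorm_sub dU sY).
apply: subnorm_step IH _; rewrite VE; last exact: subnorm_sub sY.
by apply: normalI => //; exact: sg_star.
Qed.

Lemma subnorm_der U n X k : divring U -> subnorm U n.+1 X -> subnorm U n.+1 (derk k X).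
Proof.
move=> dU h; inversion h as [|? ? Y sY nX]; subst.
by apply: subnorm_step sY _; exact: normal_derk.
Qed.

(** If [f] and [g] are the conjugates of [e] by [x] and [1 + x], then [(f - g) * x = g - e]. Either
    [f != g] and [x] is a quotient of elements of [E], or [f = g = e] and [x] commutes with [e]. *)
Lemma scott E x : divring E -> normz E x -> normz E (1 + x) ->
  E x \/ centr E x.
Proof.
move=> dE nx n1; case: (pselect (E x)) => [|nE]; [by left|right].
have x0 := normz_n0 nx; have x10 := normz_n0 n1.
move=> e Ee; have Ef := normz_cj nx Ee; have Eg := normz_cj n1 Ee.
have efx := cj_mul e x0; have egx := cj_mul e x10.
move: Ef Eg efx egx; move: (cj x e) (cj (1 + x) e) => f g Ef Eg efx egx.
have h : (f - g) * x = g - e.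
  rewrite mulrBl efx; apply/eqP; rewrite subr_eq.
  move: egx; rewrite mulrDr mulrDl mulr1 mul1r => egx.
  by rewrite addrAC egx addrAC subrr add0r.
case: (eqVneq f g) => [fg|fg].
  move: h; rewrite fg subrr mul0r => /esym/eqP; rewrite subr_eq0 => /eqP ge.
  by rewrite -efx fg ge.
case: nE; have -> : x = (f - g)^-1 * (g - e) by rewrite -h mulKd ?subr_eq0.
by apply: drM => //; [apply: drV|]; rewrite //; apply: drB.
Qed.

(** By [scott] every element of [U] outside [E] centralizes [E]; an element [z] of [E] does too,
    being the difference of [x + z] and [x], both outside [E]. *)
Lemma cartan_brauer_hua U E : divring U -> divring E -> E `<=` U ->
  star U `<=` normz E -> E = U \/ U `<=` centr E.
Proof.
move=> dU dE EU UN; case: (pselect (U `<=` E)) => [UE|nUE].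
  by left; apply/seteqP.
right; have /existsNP [x /not_implyP [Ux nEx]] := nUE.
have key : forall z, U z -> ~ E z -> centr E z.
  move=> z Uz nz; have z0 : z != 0 by apply/eqP => ez; apply: nz; rewrite ez; apply: dr0.
  have z10 : 1 + z != 0.
    apply/eqP => ez; apply: nz; have -> : z = - 1 by rewrite -[z](addKr 1) ez addr0.
    by apply: drN => //; apply: dr1.
  case: (@scott E z) => //; apply: UN; split => //.
  by apply: drD => //; apply: dr1.
move=> z Uz; case: (pselect (E z)) => [Ez|]; last exact: key.
move=> e Ee; have nxz : ~ E (x + z) by move=> h; apply: nEx; rewrite -(addrK z x); apply: drB.
have := key _ (drD dU Ux Uz) nxz _ Ee.
by rewrite mulrDl mulrDr (key x) // => /addrI.
Qed.

End Groups.

(** * Spans and Ore localization *)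

Lemma ex_min (P : nat -> Prop) : (exists n, P n) ->
  exists n, P n /\ forall k, P k -> (n <= k)%N.
Proof.
move=> [n Pn]; have ex : exists n, `[< P n >] by exists n; apply/asboolP.
case: (ex_minnP ex) => m /asboolP Pm hm; exists m; split=> // k Pk.
by apply: hm; apply/asboolP.
Qed.

Section Span.
Variables (D : unitRingType) (hD : is_division_ring D).
Implicit Types (x y z : D) (E T : set D).

Lemma homogeneous_system E m n (a : 'I_n -> 'I_m -> D) : divring E ->
  (m < n)%N -> (forall j i, E (a j i)) ->
  exists c : 'I_n -> D, [/\ forall j, E (c j), exists j, c j != 0 &
    forall i, \sum_j c j * a j i = 0].
Proof.
move=> dE; elim: m n a => [|m IH] n a mn Ea.
  exists (fun=> 1); split=> [_||[]//]; first exact: dr1.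
  by exists (Ordinal mn); exact: oner_neq0.
case: n => // n in a mn Ea *.
case: (pselect (exists j, a j ord0 != 0)) => [[j0 aj0]|h]; last first.
  have [c [Ec c0 ec]] := IH n.+1 (fun j i => a j (lift ord0 i)) (ltnW mn)
     (fun j i => Ea _ _).
  exists c; split=> // i; case: (unliftP ord0 i) => [i' ->|->]; first exact: ec.
  rewrite big1 // => j _; case: (eqVneq (a j ord0) 0) => [->|aj]; rewrite ?mulr0 //.
  by case: h; exists j.
pose b k := a (lift j0 k) ord0 * (a j0 ord0)^-1.
have Eb k : E (b k) by apply: drM => //; apply: drV.
have [||c [Ec [k0 ck0] ec]] :=
   IH n (fun k i => a (lift j0 k) (lift ord0 i) - b k * a j0 (lift ord0 i)) => //.
  by move=> j i; apply: drB => //; apply: drM.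
pose c' j := if unlift j0 j is Some k then c k else - \sum_k c k * b k.
have c'l k : c' (lift j0 k) = c k by rewrite /c' liftK.
exists c'; split.
- move=> j; rewrite /c'; case: unlift => [k|] //; apply: drN => //.
  by apply: dr_sum => // k; apply: drM.
- by exists (lift j0 k0); rewrite c'l.
- move=> i; rewrite (bigD1_ord j0) //= {1}/c' unlift_none mulNr mulr_suml.
  rewrite addrC -sumrB; case: (unliftP ord0 i) => [i' ->|->].
    rewrite -[RHS](ec i'); apply: eq_bigr => k _.
    by rewrite c'l mulrBr [in RHS]mulrA.
  rewrite big1 // => k _; rewrite c'l /b -!mulrA mulVd // mulr1 subrr //.
Qed.

Definition lsum (s : seq (D * D)) : D := \sum_(p <- s) p.1 * p.2.
Definition lgood E T (s : seq (D * D)) :=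
  forall p, p \in s -> E p.1 /\ T p.2.
Definition span E T : set D := [set x | exists2 s, lgood E T s & x = lsum s].

Lemma lsum_cons p s : lsum (p :: s) = p.1 * p.2 + lsum s.
Proof. by rewrite /lsum big_cons. Qed.

Lemma lsum_cat s1 s2 : lsum (s1 ++ s2) = lsum s1 + lsum s2.
Proof. by rewrite /lsum big_cat. Qed.

Lemma lgood_cons E T p s :
  lgood E T (p :: s) <-> [/\ E p.1, T p.2 & lgood E T s].
Proof.
split=> [h|[h1 h2 h3] q].
  have [h1 h2] := h p (mem_head _ _); split=> // q qs.
  by apply: h; rewrite inE qs orbT.
by rewrite inE => /orP [/eqP ->|/h3].
Qed.

Lemma span0 E T : span E T 0.
Proof. by exists [::]; rewrite // /lsum big_nil. Qed.

Lemma spanD E T x y : span E T x -> span E T y -> span E T (x + y).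
Proof.
move=> [s gs ->] [s' gs' ->]; exists (s ++ s'); rewrite ?lsum_cat //.
by move=> p; rewrite mem_cat => /orP [/gs|/gs'].
Qed.

Lemma span_sum E T (I : eqType) (r : seq I) (F : I -> D) :
  (forall i, i \in r -> span E T (F i)) -> span E T (\sum_(i <- r) F i).
Proof.
elim: r => [|i r IH] h; rewrite ?big_nil ?big_cons; first exact: span0.
apply: spanD; first by apply: h; rewrite mem_head.
by apply: IH => j jr; apply: h; rewrite inE jr orbT.
Qed.

Lemma span1 E T e t : E e -> T t -> span E T (e * t).
Proof.
move=> Ee Tt; exists [:: (e, t)]; last by rewrite /lsum big_seq1.
by move=> p; rewrite inE => /eqP ->.
Qed.

Lemma span_mem E T t : divring E -> T t -> span E T t.
Proof. by move=> dE Tt; rewrite -[t]mul1r; apply: span1 => //; apply: dr1. Qed.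

Lemma spanZ E T e x : divring E -> E e -> span E T x -> span E T (e * x).
Proof.
move=> dE Ee [s gs ->]; rewrite /lsum big_distrr /=; apply: span_sum => p /gs [? ?].
by rewrite mulrA; apply: span1 => //; apply: drM.
Qed.

Lemma spanN E T x : divring E -> span E T x -> span E T (- x).
Proof.
by move=> dE Sx; rewrite -mulN1r; apply: spanZ => //; apply: drN => //; apply: dr1.
Qed.

Lemma spanB E T x y : divring E -> span E T x -> span E T y -> span E T (x - y).
Proof. by move=> dE Sx Sy; apply: spanD => //; apply: spanN. Qed.

Lemma span_min E T (S : set D) : S 0 -> (forall x y, S x -> S y -> S (x + y)) ->
  (forall e t, E e -> T t -> S (e * t)) -> span E T `<=` S.
Proof.
move=> S0 SD Set_ x [s gs ->]; elim: s gs => [|p s IH] gs.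
  by rewrite /lsum big_nil.
rewrite lsum_cons; move/lgood_cons: gs => [? ? /IH ?].
by apply: SD => //; apply: Set_.
Qed.

Lemma span_seqP E (l : seq D) x : divring E -> span E [set` l] x ->
  exists2 c : 'I_(size l) -> D, (forall i, E (c i)) & x = \sum_i c i * l`_i.
Proof.
move=> dE; move: x; apply: span_min => [|x y [c Ec ->] [c' Ec' ->]|e t Ee /= lt].
- exists (fun=> 0); first by move=> _; apply: dr0.
  by rewrite big1 // => i _; rewrite mul0r.
- exists (fun i => c i + c' i); first by move=> i; apply: drD.
  by rewrite -big_split; apply: eq_bigr => i _; rewrite mulrDl.
- have it : (index t l < size l)%N by rewrite index_mem.
  exists (fun i => if i == Ordinal it then e else 0).
    by move=> i; case: eqP => _ //; apply: dr0.
  rewrite (bigD1 (Ordinal it)) //= eqxx nth_index // big1 ?addr0 //.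
  by move=> i /negPf ->; rewrite mul0r.
Qed.

Lemma span_dependent E (l : seq D) n (w : 'I_n -> D) : divring E ->
  (size l < n)%N -> (forall j, span E [set` l] (w j)) ->
  exists c : 'I_n -> D, [/\ forall j, E (c j), exists j, c j != 0 &
    \sum_j c j * w j = 0].
Proof.
move=> dE ln hw.
have /choice [a ha] : forall j, exists a : 'I_(size l) -> D,
    (forall i, E (a i)) /\ w j = \sum_i a i * l`_i.
  by move=> j; have [a ? ?] := span_seqP dE (hw j); exists a.
have [|c [Ec c0 ec]] := homogeneous_system dE ln (a := a).
  by move=> j i; case: (ha j).
exists c; split=> //.
under eq_bigr do rewrite (ha _).2 mulr_sumr.
rewrite exchange_big big1 //= => i _.
by under eq_bigr do rewrite mulrA; rewrite -mulr_suml ec mul0r.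
Qed.

End Span.

Section Ore.
Variables (D : unitRingType) (hD : is_division_ring D).
Variables (E N : set D).
Hypotheses (dE : divring E) (sN : subgroup N).
Hypothesis NE : N `<=` normz E.
Hypothesis abN : forall x y, N x -> N y -> E (cmm x y).
Implicit Types (x y z f g : D).

Local Notation R := (span E N).

Let Nn0 x : N x -> x != 0. Proof. exact: sgn0. Qed.

Lemma crossM x y : R x -> R y -> R (x * y).
Proof.
move=> Rx [s gs ->]; rewrite /lsum big_distrr /=; apply: span_sum => p ps.
have {gs ps} [Ep Np] := gs p ps; move: x Rx; apply: span_min => [|u v|e t Ee Nt].
- by rewrite mul0r; apply: span0.
- by move=> Ru Rv; rewrite mulrDl; apply: spanD.
- have -> : e * t * (p.1 * p.2) = (e * cj t p.1) * (t * p.2).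
    by have ? := Nn0 Nt; rewrite /cj; gw.
  by apply: span1; [apply: drM => //; apply: normz_cj (NE Nt) _|apply: sgM].
Qed.

Lemma cross_coef x : E x -> R x.
Proof. by move=> Ex; rewrite -[x]mulr1; apply: span1 => //; apply: sg1. Qed.

Lemma cross_grp x : N x -> R x.
Proof. by apply: span_mem. Qed.

Lemma cross1 : R 1.
Proof. by apply: cross_grp; exact: sg1. Qed.

(** Equality up to a left factor from [star E]; modulo [eqm] the group [N] is commutative, so that
    words can be sorted into monomials. *)
Let eqm x y := exists2 e, star E e & x = e * y.

Let eqm_refl x : eqm x x.
Proof. by exists 1; [split; [apply: dr1|apply: oner_neq0]|rewrite mul1r]. Qed.

Let eqm_trans y x z : eqm x y -> eqm y z -> eqm x z.
Proof.
move=> [e he ->] [e' he' ->]; exists (e * e'); last by rewrite mulrA.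
exact: sgM (sg_star hD dE) _ _.
Qed.

Let eqm_mulr x y z : eqm x y -> eqm (x * z) (y * z).
Proof. by move=> [e he ->]; exists e; rewrite ?mulrA. Qed.

Let eqm_mull x y z : N z -> eqm x y -> eqm (z * x) (z * y).
Proof.
move=> Nz [e [Ee e0] ->]; have z0 := Nn0 Nz; exists (cj z e); last by rewrite /cj; gw.
by split; [exact: normz_cj (NE Nz) _|rewrite cj_eq0].
Qed.

Let eqm_comm x y : N x -> N y -> eqm (x * y) (y * x).
Proof.
move=> Nx Ny; have x0 := Nn0 Nx; have y0 := Nn0 Ny.
exists (cmm x y); last by rewrite /cmm; gw.
split; [exact: abN|]; apply: Nn0; exact: sgcmm.
Qed.

Fixpoint monomials (ts : seq D) n : seq D :=
  if ts is t :: ts' then [seq x * t ^+ j | x <- monomials ts' n, j <- iota 0 n.+1]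
  else [:: 1].

Lemma size_monomials ts n : size (monomials ts n) = (n.+1 ^ size ts)%N.
Proof.
elim: ts => // t ts IH.
have := size_allpairs (fun x j => x * t ^+ j) (monomials ts n) (iota 0 n.+1).
by rewrite IH size_iota -expnSr.
Qed.

Lemma mem_monomials t ts n x : (x \in monomials (t :: ts) n) <->
  exists y j, [/\ y \in monomials ts n, (j <= n)%N & x = y * t ^+ j].
Proof.
rewrite -[monomials (t :: ts) n]/[seq y * t ^+ j | y <- monomials ts n, j <- iota 0 n.+1].
split=> [/allpairsP [[y j] [hy hj ->]]|[y [j [hy hj ->]]]].
  by exists y, j; split=> //; move: hj; rewrite mem_iota.
by apply/allpairsP; exists (y, j); split=> //; rewrite mem_iota.
Qed.

Lemma monomialsS ts n x : x \in monomials ts n -> x \in monomials ts n.+1.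
Proof.
elim: ts x => // t ts IH x /mem_monomials [y [j [/IH hy hj ->]]].
by apply/mem_monomials; exists y, j; split=> //; exact: ltnW.
Qed.

Lemma monomials_sub ts n x : (forall t, t \in ts -> N t) ->
  x \in monomials ts n -> N x.
Proof.
elim: ts x => [|t ts IH] x hts; first by rewrite inE => /eqP ->; apply: sg1.
move=> /mem_monomials [y [j [hy _ ->]]]; apply: sgM => //.
  by apply: IH hy => u hu; apply: hts; rewrite inE hu orbT.
by apply: sgX => //; apply: hts; rewrite mem_head.
Qed.

Lemma monomials_mul ts n x t : (forall t, t \in ts -> N t) ->
  x \in monomials ts n -> t \in ts ->
  exists2 y, y \in monomials ts n.+1 & eqm (x * t) y.
Proof.
elim: ts n x t => // t0 ts IH n x t hts /mem_monomials [y [j [hy hj ->]]].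
have Nt0 : N t0 by apply: hts; rewrite mem_head.
have hts' u : u \in ts -> N u by move=> hu; apply: hts; rewrite inE hu orbT.
rewrite inE => /orP [/eqP ->|ht].
  exists (y * t0 ^+ j.+1); last by rewrite exprSr mulrA; apply: eqm_refl.
  by apply/mem_monomials; exists y, j.+1; split=> //; exact: monomialsS.
have [z hz yz] := IH n y t hts' hy ht.
exists (z * t0 ^+ j).
  by apply/mem_monomials; exists z, j; split=> //; exact: ltnW.
apply: (@eqm_trans (y * t * t0 ^+ j)); last exact: eqm_mulr.
rewrite -!mulrA; apply: eqm_mull; first exact: monomials_sub hy.
by apply: eqm_comm; [apply: sgX|apply: hts'].
Qed.

Lemma pow_lt_exp k : exists n, (n.+1 ^ k < 2 ^ n)%N.
Proof.
(* For [n + 1 = 2 ^ (2 * m)] the claim amounts to [2 * m * k + 1 < (2 ^ m) ^ 2], and [(m + 1) ^ 2]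
   already exceeds the left-hand side. *)
pose m := (2 * k + 1)%N; have hm : (m.+1 <= 2 ^ m)%N by exact: ltn_expl.
exists (2 ^ (2 * m)).-1; rewrite prednK ?expn_gt0 // -expnM ltn_exp2l //.
rewrite -ltnS prednK ?expn_gt0 // mulnC expnM expnAC.
apply: leq_trans (_ : (m.+1 ^ 2 <= _)%N); last by rewrite leq_exp2r.
rewrite /m; lia.
Qed.

Fixpoint words n f g : set D :=
  if n is n'.+1 then
    [set x | exists2 w, words n' f g w & x = w * f \/ x = w * g]
  else [set 1].

Lemma words_span n f g ts : (forall t, t \in ts -> N t) ->
  span E [set` ts] f -> span E [set` ts] g ->
  words n f g `<=` span E [set` monomials ts n].
Proof.
move=> hts hf hg.
have step k h w : span E [set` ts] h -> span E [set` monomials ts k] w ->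
    span E [set` monomials ts k.+1] (w * h).
  move=> hh; move: w; apply: span_min => [|x y|e x Ee hx].
  - by rewrite mul0r; apply: span0.
  - by move=> ? ?; rewrite mulrDl; apply: spanD.
  move: h hh; apply: span_min => [|y z|e' t Ee' ht].
  - by rewrite mulr0; apply: span0.
  - by move=> ? ?; rewrite mulrDr; apply: spanD.
  have Nx := monomials_sub hts hx; have x0 := Nn0 Nx.
  have -> : e * x * (e' * t) = (e * cj x e') * (x * t) by rewrite /cj; gw.
  have [y hy [e2 [Ee2 _] ->]] := monomials_mul hts hx ht.
  rewrite mulrA; apply: span1 => //; apply: drM => //; apply: drM => //.
  exact: normz_cj (NE Nx) _.
elim: n => [|n IH] x /=.
  move=> ->; apply: span_mem => //=; elim: ts {hts hf hg step} => [|t ts IH].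
    by rewrite inE.
  by apply/mem_monomials; exists 1, 0%N; rewrite mulr1.
by move=> [w /IH hw [->|->]]; apply: step.
Qed.

(** Grouping a relation among words of length [n + 1] by the last letter gives [a * f = - b * g],
    with [a] and [b] combinations of words of length [n]; both vanish, and induction applies to
    each. *)
Lemma words_free n f g : f != 0 -> g != 0 ->
  (forall a b, R a -> R b -> a * f = b * g -> a = 0) -> R f -> R g ->
  exists w : 'I_(2 ^ n) -> D, (forall i, words n f g (w i) /\ R (w i)) /\
   forall c : 'I_(2 ^ n) -> D, (forall i, E (c i)) -> \sum_i c i * w i = 0 ->
   forall i, c i = 0.
Proof.
move=> f0 g0 ore Rf Rg; elim: n => [|n [w [hw fw]]].
  exists (fun=> 1); split=> [i|c Ec]; first by split=> //; apply: cross1.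
  by rewrite big_ord1 mulr1 => h i; rewrite ord1.
rewrite expnS mul2n -addnn.
exists (fun i => match split i with inl j => w j * f | inr j => w j * g end).
split=> [i|c Ec].
  by case: split => j; have [? ?] := hw j; split; try exact: crossM;
    exists (w j) => //; [left|right].
rewrite big_split_ord /=.
under eq_bigr do rewrite (unsplitK (inl _)) mulrA.
under [X in _ + X = _]eq_bigr do rewrite (unsplitK (inr _)) mulrA.
rewrite -!mulr_suml => /eqP; rewrite addr_eq0 -mulNr => /eqP e.
have R1 (d : 'I_(2 ^ n) -> D) : (forall i, E (d i)) -> R (\sum_i d i * w i).
  move=> Ed; apply: span_sum => i _; apply: spanZ => //; exact: (hw i).2.
have z1 := ore _ _ (R1 _ (fun i => Ec _)) (spanN dE (R1 _ (fun i => Ec _))) e.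
have z2 : \sum_i c (rshift (2 ^ n) i) * w i = 0.
  move: e; rewrite z1 mul0r mulNr => /esym/eqP.
  by rewrite oppr_eq0 (muld_eq0 hD) (negPf g0) orbF => /eqP.
move=> i; rewrite -(splitK i); case: split => j /=.
  exact: (fw _ (fun i => Ec (lshift _ i)) z1).
exact: (fw _ (fun i => Ec (rshift _ i)) z2).
Qed.

(* Otherwise the [2 ^ n] words of length [n] in [f] and [g] would be independent,
   but they lie in a space of dimension polynomial in [n], as [N] is abelian
   modulo [E]. *)
Lemma ore f g : R f -> R g -> f != 0 -> g != 0 ->
  exists a b, [/\ R a, R b, a != 0 & a * f = b * g].
Proof.
move=> Rf Rg f0 g0; apply: contrapT => no.
have [s gs ef] := Rf; have [s' gs' eg] := Rg.
pose ts := map snd (s ++ s').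
have hts t : t \in ts -> N t.
  by move=> /mapP [p]; rewrite mem_cat => /orP [/gs|/gs'] [_ ?] ->.
have sf : span E [set` ts] f.
  exists s => // p ps; split; first by case: (gs p ps).
  by rewrite /=; apply: map_f; rewrite mem_cat ps.
have sg : span E [set` ts] g.
  exists s' => // p ps; split; first by case: (gs' p ps).
  by rewrite /=; apply: map_f; rewrite mem_cat ps orbT.
have [n hn] := pow_lt_exp (size ts).
have [|w [hw fw]] := @words_free n f g f0 g0 _ Rf Rg.
  move=> a b Ra Rb e; apply/eqP; case: (eqVneq a 0) => // a0.
  by case: no; exists a, b.
have [||c [Ec [j /negP cj0] ec]] := @span_dependent D hD E (monomials ts n) _ w dE.
- by rewrite size_monomials.
- by move=> j; apply: (words_span hts sf sg); exact: (hw j).1.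
by apply: cj0; rewrite (fw c Ec ec).
Qed.

Definition Frac : set D := [set d | exists f, [/\ R f, f != 0 & R (f * d)]].

Lemma Frac_R x : R x -> Frac x.
Proof.
move=> Rx; exists 1; rewrite mul1r oner_neq0; split=> //; exact: cross1.
Qed.

(** The Ore condition supplies a common left denominator for sums, and for products a rewriting of
    [(f * x) * g^-1] as [a^-1 * b]. *)
Lemma divring_Frac : divring Frac.
Proof.
split; [split|].
- by apply/Frac_R/span0.
- by apply/Frac_R/cross1.
- by move=> x [f [Rf f0 h]]; exists f; split=> //; rewrite mulrN; apply: spanN.
- move=> x y [f [Rf f0 h]] [g [Rg g0 h']].
  have [a [b [Ra Rb a0 e]]] := ore Rf Rg f0 g0.
  exists (a * f); split; [exact: crossM|exact: muldn0|].
  rewrite mulrDr {2}e -!mulrA; apply: spanD; exact: crossM.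
- move=> x y [f [Rf f0 h]] [g [Rg g0 h']].
  case: (eqVneq (f * x) 0) => [fx0|fx0].
    have -> : x = 0 by apply: (mulDI hD f0); rewrite fx0 mulr0.
    by rewrite mul0r; apply/Frac_R/span0.
  have [a [b [Ra Rb a0 e]]] := ore h Rg fx0 g0.
  exists (a * f); split; [exact: crossM|exact: muldn0|].
  rewrite mulrA -[a * f * x]mulrA e -mulrA; exact: crossM.
- move=> x [f [Rf f0 h]]; case: (eqVneq x 0) => [->|x0].
    by rewrite invr0; apply/Frac_R/span0.
  by exists (f * x); split=> //; [exact: muldn0|gw].
Qed.

Lemma Dgen_Frac : Dgen (E `|` N) `<=` Frac.
Proof.
apply: Dgen_min; first exact: divring_Frac.
by move=> x [/cross_coef|/cross_grp] /Frac_R.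
Qed.

(** * Minimal supports under conjugation *)

Section Conjugators.
Variable Q : set D.
Hypotheses (sQ : subgroup Q) (QR : Q `<=` R) (QE : Q `<=` normz E).
Hypothesis QN : forall x t, Q x -> N t -> E (cmm x t).

(** Since [Q] commutes with [N] modulo [E], conjugation by [Q] changes the coefficients of a sum but
    not its list of monomials. *)
Let cj_term x s : Q x -> lgood E N s ->
  exists s', [/\ lgood E N s', map snd s' = map snd s & lsum s' = cj x (lsum s)].
Proof.
move=> Qx; elim: s => [|p s IH] gs.
  by exists [::]; split=> //; rewrite /lsum !big_nil cj0.
move/lgood_cons: gs => [Ep Np gs]; have [s' [gs' es' ls']] := IH gs.
have x0 := sgn0 sQ Qx; have p0 := Nn0 Np.
exists ((cj x p.1 * cmm x p.2, p.2) :: s'); split.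
- apply/lgood_cons; split=> //=; apply: drM => //; last exact: QN.
  exact: normz_cj (QE Qx) _.
- by rewrite /= es'.
- by rewrite !lsum_cons /= ls' cjD /cj /cmm; congr (_ + _); gw.
Qed.

Let combine e s s' : E e -> lgood E N s -> lgood E N s' ->
  map snd s' = map snd s ->
  exists s'', [/\ lgood E N s'', map snd s'' = map snd s &
    lsum s'' = lsum s' - e * lsum s].
Proof.
move=> Ee; elim: s s' => [|p s IH] [|p' s'] //= gs gs'.
  by exists [::]; split=> //; rewrite /lsum !big_nil mulr0 subr0.
move=> [epp ess]; move/lgood_cons: gs => [Ep Np gs].
move/lgood_cons: gs' => [Ep' Np' gs'].
have [s'' [gs'' zs'' ls'']] := IH s' gs gs' ess.
exists ((p'.1 - e * p.1, p.2) :: s''); split=> /=.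
- apply/lgood_cons; split=> //=; apply: drB => //; exact: drM.
- by rewrite zs''.
- by rewrite !lsum_cons /= ls'' epp mulrBl mulrDr mulrA opprD addrACA.
Qed.

Let scale e t s : E e -> N t -> lgood E N s ->
  exists s', [/\ lgood E N s', size s' = size s & lsum s' = e * t * lsum s].
Proof.
move=> Ee Nt gs; have t0 := Nn0 Nt.
exists [seq (e * cj t p.1, t * p.2) | p <- s]; split; rewrite ?size_map //.
  move=> _ /mapP [p ps ->] /=; have [Ep Np] := gs p ps.
  by split; [apply: drM => //; apply: normz_cj (NE Nt) _|apply: sgM].
by rewrite /lsum big_map mulr_sumr; apply: eq_bigr => p _ /=; rewrite /cj; gw.
Qed.

Let normalize s : lgood E N s -> (0 < size s)%N ->
  (forall s', lgood E N s' -> lsum s' = lsum s -> (size s <= size s')%N) ->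
  exists e t s', [/\ star E e, N t, lgood E N s', size s = (size s').+1 &
    lsum s = e * t * (1 + lsum s')].
Proof.
case: s => // -[e t] s gs _ min; have /lgood_cons [/= Ee Nt gs'] := gs.
have e0 : e != 0.
  apply/eqP => e0; have := min s gs'; rewrite lsum_cons /= e0 mul0r add0r.
  by move=> /(_ erefl); rewrite ltnn.
have t0 := Nn0 Nt; have nt := NE Nt.
have [||s' [gs1 zs1 ls1]] := @scale (cj t^-1 e^-1) t^-1 s _ _ gs'.
- by apply: normz_cjV nt _; apply: drV.
- exact: sgV.
exists e, t, s'; split; rewrite ?zs1 // lsum_cons /= mulrDr mulr1 ls1.
by rewrite /cj; gw.
Qed.

(** Take a denominator with the fewest monomials, normalized to contain [1]. For [q] in [Q],
    [cj q f] is again a denominator because [m] normalizes [Q], and it has the same monomials; the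
    difference [cj q f - f] loses the monomial [1], hence vanishes. *)
Lemma exists_centralizing_denominator m : m != 0 -> Frac m -> normz Q m ->
  exists f, [/\ R f, f != 0, R (f * m) & centr Q f].
Proof.
move=> m0 [f0 [[s0 gs0 ef0] f00 Rf0]] nm.
pose P k := exists s, [/\ lgood E N s, lsum s != 0, R (lsum s * m) & size s = k].
have [|k [[s [gs s0' Rs sk]] min]] := @ex_min P.
  by exists (size s0), s0; split; rewrite -?ef0.
have [||e [t [s' [[Ee e0] Nt gs' zs ls]]]] := @normalize s gs.
- by case: s {gs Rs sk} s0' => //; rewrite /lsum big_nil eqxx.
- by move=> s1 gs1 ls1; rewrite sk; apply: min; exists s1; rewrite ls1.
have t0 := Nn0 Nt; pose f := 1 + lsum s'.
have fe : f = (e * t)^-1 * lsum s by rewrite ls mulKd ?muldn0.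
have Rf : R f.
  by apply: spanD; [apply: cross1|exists s'].
have Rfm : R (f * m).
  rewrite fe -mulrA (invMd hD) -mulrA; apply: crossM.
    by apply: cross_grp; exact: sgV.
  by apply: crossM => //; apply: cross_coef; exact: drV.
have fn0 : f != 0 by apply: contraNneq s0' => h; rewrite ls -/f h mulr0.
exists f; split=> // q Qq; have q0 := sgn0 sQ Qq.
have [s1 [gs1 es1 ls1]] := cj_term Qq gs'.
have [s2 [gs2 zs2 ls2]] := combine (dr1 dE) gs' gs1 es1.
have e2 : lsum s2 = cj q f - f.
  by rewrite ls2 ls1 mul1r /f cjD cj1 // opprD addrACA subrr add0r.
have : lsum s2 == 0.
  apply: contraT => n0; have : P (size s2).
    exists s2; split=> //; rewrite e2 mulrBl; apply: spanB => //.
    have -> : cj q f * m = q * (f * m) * (cj m^-1 q)^-1.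
      by rewrite /cj; gw.
    have Q' := normz_cjV nm Qq.
    apply: crossM; last by apply: QR; exact: sgV.
    by apply: crossM => //; apply: QR.
  by move/min; rewrite -(size_map snd) zs2 size_map -sk zs ltnn.
by rewrite e2 subr_eq0 => /eqP h; rewrite -{1}h cj_mul.
Qed.

(** An element that [Q] moves only by factors in [E] centralizes [Q] up to one monomial: [h] is [g]
    divided by a term of its shortest expression. *)
Lemma monomial_times_centralizing g : R g -> g != 0 ->
  (forall q, Q q -> E (cmm g q)) ->
  exists e t h, [/\ star E e, N t, R h, g = e * t * h & centr Q h].
Proof.
move=> [s0 gs0 eg] g0 hg.
pose P k := exists s, [/\ lgood E N s, lsum s = g & size s = k].
have [|k [[s [gs ls sk]] min]] := @ex_min P; first by exists (size s0), s0.
have [||e [t [s' [[Ee e0] Nt gs' zs ls']]]] := @normalize s gs.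
- by case: s {gs sk} ls g0 => // <-; rewrite /lsum big_nil eqxx.
- by move=> s1 gs1 ls1; rewrite sk; apply: min; exists s1; rewrite ls1.
have t0 := Nn0 Nt; pose h := 1 + lsum s'.
exists e, t, h; split=> //; first by apply: spanD; [apply: cross1|exists s'].
  by rewrite -ls ls'.
move=> q Qq; have q0 := sgn0 sQ Qq.
have he : h = (e * t)^-1 * g by rewrite -ls ls' mulKd ?muldn0.
have h0 : h != 0 by rewrite he muldn0 ?invdn0 ?muldn0.
have Ed : E (cmm q h).
  have -> : cmm q h = cj t^-1 (cj e^-1 (e * (cmm q t)^-1 * cj q e^-1 * (cmm g q)^-1)).
    by rewrite he /cmm /cj; gw.
  apply: normz_cjV (NE Nt) _.
  apply: drcj => //; first exact: drV.
  apply: drM => //; last by apply: drV => //; exact: hg.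
  apply: drM => //; last by apply: normz_cj (QE Qq) _; apply: drV.
  by apply: drM => //; apply: drV => //; exact: QN.
have [s1 [gs1 es1 ls1]] := cj_term Qq gs'.
have [s2 [gs2 zs2 ls2]] := combine Ed gs' gs1 es1.
(* Comparing the coefficients of 1 in [cj q h = cmm q h * h]: unless
   [cmm q h = 1], the monomial 1 could be eliminated from [h]. *)
have e2 : lsum s2 = cmm q h - 1.
  have e3 : 1 + lsum s1 = cmm q h + cmm q h * lsum s'.
    rewrite ls1 -[X in X + _](cj1 hD q0) -cjD -/h -[X in X + _]mulr1 -mulrDr -/h.
    by rewrite /cmm /cj; gw.
  by rewrite ls2; apply/eqP; rewrite subr_eq addrAC -e3 addrAC subrr add0r.
case: (eqVneq (cmm q h) 1) => [c1|c1].
  by apply/esym/cmm1P.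
have d0 : cmm q h - 1 != 0 by rewrite subr_eq0.
have Ei : E (- (cmm q h - 1)^-1).
  by apply: drN => //; apply: drV => //; apply: drB => //; apply: dr1.
have [s3 [gs3 zs3 ls3]] := combine Ei gs2 gs' (esym zs2).
have [s4 [gs4 zs4 ls4]] := scale Ee Nt gs3.
have : P (size s4).
  exists s4; split=> //; rewrite ls4 ls3 e2 mulNr opprK mulVd // addrC -/h.
  by rewrite he mulVKd ?muldn0.
by move/min; rewrite zs4 -(size_map snd) zs3 size_map -sk zs -(size_map snd s2) zs2 size_map ltnn.
Qed.

End Conjugators.
End Ore.

(** * Normalizers in cyclic extensions *)

Section FreeRep.
Variables (D : unitRingType) (hD : is_division_ring D).

(** In an expression of [g] with the fewest terms, a relation among the [t i] or a zero coefficient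
    would allow a shorter one. *)
Lemma span_free_rep (E T : set D) g : divring E -> span E T g ->
  exists n (e t : 'I_n -> D), [/\ forall i, E (e i) /\ e i != 0,
    forall i, T (t i), g = \sum_i e i * t i &
    forall c : 'I_n -> D, (forall i, E (c i)) -> \sum_i c i * t i = 0 ->
      forall i, c i = 0].
Proof.
move=> dE [s gs gE].
pose P n := exists (e t : 'I_n -> D), [/\ forall i, E (e i),
    forall i, T (t i) & g = \sum_i e i * t i].
have [|n [[e [t [Ee Tt ge]]] min]] := @ex_min P.
  exists (size s), (fun i => (tnth (in_tuple s) i).1), (fun i => (tnth (in_tuple s) i).2).
  split=> [i|i|]; try by have [] := gs _ (mem_tnth i (in_tuple s)).
  by rewrite gE /lsum big_tnth.
have free (c : 'I_n -> D) : (forall i, E (c i)) -> \sum_i c i * t i = 0 ->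
    forall i, c i = 0.
  case: n => [|n] in e t Ee Tt ge min c *; first by move=> _ _ [].
  move=> Ec c0 i0; apply/eqP; case: (eqVneq (c i0) 0) => // ci0.
  suff : P n by move/min; rewrite ltnn.
  pose b := - (e i0 * (c i0)^-1).
  have Eb : E b by apply: drN => //; apply: drM => //; apply: drV.
  exists (fun k => e (lift i0 k) + b * c (lift i0 k)), (fun k => t (lift i0 k)).
  split=> // [k|]; first by apply: drD => //; apply: drM.
  transitivity (\sum_i (e i + b * c i) * t i).
    under [RHS]eq_bigr do rewrite mulrDl -mulrA.
    by rewrite big_split -mulr_sumr /= c0 mulr0 addr0.
  rewrite (bigD1_ord i0) //= /b mulNr -mulrA mulVd // mulr1 subrr mul0r add0r //.
exists n, e, t; split=> // i; split=> //; apply/eqP => ei0.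
case: n => [|n] in e t Ee Tt ge min free i ei0 *; first by case: i ei0.
suff : P n by move/min; rewrite ltnn.
exists (fun k => e (lift i k)), (fun k => t (lift i k)); split=> //.
by rewrite ge (bigD1_ord i) //= ei0 mul0r add0r.
Qed.

End FreeRep.

Section CyclicExtension.
Variables (D : unitRingType) (hD : is_division_ring D).
Variables (E : set D) (y : D).
Hypotheses (dE : divring E) (Ey : normz E y).

Let y0 : y != 0. Proof. exact: normz_n0 Ey. Qed.
Let uy : y \is a GRing.unit. Proof. exact: hD. Qed.
Let N : set D := [set x | exists i : int, x = y ^ i].
Let U := Dgen (E `|` [set y]).
Let C := centr E `&` U.

Let dU : divring U. Proof. exact: divring_Dgen. Qed.
Let EU : E `<=` U. Proof. by move=> x Ex; apply: Dgen_sub; left. Qed.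
Let Uy : U y. Proof. by apply: Dgen_sub; right. Qed.
Let dC : divring C. Proof. by apply: divringI => //; exact: divring_centr. Qed.

Let sN : subgroup N.
Proof.
split.
- by move=> _ [i ->]; exact: expdzn0.
- by exists 0.
- by move=> _ _ [i ->] [j ->]; exists (i + j); rewrite exprzDr.
- by move=> _ [i ->]; exists (- i); rewrite invr_expz.
Qed.

Let NE : N `<=` normz E.
Proof. by move=> _ [i ->]; apply: sgXz Ey; exact: sg_normz. Qed.

Let abN x z : N x -> N z -> E (cmm x z).
Proof.
move=> Nx Nz; rewrite cmm_eq1 //; [exact: dr1|exact: sgn0 sN Nx|exact: sgn0 sN Nz|].
case: Nx => i ->; case: Nz => j ->; by rewrite -!exprzDr // addrC.
Qed.

Local Notation R := (span E N).

Let RU : R `<=` U.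
Proof.
apply: span_min; [exact: (dr0 dU)|by move=> x z; exact: (drD dU)|].
by move=> e _ Ee [i ->]; apply: (drM dU); [exact: EU|exact: (drXz dU)].
Qed.

Let UFrac : U `<=` Frac E N.
Proof.
apply: Dgen_min; first exact: divring_Frac.
move=> x [Ex|->]; apply: Frac_R => //; first exact: cross_coef.
by apply: cross_grp => //; exists 1.
Qed.

Let sQ : subgroup (star E). Proof. exact: sg_star. Qed.
Let QR : star E `<=` R.
Proof. by move=> x [Ex _]; exact: cross_coef. Qed.
Let QE : star E `<=` normz E. Proof. by move=> x; exact: normz_star. Qed.
Let QN x t : star E x -> N t -> E (cmm x t).
Proof.
move=> [Ex x0] Nt; have t0 := sgn0 sN Nt.
have -> : cmm x t = x * cj t x^-1 by rewrite /cmm /cj; gw.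
by apply: drM => //; apply: normz_cj (NE Nt) _; apply: drV.
Qed.

Let centr_star x : centr (star E) x -> centr E x.
Proof.
move=> h e Ee; case: (eqVneq e 0) => [->|e0]; first by rewrite mul0r mulr0.
exact: h.
Qed.

Let denominator m : U m -> normz E m ->
  exists f, [/\ R f, f != 0, R (f * m) & centr E f].
Proof.
move=> Um nm; have m0 := normz_n0 nm.
have nm' : normz (star E) m by exact: normz_star_sub.
have [f [? ? ? /centr_star ?]] :=
  exists_centralizing_denominator hD dE sN NE sQ QR QE QN m0 (UFrac Um) nm'.
by exists f.
Qed.

Let EC : set D := [set z | exists e c, [/\ star E e, star C c & z = e * c]].

Let sEC : subgroup EC.
Proof.
have sE := sg_star hD dE; have sC := sg_star hD dC.
split.
- by move=> _ [e [c [[_ e0] [_ c0] ->]]]; apply: muldn0.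
- by exists 1, 1; rewrite mulr1; split=> //; apply: sg1.
- move=> _ _ [e [c [Ee Cc ->]]] [e' [c' [Ee' Cc' ->]]].
  exists (e * e'), (c * c'); split; [exact: sgM|exact: sgM|].
  by case: Cc => [[cc _] _]; rewrite -mulrA [c * _]mulrA cc ?mulrA //; case: Ee'.
- move=> _ [e [c [Ee Cc ->]]]; exists e^-1, c^-1; split; [exact: sgV|exact: sgV|].
  case: Cc => [[cc _] _]; rewrite (invMd hD).
  by apply: (commV hD); apply: cc; apply: (drV dE); case: Ee.
Qed.

Let EC_y i z : EC z -> EC (cj (y ^ i) z).
Proof.
move=> [e [c [[Ee e0] [[cc Uc] c0] ->]]].
have ni : normz E (y ^ i) by apply: NE; exists i.
have yi0 := normz_n0 ni.
exists (cj (y ^ i) e), (cj (y ^ i) c); rewrite cjM //; split=> //.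
  by split; [exact: normz_cj ni _|rewrite cj_eq0].
split; [split|by rewrite cj_eq0].
  by apply: normz_cj cc; exact: normz_centr.
by apply: (drcj dU) => //; exact: (drXz dU).
Qed.

(** With [Q = star E], the two results on minimal supports write [m] as [f^-1 * e * y ^ i * h],
    where [f] and [h] lie in [C]; [EC] is stable under conjugation by [y]. *)
Lemma cyclic_normalizer m : U m -> normz E m -> exists i : int, EC (m * y ^ i).
Proof.
move=> Um nm; have m0 := normz_n0 nm.
have [f [Rf f0 Rg cf]] := denominator Um nm; set g := f * m in Rg.
have g0 : g != 0 by exact: muldn0.
have ng : normz E g.
  by apply: sgM nm; [exact: sg_normz|exact: normz_centr_in].
have [|e [t [h [[Ee e0] [i ti] Rh gE /centr_star ch]]]] :=
  monomial_times_centralizing hD dE sN NE sQ QE QN Rg g0.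
  by move=> q [Eq _]; rewrite cmm_cj; exact: (drM dE (normz_cj ng Eq) (drV dE Eq)).
have yi0 : y ^ i != 0 by exact: expdzn0.
have h0 : h != 0 by apply: contraNneq g0 => h0; rewrite gE h0 mulr0.
exists (- i); rewrite -invr_expz.
have -> : m * (y ^ i)^-1 = f^-1 * (e * cj (y ^ i) h).
  have -> : m = f^-1 * g by rewrite /g; gw.
  by rewrite gE ti /cj; gw.
apply: sgM => //.
  apply: sgV => //; exists 1, f; rewrite mul1r; split=> //.
    by split; [exact: dr1|exact: oner_neq0].
  by do !split => //; exact: RU.
apply: sgM => //; first by exists e, 1; rewrite mulr1; split=> //; exact: sg1 (sg_star hD dC).
apply: EC_y; exists 1, h; rewrite mul1r; split=> //.
  by split; [exact: dr1|exact: oner_neq0].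
by do !split => //; exact: RU.
Qed.

Lemma cyclic_normalizer_cmm m1 m2 : U m1 -> U m2 -> normz E m1 -> normz E m2 ->
  EC (cmm m1 m2).
Proof.
move=> Um1 Um2 nm1 nm2; have [i hi] := cyclic_normalizer Um1 nm1.
have [j hj] := cyclic_normalizer Um2 nm2.
have yi0 : y ^ i != 0 by exact: expdzn0.
have yj0 : y ^ j != 0 by exact: expdzn0.
have [z [hz ->]] : exists z, EC z /\ m1 = z * (y ^ i)^-1.
  by exists (m1 * y ^ i); split=> //; gw.
have [w [hw ->]] : exists w, EC w /\ m2 = w * (y ^ j)^-1.
  by exists (m2 * y ^ j); split=> //; gw.
have z0 := sgn0 sEC hz; have w0 := sgn0 sEC hw.
have yV k : (y ^ k)^-1 = y ^ (- k) by rewrite invr_expz.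
have -> : cmm (z / y ^ i) (w / y ^ j) = z * cj (y ^ (- i)) w * cj (y ^ (- j)) z^-1 * w^-1.
  have yij : (y ^ j)^-1 * y ^ i = y ^ i * (y ^ j)^-1.
    by rewrite yV -!exprzDr // addrC.
  rewrite -!yV /cmm /cj; gw.
  by rewrite [_^-1 * (y ^ i * _)]mulrA yij -mulrA.
apply: sgM => //; last exact: sgV.
apply: sgM => //; last by apply: EC_y; exact: sgV.
by apply: sgM => //; exact: EC_y.
Qed.

(** Euclid's algorithm on the exponents: for [i <= j] the quotient of the two elements is a monomial
    of degree [j - i] centralizing [E], and it suffices that it commutes with [e * y ^+ i]. A
    monomial of degree [0] lies in [E], which the other one centralizes. *)
Let mono_comm n (i j : nat) e e' : (i + j <= n)%N -> E e -> E e' ->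
  e != 0 -> e' != 0 ->
  centr E (e * y ^+ i) -> centr E (e' * y ^+ j) ->
  (e * y ^+ i) * (e' * y ^+ j) = (e' * y ^+ j) * (e * y ^+ i).
Proof.
elim: n i j e e' => [|n IH] i j e e' ijn Ee Ee' e0 e0' c c'.
  move: ijn; rewrite leqn0 addn_eq0 => /andP [/eqP i0 _].
  by subst i; rewrite expr0 mulr1; apply/esym/c'.
wlog ij : i j e e' ijn Ee Ee' e0 e0' c c' / (i <= j)%N.
  move=> h; case: (leqP i j) => [|/ltnW] ij; first exact: h.
  by rewrite (h j i e' e) // addnC.
case: (posnP i) => [i0|ip]; first by subst i; rewrite expr0 mulr1; apply/esym/c'.
have yi0 : y ^+ i != 0 by exact: expdn0.
have ni : normz E (y ^+ i) by apply: NE; exists i.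
have yji0 : y ^+ (j - i) != 0 by exact: expdn0.
pose e'' := e' * cj (y ^+ (j - i)) e^-1.
have E'' : E e''.
  apply: drM => //; apply: normz_cj; first by apply: NE; exists (j - i)%N.
  exact: drV.
have h : e'' * y ^+ (j - i) = (e' * y ^+ j) * (e * y ^+ i)^-1.
  have -> : y ^+ j = y ^+ (j - i) * y ^+ i by rewrite -exprD subnK.
  by rewrite /e'' /cj; gw.
have c'' : centr E (e'' * y ^+ (j - i)).
  by rewrite h; exact: (drM (divring_centr hD E) c' (drV (divring_centr hD E) c)).
have e0'' : e'' != 0 by rewrite muldn0 ?cj_eq0 ?invdn0.
have := IH i (j - i)%N e e'' _ Ee E'' e0 e0'' c c''.
rewrite subnKC // h => /(_ _)/(congr1 (fun z => z * (e * y ^+ i))) IH'.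
have ez : e * y ^+ i != 0 by exact: muldn0.
move: IH'; rewrite -!mulrA mulVd // mulr1 => -> //; first by gw.
by move: ijn ip; clear; lia.
Qed.

Let T : set D := [set z | exists e (i : int),
  [/\ E e, e != 0, z = e * y ^ i & centr E z]].

Let T_nat z : T z -> exists e (i : nat), [/\ E e, e != 0, centr E (e * y ^+ i) &
  z = e * y ^+ i \/ z = (e * y ^+ i)^-1].
Proof.
move=> [e [[i|i] [Ee e0 zE cz]]].
  by exists e, i; split=> //; [rewrite zE in cz|left].
have yi0 : y ^+ i.+1 != 0 by exact: expdn0.
have ez : z = (cj (y ^+ i.+1) e^-1 * y ^+ i.+1)^-1.
  by rewrite zE /exprz /cj; gw.
exists (cj (y ^+ i.+1) e^-1), i.+1; split; last by right.
- by apply: normz_cj; [apply: NE; exists i.+1|apply: drV].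
- by rewrite cj_eq0 // invdn0.
- by apply: (drVE (divring_centr hD E)); rewrite -ez.
Qed.

Let T_comm z w : T z -> T w -> z * w = w * z.
Proof.
move=> /T_nat [e [i [Ee e0 c zE]]] /T_nat [e' [j [Ee' e0' c' wE]]].
have h := mono_comm (leqnn _) Ee Ee' e0 e0' c c'.
case: zE => ->; case: wE => -> //.
- by apply/esym/(commV hD).
- by apply: (commV hD).
- by apply: (commV hD) => //; apply/esym/(commV hD).
Qed.

(** Conjugation by a nonzero [x] in [E] changes only the coefficients of [g]; the monomials being
    independent, each term is itself fixed. *)
Let R_centr_T g : R g -> centr E g -> exists n (t : 'I_n -> D),
  (forall i, T (t i)) /\ g = \sum_i t i.
Proof.
move=> Rg cg; have [n [e [t [he ht gE free]]]] := span_free_rep hD dE Rg.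
exists n, (fun i => e i * t i); split=> // i.
have [k tk] := ht i; have [Ei ei0] := he i.
exists (e i), k; split=> //; first by rewrite -tk.
apply: centr_star => x [Ex x0]; apply/esym/cj_idP => //.
have t0 j : t j != 0 by exact: sgn0 sN (ht j).
pose c j := cj x (e j) * (x * cj (t j) x^-1) - e j.
have Ec j : E (c j).
  have [Ej _] := he j; have Exv : E x^-1 by exact: drV.
  apply: drB => //; apply: drM => //; first exact: drcj.
  by apply: drM => //; exact: normz_cj (NE (ht j)) _.
have /(free c Ec)/(_ i)/eqP : \sum_j c j * t j = 0.
  transitivity (cj x g - g).
    rewrite gE /cj mulr_sumr mulr_suml -sumrB; apply: eq_bigr => j _.
    rewrite /c; have := t0 j; move: (t j) (e j) => tj ej tj0.
    by rewrite mulrBl /cj; congr (_ - _); gw.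
  by rewrite cj_id ?subrr // cg.
rewrite /c subr_eq0 => /eqP ee; rewrite -[in RHS]ee.
by have := t0 i; move: (t i) (e i) => ti ei ti0; rewrite /cj; gw.
Qed.

(** Every element of [C] is a quotient of elements of [R] centralizing [E], and these are sums of
    monomials centralizing [E], which commute pairwise. *)
Lemma cyclic_centralizer_abelian : abelian C.
Proof.
have h : abelian (R `&` centr E).
  move=> x z [Rx cx] [Rz cz].
  have [n [t [Tt ->]]] := R_centr_T Rx cx; have [m [s [Ts ->]]] := R_centr_T Rz cz.
  rewrite mulr_suml mulr_sumr; apply: eq_bigr => i _.
  by rewrite mulr_sumr mulr_suml; apply: eq_bigr => j _; exact: T_comm.
have sub : C `<=` Dgen (R `&` centr E).
  move=> m [cm Um]; case: (eqVneq m 0) => [->|m0]; first exact: (dr0 (divring_Dgen _)).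
  have nm : normz E m by exact: normz_centr_in.
  have [f [Rf f0 Rg cf]] := denominator Um nm.
  have -> : m = f^-1 * (f * m) by gw.
  have dG := divring_Dgen (R `&` centr E).
  apply: (drM dG); first by apply: (drV dG); apply: Dgen_sub.
  by apply: Dgen_sub; split=> //; apply: (drM (divring_centr hD E)).
move=> x z /sub Cx /sub Cz; exact: (abelian_Dgen hD h).
Qed.

(* With [EC = E^* C^*], the normalizer modulo [EC] is generated by [y], so its
   commutators lie in [EC], and those of [EC] in [E] as [C] is commutative. *)
Lemma cyclic_normalizer_der2 X : subgroup X -> X `<=` U -> X `<=` normz E ->
  derk 2 X `<=` E.
Proof.
move=> sX XU XE.
have d1 : der X `<=` EC.
  apply: der_min => // a b Xa Xb.
  by apply: cyclic_normalizer_cmm; [exact: XU|exact: XU|exact: XE|exact: XE].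
suff : der (der X) `<=` star E by move=> h x /h [].
apply: der_min; [exact: sg_der|exact: sg_star|].
move=> _ _ /d1 [e [c [[Ee e0] [Cc c0] ->]]] /d1 [e' [c' [[Ee' e0'] [Cc' c0'] ->]]].
have cc' := cyclic_centralizer_abelian Cc Cc'.
have -> : cmm (e * c) (e' * c') = cmm e e'.
  have cmmE (a b : D) : cmm a b = a * b * (b * a)^-1 by rewrite /cmm (invMd hD) !mulrA.
  have cE x z : E x -> z * c * (x * c') = z * x * (c * c').
    by case: Cc => cc _ Ex; rewrite -!mulrA [c * (x * _)]mulrA cc // !mulrA.
  have cE' x z : E x -> z * c' * (x * c) = z * x * (c' * c).
    by case: Cc' => cc _ Ex; rewrite -!mulrA [c' * (x * _)]mulrA cc // !mulrA.
  rewrite !cmmE cE // cE' // cc'; have cc0 : c' * c != 0 by exact: muldn0.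
  by move: (c' * c) cc0 => z z0; gw.
exact: (sgcmm (sg_star hD dE)).
Qed.

(** A commutative [E] lies in [C], so that [EC] is contained in the commutative [C]. *)
Lemma cyclic_normalizer_der X : abelian E -> subgroup X -> X `<=` U ->
  X `<=` normz E -> abelian (der X).
Proof.
move=> aE sX XU XE; have : der X `<=` star C; last first.
  by move=> h x z /h [Cx _] /h [Cz _]; exact: cyclic_centralizer_abelian.
apply: der_min => //; first exact: sg_star.
move=> a b Xa Xb; have [e [c [[Ee e0] Cc ->]]] :=
  cyclic_normalizer_cmm (XU _ Xa) (XU _ Xb) (XE _ Xa) (XE _ Xb).
apply: sgM (sg_star hD dC) _ Cc; do !split => //; last exact: EU.
by move=> z Ez; exact: aE.
Qed.

End CyclicExtension.

(** * Finiteness arguments *)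

Section SubDivisionRing.
Variables (D : unitRingType) (U : set D).

Definition mem_dr of divring U : {pred D} := fun x => `[< U x >].

Variable dU : divring U.

Lemma mem_drE x : (x \in mem_dr dU) <-> U x.
Proof. by rewrite unfold_in; split=> /asboolP. Qed.

Lemma mem_dr_closed : GRing.divring_closed (mem_dr dU).
Proof.
split; first by apply/mem_drE/(dr1 dU).
  by move=> x y /mem_drE Ux /mem_drE Uy; apply/mem_drE/(drB dU).
by move=> x y /mem_drE Ux /mem_drE Uy; apply/mem_drE/(drM dU) => //; apply: (drV dU).
Qed.

HB.instance Definition _ := GRing.isDivringClosed.Build D (mem_dr dU) mem_dr_closed.

Record drT := DrT { drval :> D; _ : drval \in mem_dr dU }.

HB.instance Definition _ := [isSub for drval].
HB.instance Definition _ := [Choice of drT by <:].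
HB.instance Definition _ := [SubChoice_isSubUnitRing of drT by <:].

Lemma drvalP (x : drT) : U (drval x).
Proof. by apply/mem_drE; exact: valP. Qed.

Definition drmk x (Ux : U x) : drT := DrT ((mem_drE x).2 Ux).

Lemma drval_unit (hD : is_division_ring D) (x : drT) : x != 0 -> x \is a GRing.unit.
Proof.
move=> x0; have v0 : drval x != 0.
  by apply: contraNneq x0 => v0; apply/eqP/val_inj.
have Ui : U (drval x)^-1 by apply: (drV dU); exact: drvalP.
apply/unitrP; exists (drmk Ui); split; apply: val_inj => /=.
  exact: mulVd.
exact: muldV.
Qed.

Variables (hD : is_division_ring D) (cU : abelian U).

Definition drF of is_division_ring D & abelian U := drT.
Local Notation K := (drF hD cU).

HB.instance Definition _ := GRing.UnitRing.on K.
Lemma drF_mulC : commutative (@GRing.mul K).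
Proof. by move=> x y; apply: val_inj; apply: cU; exact: drvalP. Qed.
HB.instance Definition _ := GRing.PzRing_hasCommutativeMul.Build K drF_mulC.
Lemma drF_field : GRing.field_axiom K.
Proof. by move=> x; exact: drval_unit. Qed.
HB.instance Definition _ := GRing.ComUnitRing_isField.Build K drF_field.

Lemma divring_field : exists (F : fieldType) (f : {rmorphism F -> D}),
  forall x, U x <-> exists z, f z = x.
Proof.
exists (drF hD cU : fieldType).
pose f : {rmorphism drT -> D} := \val.
exists f => x; split=> [Ux|[z <-]]; last exact: drvalP.
by exists (drmk Ux).
Qed.

End SubDivisionRing.

Section FiniteSets.
Variables (D : unitRingType) (hD : is_division_ring D).
Implicit Types (x y z : D) (l : seq D) (U S : set D).

Lemma pigeonhole l (f : nat -> D) : (forall n, f n \in l) ->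
  exists i j, [/\ (i < j)%N, (j <= size l)%N & f i = f j].
Proof.
move=> fl; pose s := [seq f i | i <- iota 0 (size l).+1].
have : ~~ uniq s.
  apply/negP => us; have := uniq_leq_size us (s2 := l).
  rewrite size_map size_iota ltnn; suff h : {subset s <= l} by move/(_ h).
  by move=> _ /mapP [i _ ->].
case/(uniqPn 0) => i [j [ij js e]]; exists i, j.
move: js; rewrite size_map size_iota => js; have il := ltn_trans ij js.
by split=> //; move: e; rewrite !(nth_map 0%N) ?size_iota // !nth_iota.
Qed.

Lemma finite_order l x : x != 0 -> (forall n, x ^+ n \in l) ->
  exists2 n, (0 < n)%N & x ^+ n = 1.
Proof.
move=> x0 /pigeonhole [i [j [ij _ e]]]; exists (j - i)%N; first by rewrite subn_gt0.
apply: (mulId hD (expdn0 hD i x0)).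
by rewrite -exprD subnK ?mul1r // ltnW.
Qed.

Lemma finite_subring_divring l S : subring S -> (forall x, S x -> x \in l) ->
  divring S.
Proof.
move=> sS Sl; split=> // x Sx; case: (eqVneq x 0) => [->|x0]; first by rewrite invr0; case: sS.
have SX n : S (x ^+ n).
  elim: n => [|n IH]; rewrite ?expr0 ?exprS; case: sS => _ S1 _ _ SM //; exact: SM.
have [[//|n] _ e] := finite_order x0 (fun n => Sl _ (SX n)).
suff -> : x^-1 = x ^+ n by [].
by apply: (mulDI hD x0); rewrite muldV // -exprS e.
Qed.

Lemma finite_divring_abelian l U : divring U -> (forall x, U x -> x \in l) ->
  abelian U.
Proof.
move=> dU Ul; pose T : unitRingType := drT dU.
pose e : seq T := undup (pmap insub l).
have he : Finite.axiom e.
  move=> x; rewrite count_uniq_mem ?undup_uniq // mem_undup mem_pmap_sub.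
  by rewrite Ul //; exact: drvalP.
pose pick (x : T) := index x e; pose unpick n : option T := onth e n.
have pK : pcancel pick unpick.
  move=> x; rewrite /unpick /pick; have xe : x \in e by rewrite -has_pred1 has_count he.
  by rewrite onthE (nth_map x) ?index_mem // nth_index.
pose cT := isCountable.Build T pK.
pose fT := isFinite.Build T he.
pose R : finUnitRingType := HB.pack T cT fT.
have domR : GRing.integral_domain_axiom R.
  move=> x y /(congr1 (fun z : T => drval z)) /= /eqP.
  by rewrite (muld_eq0 hD) => /orP [] /eqP h; apply/orP; [left|right]; apply/eqP/val_inj.
move=> x y Ux Uy.
have := @finfield.finDomain_mulrC R domR (drmk dU Ux) (drmk dU Uy).
by move=> /(congr1 (fun z : T => drval z)).
Qed.

(** A longest duplicate-free list of roots is complete; lengths are bounded by [r], which is why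
    [r - size s] is minimized. *)
Lemma roots_of_unity_finite U r : divring U -> abelian U -> (0 < r)%N ->
  exists l, forall x, U x -> x ^+ r = 1 -> x \in l.
Proof.
move=> dU cU r0; have [K [f fU]] := divring_field dU hD cU.
pose P n := exists s : seq K, [/\ uniq s, all r.-unity_root s & (r - size s = n)%N].
have [|n [[s [us rs sn]] min]] := @ex_min P; first by exists r, [::]; rewrite subn0.
exists (map f s) => x /fU [z <-] xr; apply: map_f.
apply: contraT => zs; have rz : r.-unity_root z.
  by rewrite unity_rootE; apply/eqP/(fmorph_inj f); rewrite rmorphXn xr rmorph1.
have uz : uniq (z :: s) by rewrite /= zs.
have az : all r.-unity_root (z :: s) by rewrite /= rz.
have : P (r - size (z :: s))%N by exists (z :: s).
move/min; have := max_unity_roots r0 az uz; rewrite -sn /=; lia.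
Qed.

Lemma span_finite (E T : set D) l1 l2 : divring E ->
  (forall x, E x -> x \in l1) -> (forall x, T x -> x \in l2) ->
  exists l, forall x, span E T x -> x \in l.
Proof.
move=> dE El Tl; exists [seq \sum_(i < size l2) l1`_(f i) * l2`_i |
  f : {ffun 'I_(size l2) -> 'I_(size l1)}] => x [s gs xs].
have : span E [set` l2] x by exists s => // p /gs [Ep Tp]; split=> //=; exact: Tl.
move/(span_seqP dE) => [c Ec ->]; apply/mapP.
have ci i : (index (c i) l1 < size l1)%N by rewrite index_mem; exact: El.
exists [ffun i => Ordinal (ci i)]; first by rewrite mem_enum.
by apply: eq_bigr => i _; rewrite ffunE /= nth_index //; exact: El.
Qed.

(* Here [d] is a power of an endomorphism [1 - s] of the abelian group [S]: if
   it is nilpotent and [d x] ranges over a finite set when [d (d x) = 1], then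
   filtering [S] by the kernels of [d ^ j] gives [S / Ker d] finite. *)
Lemma finite_mod_kernel S (d : D -> D) (vs : seq D) m : subgroup S ->
  (forall x, S x -> S (d x)) ->
  (forall x y, S x -> S y -> d (x * y) = d x * d y) ->
  (forall x, S x -> d (d x) = 1 -> d x \in vs) ->
  (forall x, S x -> iter m d x = 1) ->
  exists l, forall x, S x -> exists y, [/\ y \in l, S y & d (x * y^-1) = 1].
Proof.
move=> sS Sd dM dvs dm.
have S1 := sg1 sS.
have d1 : d 1 = 1.
  apply: (mulDI hD (sgn0 sS (Sd _ S1))).
  by rewrite -dM // mulr1 mulr1.
have Si j x : S x -> S (iter j d x) by move=> Sx; elim: j => //= j; exact: Sd.
have iM j x y : S x -> S y -> iter j d (x * y) = iter j d x * iter j d y.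
  by move=> Sx Sy; elim: j => //= j ->; apply: dM; exact: Si.
have i1 j : iter j d 1 = 1 by elim: j => //= j ->.
suff h j : exists l, forall x, S x -> iter j d x = 1 ->
    exists y, [/\ y \in l, S y & d (x * y^-1) = 1].
  by have [l hl] := h m; exists l => x Sx; apply: hl => //; exact: dm.
elim: j => [|[|j] [l hl]].
- exists [:: 1] => x _ /= ->; exists 1; rewrite mem_head.
  by rewrite invr1 mulr1.
- by exists [:: 1] => x _ dx; exists 1; rewrite mem_head invr1 mulr1.
(* [g v] is a preimage of [v] under the iterate of order [j + 1]; dividing [x] by it lands in the
   kernel of that iterate, where the induction hypothesis applies. *)
pose g v := xget 1 [set x | S x /\ iter j.+1 d x = v].
exists [seq y * g v | y <- l, v <- vs] => x Sx xj.
set v := iter j.+1 d x.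
have [Sg gv] : S (g v) /\ iter j.+1 d (g v) = v.
  by rewrite /g; case: xgetP => [y _ [] //|/(_ x)]; case.
have [||y [yl Sy dy]] := hl (x * (g v)^-1).
- by apply: sgM => //; exact: sgV.
- rewrite iM //; last exact: sgV.
  apply: (mulId hD (sgn0 sS (Si j.+1 _ Sg))).
  rewrite -mulrA -iM //; last exact: sgV.
  by rewrite mulVd ?i1 ?mulr1 ?mul1r ?gv //; exact: sgn0 Sg.
exists (y * g v); split.
- apply/allpairsP; exists (y, v); split=> //=.
  by rewrite /v /=; apply: dvs => //; exact: Si.
- exact: sgM.
- by rewrite (invMd hD) mulrA.
Qed.

End FiniteSets.

(** * Subnormal subgroups of division rings *)

Section Engel.
Variables (D : unitRingType) (hD : is_division_ring D).
Variables (a y mu : D) (m : nat).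
Let U := Dgen [set a; y].
Hypotheses (a0 : a != 0) (y0 : y != 0) (ay : cj a y = mu * y).
Hypotheses (mu1 : mu != 1) (mua : mu * a = a * mu) (muy : mu * y = y * mu).
Hypothesis engel : forall d, star U d -> iter m (fun d => cj d a) d = a.

Let dU : divring U. Proof. exact: divring_Dgen. Qed.
Let Ua : U a. Proof. by apply: Dgen_sub; left. Qed.
Let Uy : U y. Proof. by apply: Dgen_sub; right. Qed.

Let mu0 : mu != 0.
Proof.
by apply: contraNneq y0 => mu0; rewrite -(cj_eq0 hD y a0) ay mu0 mul0r.
Qed.

Let centralU z : z * a = a * z -> z * y = y * z -> forall x, U x -> x * z = z * x.
Proof.
move=> za zy x Ux; suff h : centr [set z] x by exact: h.
apply: (Dgen_min _ _ Ux); first exact: divring_centr.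
by move=> w [] -> _ ->.
Qed.

Let Umu : U mu.
Proof.
have -> : mu = cj a y * y^-1 by rewrite ay; gw.
by apply: (drM dU); [apply: (drcj dU)|apply: (drV dU)].
Qed.

(** The double centralizer of [y] in [U], a commutative division ring. It contains [mu] and is
    stable under [cj a], which sends [y] to [mu * y], an element with the same centralizer in
    [U]. *)
Let Y := U `&` centr (U `&` centr [set y]).
Let dY : divring Y. Proof. by apply: divringI => //; apply: divring_centr. Qed.

Let YU x : Y x -> U x. Proof. by case. Qed.
Let Ycentral z : U z -> z * a = a * z -> z * y = y * z -> Y z.
Proof.
by move=> Uz za zy; split=> // x [Ux _]; apply/esym/centralU.
Qed.
Let Yy : Y y. Proof. by split=> // x [_ cx]; rewrite cx. Qed.
Let Ymu : Y mu. Proof. exact: Ycentral. Qed.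
Let Yy_comm x : Y x -> x * y = y * x.
Proof. by move=> [Ux cx]; apply: cx; split=> // _ ->. Qed.
Let aY : abelian Y.
Proof. by move=> x z Yx [Uz cz]; rewrite cz //; split; [exact: YU|move=> _ ->; exact: Yy_comm]. Qed.

Let aV0 : a^-1 != 0. Proof. exact: invdn0. Qed.

Let Ycj x : Y x -> Y (cj a x).
Proof.
move=> [Ux cx]; split; first exact: (drcj dU).
move=> z [Uz cz]; rewrite -[z](cjKV hD _ a0) -!(cjM hD) //; congr cj.
apply: cx; split; first by apply: (drcj dU) => //; exact: (drV dU).
move=> _ ->; rewrite -[y](cjK hD y a0) -!(cjM hD) //; congr cj.
by rewrite ay mulrA (centralU mua muy) // -!mulrA; congr (_ * _); apply: cz.
Qed.

(** Since [cj d a = delta d * a] and [cj (f * a) a = delta f * a], iterated conjugation of [a] is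
    iteration of [delta], and the Engel condition makes [delta] nilpotent on [star U]. On [star Y]
    it is the multiplicative form of [1 - s] for the automorphism [s = cj a]. *)
Let delta d := d * (cj a d)^-1.

Let iter_delta k d : d != 0 ->
  iter k.+1 (fun d => cj d a) d = iter k.+1 delta d * a /\ iter k.+1 delta d != 0.
Proof.
have dn0 e : e != 0 -> delta e != 0.
  by move=> e0; rewrite /delta muldn0 ?invdn0 // cj_eq0.
move=> d0; elim: k => [|k [IH n0]].
  by split; [rewrite /= /delta /cj; gw|exact: dn0].
rewrite iterS IH [iter k.+2 delta d]iterS; move: (iter k.+1 delta d) n0 => f f0.
by split; [rewrite /delta /cj; gw|exact: dn0].
Qed.

Let delta_nilp d : star U d -> iter m.+1 delta d = 1.
Proof.
move=> Ud; have [e _] := iter_delta m Ud.2; move: e; rewrite iterS engel //.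
have -> : cj a a = a by rewrite /cj; gw.
by move=> e; apply: (mulId hD a0); rewrite -e mul1r.
Qed.

Let iter_cj k : cj (a ^+ k) y = mu ^+ k * y.
Proof.
elim: k => [|k IH]; first by rewrite !expr0 /cj invr1 mulr1.
rewrite exprS cjJ // IH cjM // ay exprSr mulrA; congr (_ * _ * _).
by apply: cj_id => //; apply: commrX; rewrite /GRing.comm mua.
Qed.

Section InfiniteOrder.
Hypothesis inf : forall k, (0 < k)%N -> mu ^+ k != 1.
Variables (K : fieldType) (f : {rmorphism K -> D}) (muK yK : K).
Hypotheses (fY : forall z, Y (f z)) (fmu : f muK = mu) (fy : f yK = y).

Let shift (A : {poly K}) := A \Po (muK *: 'X).

(* [A_k, B_k] satisfy [delta^k (1 + z) = A_k(z) / B_k(z)] when [cj a z = mu * z]. *)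
Fixpoint delta_fraction k : {poly K} * {poly K} :=
  if k is k'.+1 then
    let AB := delta_fraction k' in (AB.1 * shift AB.2, AB.2 * shift AB.1)
  else ('X + 1, 1).

Local Notation A k := (delta_fraction k).1.
Local Notation B k := (delta_fraction k).2.

Let hA k z : (A k.+1).[z] = (A k).[z] * (B k).[muK * z].
Proof. by rewrite /= hornerM horner_comp hornerZ hornerX. Qed.

Let hB k z : (B k.+1).[z] = (B k).[z] * (A k).[muK * z].
Proof. by rewrite /= hornerM horner_comp hornerZ hornerX. Qed.

Let muK_inf k : (0 < k)%N -> muK ^+ k != 1.
Proof. by move=> /inf; apply: contraNneq => e; rewrite -fmu -rmorphXn e rmorph1. Qed.

Let eval k z : cj a (f z) = mu * f z -> z != 0 ->
  [/\ (A k).[z] != 0, (B k).[z] != 0 &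
      iter k delta (1 + f z) = f ((A k).[z] / (B k).[z])].
Proof.
elim: k z => [|k IH] z cz z0.
  rewrite /= !hornerE invr1 mulr1 oner_eq0; split=> //; last first.
    by rewrite rmorphD rmorph1 addrC.
  rewrite addr_eq0; apply: contraNneq mu1 => e; move: cz.
  by rewrite e rmorphN rmorph1 cjN cj1 // mulrN mulr1 => /eqP; rewrite eqr_opp eq_sym.
have [A0 B0 e] := IH z cz z0.
have [||A1 B1 e1] := IH (muK * z).
- rewrite rmorphM fmu cjM // cz; congr (_ * _); exact: cj_id.
- by rewrite mulf_neq0 // -(fmorph_eq0 f) fmu.
rewrite hA hB !mulf_neq0 //; split=> //.
rewrite iterS.
have -> : delta (iter k delta (1 + f z)) =
    iter k delta (1 + f z) * (iter k delta (1 + f (muK * z)))^-1.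
  rewrite /delta; congr (_ * _^-1).
  have -> : 1 + f (muK * z) = cj a (1 + f z) by rewrite cjD cj1 // cz rmorphM fmu.
  elim: (k) => //= j <-; rewrite /delta cjM // cjV //.
rewrite e e1 -fmorphV -rmorphM; apply: (congr1 f).
by rewrite invf_div mulrACA -invfM.
Qed.

(** The numerator and the denominator of [delta^(m+1) (1 + z)] agree at all [z = mu ^ j * y], which
    are infinitely many, hence they are equal. But [-1] is a root of every numerator and of no
    denominator. *)
Lemma infinite_order_absurd : False.
Proof.
have muK0 : muK != 0 by rewrite -(fmorph_eq0 f) fmu.
have yK0 : yK != 0 by rewrite -(fmorph_eq0 f) fy.
pose z j := muK ^+ j * yK.
have zn0 j : z j != 0 by rewrite mulf_neq0 ?expf_neq0.
have cz j : cj a (f (z j)) = mu * f (z j).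
  rewrite rmorphM rmorphXn fmu fy cjM // ay !mulrA; congr (_ * _).
  by rewrite cj_id -?exprS -?exprSr //; apply: commrX; rewrite /GRing.comm mua.
have AeB j : (A m.+1).[z j] = (B m.+1).[z j].
  have [A0 B0 e] := eval m.+1 (cz j) (zn0 j).
  have Y1z : star U (1 + f (z j)).
    split; first by apply: (drD dU); [exact: (dr1 dU)|apply: YU].
    have [n0 _ _] := eval 0 (cz j) (zn0 j).
    by move: n0; rewrite /= !hornerE addrC -(fmorph_eq0 f) rmorphD rmorph1.
  move: e; rewrite delta_nilp // -(rmorph1 f) => /fmorph_inj e.
  by rewrite -[RHS]mul1r e divfK.
have ABeq : A m.+1 = B m.+1.
  apply/eqP; rewrite -subr_eq0; apply: contraT => p0.
  set p := _ - _ in p0; have := @max_poly_roots _ p [seq z j | j <- iota 0 (size p)] p0.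
  rewrite size_map size_iota ltnn => -> //.
    by apply/allP => _ /mapP [j _ ->]; rewrite rootE /p hornerD hornerN AeB subrr.
  rewrite map_inj_uniq ?iota_uniq // => i j; wlog ij : i j / (i <= j)%N.
    by move=> h; case: (leqP i j) => [|/ltnW] ij e; [exact: h|apply/esym/h].
  move=> /(mulIf yK0) e; apply/eqP; rewrite eqn_leq ij leqNgt; apply/negP => ji.
  have /eqP : muK ^+ (j - i) = 1.
    apply: (mulIf (expf_neq0 i muK0)); rewrite -exprD subnK // mul1r; exact/esym/e.
  by apply/negP/muK_inf; rewrite subn_gt0.
have claim k : [/\ (A k).[-1] = 0, forall j, (B k).[- (muK ^+ j)] != 0 &
    forall j, (A k).[- (muK ^+ j.+1)] != 0].
  elim: k => [|k [h1 h2 h3]].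
    split=> [|j|j]; rewrite /= !hornerE ?addNr ?oner_neq0 //.
    by rewrite addrC subr_eq0 eq_sym muK_inf.
  split=> [|j|j]; rewrite ?hA ?hB ?h1 ?mul0r // mulf_neq0 // mulrN -exprS //.
have [A1 B1 _] := claim m.+1; have := B1 0%N.
by rewrite expr0 -ABeq A1 eqxx.
Qed.

End InfiniteOrder.

(* The fixed field [Phi] of [a] in [Y] turns out to be finite; then so is [U],
   which is commutative by Wedderburn's theorem. *)
Lemma finite_order_absurd r : (0 < r)%N -> mu ^+ r = 1 -> False.
Proof.
move=> r0 mur.
have ar_y : a ^+ r * y = y * a ^+ r.
  by apply: (cj_idP hD); [exact: expdn0|rewrite iter_cj // mur mul1r].
have yr_a : y ^+ r * a = a * y ^+ r.
  apply/esym/(cj_idP hD a0).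
  have -> : forall k, cj a (y ^+ k) = mu ^+ k * y ^+ k; last by rewrite mur mul1r.
  elim=> [|k IH]; first by rewrite !expr0 cj1 // mulr1.
  rewrite exprS cjM // IH ay !exprS -!mulrA; congr (_ * _).
  by rewrite !mulrA; congr (_ * _); apply: commrX; rewrite /GRing.comm muy.
have sY := sg_star hD dY.
have [vs hvs] := roots_of_unity_finite hD dY aY r0.
have Yd x : star Y x -> star Y (delta x).
  move=> [Yx x0]; apply: sgM => //; apply: sgV => //; split; first exact: Ycj.
  by rewrite cj_eq0.
have [|||l hl] := @finite_mod_kernel D hD (star Y) delta vs m.+1 sY Yd.
- move=> x z [Yx x0] [Yz z0]; rewrite /delta cjM // (invMd hD) mulrA.
  have Ysz : Y (z * (cj a z)^-1) by apply: (drM dY) => //; apply: (drV dY); exact: Ycj.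
  have Ysx : Y (cj a x)^-1 by apply: (drV dY); exact: Ycj.
  by rewrite -!mulrA; congr (_ * _); rewrite mulrA; exact: aY.
(* Here [v = delta x] is fixed by [a], so [x = v ^+ k * cj (a ^+ k) x] for all [k]; as [a ^+ r] is
   central in [U], [k = r] gives [v ^+ r = 1]. *)
- move=> x Yx e; have [Yv v0] := Yd _ Yx; have [Yx' x0] := Yx; apply: hvs => //.
  have av : cj a (delta x) = delta x.
    have c0 : cj a (delta x) != 0 by rewrite cj_eq0.
    by apply/esym/(mulId hD (invdn0 c0)); rewrite muldV.
  have xv k : x = delta x ^+ k * cj (a ^+ k) x.
    elim: k => [|k IH]; first by rewrite !expr0 /cj invr1 mulr1 !mul1r.
    rewrite {1}IH exprSr -mulrA; congr (_ * _).
    have ak0 : a ^+ k != 0 by exact: expdn0.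
    have c0 : cj a x != 0 by rewrite cj_eq0.
    have {1}-> : x = delta x * cj a x by rewrite /delta; gw.
    rewrite cjM // -cjJ // -exprSr; congr (_ * _); apply: cj_id => //.
    by apply/esym/commrX/esym; exact: (cj_idP hD a0).
  apply: (mulId hD x0); rewrite mul1r [RHS](xv r); congr (_ * _); apply/esym.
  apply: (cj_id hD); first exact: expdn0.
  apply/esym/centralU => //; last exact: YU.
  by apply/esym/commrX.
- by move=> x [Yx x0]; apply: delta_nilp; split=> //; exact: YU.
pose Phi := Y `&` centr [set a].
have dPhi : divring Phi by apply: divringI => //; exact: divring_centr.
have nPy : ~ Phi y.
  move=> [_ /(_ a erefl) e]; case/negP: mu1; apply/eqP; apply: (mulId hD y0).
  by rewrite -ay mul1r cj_id // e.
(* The map [t |-> y + t] embeds [Phi] into the finite quotient of [star Y] by [star Phi]: were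
   [y + t] and [y + t'] proportional over [Phi] with [t != t'], a linear equation would put [y] in
   [Phi]. *)
have [lP hlP] : exists lP : seq D, forall t, Phi t -> t \in lP.
  exists [seq xget 0 [set t | Phi t /\ Phi ((y + t) * w^-1)] | w <- l] => t Pt.
  have yt0 t' : Phi t' -> y + t' != 0.
    move=> Pt'; apply/eqP => /eqP; rewrite addr_eq0 => /eqP e.
    by apply: nPy; rewrite e; apply: (drN dPhi).
  have [w [wl [Yw w0] e]] : exists w, [/\ w \in l, star Y w & delta ((y + t) * w^-1) = 1].
    by apply: hl; split; [apply: (drD dY) => //; case: Pt|exact: yt0].
  have fixP x : Y x -> x != 0 -> delta x = 1 -> Phi x.
    move=> Yx x0 dx; split=> // _ ->; apply/esym/(cj_idP hD a0).
    have c0 : cj a x != 0 by rewrite cj_eq0.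
    by apply: (mulId hD (invdn0 c0)); rewrite muldV // -dx.
  have Pw : Phi ((y + t) * w^-1).
    apply: fixP => //; last by rewrite muldn0 ?invdn0 // yt0.
    apply: (drM dY); last exact: (drV dY).
    by apply: (drD dY) => //; case: Pt.
  apply/mapP; exists w => //; case: xgetP => [t' _ [Pt' Pw']|/(_ t)]; last by case.
  have Pz : Phi ((y + t) * (y + t')^-1).
    have -> : (y + t) * (y + t')^-1 = ((y + t) * w^-1) * ((y + t') * w^-1)^-1 by gw.
    by apply: (drM dPhi) => //; apply: (drV dPhi).
  set z := _ * _ in Pz; have ez : z * (y + t') = y + t.
    by have := yt0 _ Pt'; rewrite /z => ?; gw.
  case: (eqVneq z 1) => [z1|z1].
    by move: ez; rewrite z1 mul1r => /addrI.
  case: nPy; have z10 : z - 1 != 0 by rewrite subr_eq0.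
  have -> : y = (z - 1)^-1 * (t - z * t').
    apply: (mulDI hD z10); rewrite mulVKd // mulrBl mul1r.
    by apply/eqP; rewrite subr_eq addrAC eq_sym subr_eq -mulrDr ez addrC.
  apply: (drM dPhi); first by apply: (drV dPhi); apply: (drB dPhi) => //; exact: (dr1 dPhi).
  by apply: (drB dPhi) => //; apply: (drM dPhi).
(* Central elements of [U] lie in the finite [Phi]; applied to [a ^+ r] and [y ^+ r], this bounds
   the exponents of [a] and [y]. *)
have finord z : U z -> z * a = a * z -> z * y = y * z -> z != 0 ->
    exists2 n, (0 < n)%N & z ^+ n = 1.
  move=> Uz za zy z0; apply: (finite_order hD z0 (l := lP)) => n; apply: hlP.
  apply: (drX dPhi); split; first exact: Ycentral.
  by move=> _ ->.
have aar : a ^+ r * a = a * a ^+ r by apply/esym/commrX.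
have yyr : y ^+ r * y = y * y ^+ r by apply/esym/commrX.
have [s1 s10 as1] := finord _ (drX dU r Ua) aar ar_y (expdn0 hD r a0).
have [s2 s20 ys2] := finord _ (drX dU r Uy) yr_a yyr (expdn0 hD r y0).
have modX x s k : (0 < s)%N -> x ^+ s = 1 -> x ^+ k = x ^+ (k %% s) :> D.
  by move=> _ xs; rewrite {1}(divn_eq k s) exprD mulnC exprM xs expr1n mul1r.
pose T : set D := [set x | exists i j : nat, x = a ^+ i * y ^+ j].
pose lT := [seq a ^+ i * y ^+ j | i <- iota 0 (r * s1), j <- iota 0 (r * s2)].
have hT x : T x -> x \in lT.
  move=> [i [j ->]]; rewrite (modX a (r * s1)%N i) ?muln_gt0 ?r0 ?exprM //.
  rewrite (modX y (r * s2)%N j) ?muln_gt0 ?r0 ?exprM //; apply/allpairsP.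
  by exists (i %% (r * s1), j %% (r * s2))%N; rewrite !mem_iota !ltn_mod !muln_gt0 r0 s10.
have [lW hW] := span_finite dPhi hlP hT.
set W := span Phi T in hW.
have Phi_c x z : Phi x -> U z -> x * z = z * x.
  move=> [Yx ax] Uz; apply/esym/centralU => //; [exact: ax|exact: Yy_comm].
have Pmu : Phi mu by split=> // _ ->.
have T1 : T 1 by exists 0%N, 0%N; rewrite !expr0 mulr1.
have TU x : T x -> U x.
  by move=> [i [j ->]]; apply: (drM dU); apply: (drX dU).
have yja j : exists2 e, Phi e & y ^+ j * a = e * (a * y ^+ j).
  elim: j => [|j [e Pe IH]]; first by exists 1; [exact: (dr1 dPhi)|rewrite !expr0 mulr1 !mul1r].
  exists (e * mu^-1); first by apply: (drM dPhi) => //; apply: (drV dPhi).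
  have ya : y * a = mu^-1 * (a * y) by rewrite -(cj_mul hD y a0) ay; gw.
  rewrite exprS -mulrA IH mulrA -(Phi_c e) // -!mulrA; congr (_ * _).
  by rewrite mulrA ya -!mulrA.
have yjai i j : exists2 e, Phi e & y ^+ j * a ^+ i = e * (a ^+ i * y ^+ j).
  elim: i => [|i [e Pe IH]]; first by exists 1; [exact: (dr1 dPhi)|rewrite expr0 mulr1 !mul1r].
  have [e' Pe' e'E] := yja j.
  exists (e * e'); first exact: (drM dPhi).
  rewrite exprSr mulrA IH -!mulrA e'E; congr (_ * _); rewrite mulrA -(Phi_c e') -?mulrA //.
  exact: (drX dU).
have TM x z : T x -> T z -> W (x * z).
  move=> [i [j ->]] [i' [j' ->]]; have [e Pe ee] := yjai i' j.
  have -> : a ^+ i * y ^+ j * (a ^+ i' * y ^+ j') = e * (a ^+ (i + i') * y ^+ (j + j')).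
    rewrite !exprD -!mulrA [y ^+ j * _]mulrA ee -!mulrA [a ^+ i * _]mulrA.
    by rewrite -(Phi_c e) // ?mulrA //; apply: (drX dU).
  by apply: span1 => //; exists (i + i')%N, (j + j')%N.
have WM x z : W x -> W z -> W (x * z).
  move=> Wx; move: z; apply: span_min => [|u v|e t Pe Tt].
  - by rewrite mulr0; apply: span0.
  - by move=> ? ?; rewrite mulrDr; apply: spanD.
  move: x Wx; apply: span_min => [|u v|e' t' Pe' Tt'].
  - by rewrite mul0r; apply: span0.
  - by move=> ? ?; rewrite mulrDl; apply: spanD.
  have -> : e' * t' * (e * t) = (e' * e) * (t' * t).
    by rewrite -!mulrA [t' * (e * _)]mulrA -(Phi_c e) ?mulrA //; exact: TU.
  by apply: spanZ => //; [exact: (drM dPhi)|exact: TM].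
have sW : subring W.
  split=> //; [exact: span0| | |].
  - exact: (span_mem dPhi).
  - by move=> x; apply: (spanN dPhi).
  - by move=> x z; apply: spanD.
have dW := finite_subring_divring hD sW hW.
have UW : U `<=` W.
  apply: Dgen_min => // x [->|->]; apply: (span_mem dPhi).
    by exists 1%N, 0%N; rewrite expr1 expr0 mulr1.
  by exists 0%N, 1%N; rewrite expr1 expr0 mul1r.
have aU := finite_divring_abelian hD dU (fun x Ux => hW x (UW x Ux)).
case/negP: mu1; apply/eqP; apply: (mulId hD y0); rewrite -ay mul1r cj_id //.
exact: aU.
Qed.

Lemma engel_absurd : False.
Proof.
case: (pselect (exists2 r, (0 < r)%N & mu ^+ r = 1)) => [[r r0]|no].
  exact: finite_order_absurd.
have [K [f fY]] := divring_field dY hD aY.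
have [muK fmu] := (fY mu).1 Ymu; have [yK fy] := (fY y).1 Yy.
apply: (@infinite_order_absurd _ K f muK yK) => // [k k0|z]; last by apply/fY; exists z.
by apply/eqP => e; apply: no; exists k.
Qed.

End Engel.

Section Subnormal.
Variables (D : unitRingType) (hD : is_division_ring D).
Implicit Types (U X A B G : set D).

Definition commute_with X U := forall x u, X x -> U u -> x * u = u * x.

(** Each conjugation descends one step of the chain: [Z] being normal in the group above it, a
    conjugate of [a] by an element of that group lies in [Z]. *)
Lemma subnorm_iter_cj U n Z a d : divring U -> subnorm U n Z -> Z a -> star U d ->
  Z (iter n (fun d => cj d a) d).
Proof.
move=> dU sZ; move=> + Ud; elim: sZ => {n Z} [//|k X Y sY IH nX Xa].
by apply: (normal_cj nX _ Xa); apply: IH => //; exact: (nsub nX Xa).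
Qed.

Lemma normal_center B G : normal B G -> normal (B `&` centr B) G.
Proof.
move=> nB; have sB := nsgN nB; have sG := nsgG nB.
have sZ : subgroup (B `&` centr B).
  split.
  - by move=> x [/(sgn0 sB)].
  - by split; [exact: sg1|move=> z _; rewrite mul1r mulr1].
  - move=> x z [Bx cx] [Bz cz]; split; first exact: sgM.
    exact: (drM (divring_centr hD B)).
  - move=> x [Bx cx]; split; first exact: sgV.
    exact: (drV (divring_centr hD B)).
apply: (normalP sZ sG) => [x [/(nsub nB)]//|g x Gg [Bx cx]].
split; first exact: normal_cj nB _ _.
exact: normz_cj (normz_centr hD (normal_normz nB Gg)) cx.
Qed.

Lemma abelian_gen X : X `<=` @Dstar D -> abelian X -> abelian (gen X).
Proof.
move=> X0 aX; have h : gen X `<=` star (Dgen X).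
  apply: gen_min; first exact: (sg_star hD (divring_Dgen _)).
  by move=> x Xx; split; [exact: Dgen_sub|exact: X0].
by move=> x z /h [Gx _] /h [Gz _]; exact: (abelian_Dgen hD aX).
Qed.

(* By induction commutators [cmm a y] are central in the division ring generated
   by [A] and [y], which is the configuration excluded by [engel_absurd]. *)
Lemma abelian_subnormal_central n : forall U A, divring U -> subnorm U n A ->
  abelian A -> commute_with A U.
Proof.
elim: n => [|n IH] U A dU sA aA.
  inversion sA; subst => x u Ax Uu; case: (eqVneq u 0) => [->|u0].
    by rewrite mulr0 mul0r.
  exact: aA.
have sAg := subnorm_sg hD dU sA; have AU := subnorm_sub dU sA.
inversion sA as [|k A' B sB nA]; subst.
have sBg := subnorm_sg hD dU sB; have BU := subnorm_sub dU sB.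
have AB : commute_with A B.
  move=> a y Aa By; apply: contrapT => nay.
  have a0 := sgn0 sAg Aa; have y0 := sgn0 sBg By.
  pose K := Dgen A; have dK : divring K by exact: divring_Dgen.
  have aK : abelian K by exact: (abelian_Dgen hD aA).
  have BK : B `<=` normz K.
    by move=> b Bb; apply: (normz_Dgen hD); exact: normal_normz nA _ Bb.
  pose V := Dgen (K `|` [set y]); have dV : divring V by exact: divring_Dgen.
  have KV : K `<=` V by move=> x Kx; apply: Dgen_sub; left.
  have Vy : V y by apply: Dgen_sub; right.
  have Ka : K a by exact: Dgen_sub.
  have VU : V `<=` U.
    apply: Dgen_min => // x [Kx|->]; last by case: (BU _ By).
    by apply: (Dgen_min dU _ Kx) => z /AU [].
  have sX := subnorm_I hD dU dV VU sB; set X := B `&` V in sX.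
  have sXg := subnorm_sg hD dV sX.
  have XK : X `<=` normz K by move=> x [/BK].
  case: n IH sA sB sX => [|n] IH sA sB sX.
    have XE : X = star V by inversion sX.
    rewrite XE in XK.
    case: (cartan_brauer_hua hD dV dK KV XK) => [KE|cK].
      by apply: nay; apply: aK => //; rewrite KE.
    by apply: nay; apply/esym/cK.
  (* The derived subgroup of [X] is abelian and no deeper than [B], so by induction central in [V];
     in particular [cmm a y] is. *)
  have aX' := cyclic_normalizer_der hD dK (BK _ By) aK sXg (fun x Xx => proj2 Xx) XK.
  have cX' := IH V _ dV (subnorm_der hD 1 dV sX) aX'.
  have Xa : X a by split; [exact: nsub nA _ Aa|exact: KV].
  have Xy : X y by [].
  have hmu := cX' _ _ (der_cmm sXg Xa Xy).
  have av : cj a y = cmm a y * y by rewrite /cmm /cj; gw.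
  (* The first [n + 2] conjugations bring [d] down into [A], whose elements commute with [a]; one
     more gives [a]. *)
  apply: (engel_absurd hD a0 y0 av (m := n.+3)).
  - by apply/eqP => e; apply: nay; exact: (cmm1P hD a0 y0).
  - by apply: hmu; exact: KV.
  - exact: hmu.
  move=> d [Vd d0]; have Ud : star U d.
    split=> //; apply: VU; apply: (Dgen_min dV _ Vd) => x [->|->] //; exact: KV.
  have p := subnorm_iter_cj dU sA Aa Ud; rewrite iterS.
  by apply: (cj_id hD); [exact: sgn0 p|exact: aA].
case: n IH sA sB => [|n] IH sA sB.
  inversion sB; subst => x u Ax Uu; case: (eqVneq u 0) => [->|u0].
    by rewrite mulr0 mul0r.
  exact: AB.
inversion sB as [|k B' B2 sB2 nB]; subst.
have sZ := subnorm_step sB2 (normal_center nB).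
move=> x u Ax Uu; apply: (IH U _ dU sZ) => //.
  by move=> z w [Bz cz] [Bw _]; exact: cz.
by split; [exact: nsub nA _ Ax|move=> b Bb; exact: AB].
Qed.

(** By induction on the derived length [der X] is central; with any [x] in [X] it then generates an
    abelian normal subgroup of [X]. *)
Lemma solv_subnormal_central U n X : divring U -> subnorm U n X -> solv X ->
  commute_with X U.
Proof.
move=> dU sX [k]; elim: k n X sX => [|k IH] n X sX.
  by move=> X1 x u /X1 -> _; rewrite mul1r mulr1.
rewrite /derk iterSr => hk; have sXg := subnorm_sg hD dU sX.
have nX' := normal_der hD (normal_refl sXg).
have cX' := IH _ _ (subnorm_step sX nX') hk.
move=> x u Xx Uu; pose S := [set x] `|` der X.
have XU := subnorm_sub dU sX; have dX := @der_sub D X sXg.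
have SX : S `<=` X by move=> z [->|/dX].
have S0 : S `<=` @Dstar D by move=> z /SX /(sgn0 sXg).
have aS : abelian S.
  have UX z : X z -> U z by move=> /XU [].
  move=> z w [->|dz] [->|dw] //; last 2 first.
  - by apply: cX' => //; exact: UX.
  - by apply: cX' => //; apply: UX; exact: dX.
  - by apply/esym/cX' => //; exact: UX.
have sS := sg_gen hD S0.
have GX : gen S `<=` X by apply: gen_min.
have nS : normal (gen S) X.
  apply: (normalP sS sXg GX) => g z Xg; have g0 := sgn0 sXg Xg.
  apply: (gen_cj hD S0 S0 g0) => w [->|dw]; last first.
    by apply: sgen_sub; right; exact: normal_cj nX' Xg dw.
  have x0 := sgn0 sXg Xx.
  have -> : cj g x = cmm g x * x by rewrite /cmm /cj; gw.
  by apply: (sgM sS); apply: sgen_sub; [right; exact: der_cmm|left].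
apply: (abelian_subnormal_central dU (subnorm_step sX nS)) => //.
  exact: abelian_gen.
by apply: sgen_sub; left.
Qed.

Lemma Dgen_star U : divring U -> Dgen (star U) = U.
Proof.
move=> dU; apply/seteqP; split; first by apply: Dgen_min => // x [].
move=> x Ux; case: (eqVneq x 0) => [->|x0]; first exact: (dr0 (divring_Dgen _)).
by apply: Dgen_sub.
Qed.

(** Suppose that [E = Dgen X] is proper and take [y] in [G] outside it. In [V = E(y)] the second
    derived subgroup of [G1] lies in [E]. If it is noncentral in [V], it generates [V] by induction,
    although [y] is not in [E]; if central, [G1] is solvable, hence central in [V], which makes [X]
    abelian and so central in [U]. *)
Theorem Dgen_subnormal n : forall U X, divring U -> subnorm U n X ->
  ~ commute_with X U -> Dgen X = U.
Proof.
elim: n => [|n IH] U X dU sX ncX; first by inversion sX; exact: Dgen_star.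
inversion sX as [|k X' G sG nX]; subst.
have sXg := subnorm_sg hD dU sX; have sGg := subnorm_sg hD dU sG.
have XU := subnorm_sub dU sX; have GU := subnorm_sub dU sG.
pose E := Dgen X; have dE : divring E by exact: divring_Dgen.
have EU : E `<=` U by apply: Dgen_min => // x /XU [].
have GE : G `<=` normz E.
  by move=> g Gg; apply: (normz_Dgen hD); exact: normal_normz nX _ Gg.
case: n IH sX sG => [|n] IH sX sG.
  have GE' : G = star U by inversion sG.
  rewrite GE' in GE; case: (cartan_brauer_hua hD dU dE EU GE) => // cE.
  by case: ncX => x u Xx Uu; apply/esym/cE => //; exact: Dgen_sub.
have ncG : ~ commute_with G U.
  by move=> cG; apply: ncX => x u Xx; apply: cG; exact: nsub nX _ Xx.
have GD := IH U G dU sG ncG.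
apply: contrapT => EnU; have [y Gy nEy] : exists2 y, G y & ~ E y.
  apply: contrapT => no; apply: EnU; apply/seteqP; split=> //.
  rewrite -{1}GD; apply: Dgen_min => // y Gy; apply: contrapT => nEy.
  by apply: no; exists y.
pose V := Dgen (E `|` [set y]); have dV : divring V by exact: divring_Dgen.
have EV : E `<=` V by move=> x Ex; apply: Dgen_sub; left.
have Vy : V y by apply: Dgen_sub; right.
have VU : V `<=` U by apply: Dgen_min => // x [/EU//|->]; case: (GU _ Gy).
have sG1 := subnorm_I hD dU dV VU sG; set G1 := G `&` V in sG1.
have sG1g := subnorm_sg hD dV sG1.
have d2 : derk 2 G1 `<=` E.
  apply: (cyclic_normalizer_der2 hD dE (GE _ Gy) sG1g (fun x Xx => proj2 Xx)).
  by move=> x [/GE].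
have sd2 := subnorm_der hD 2 dV sG1.
case: (pselect (commute_with (derk 2 G1) V)) => [c2|nc2]; last first.
  by apply: nEy; apply: (Dgen_min dE d2); rewrite (IH V _ dV sd2 nc2).
have sG1s : solv G1.
  exists 3; apply: der_min; [exact: (sg_derk hD 2 sG1g)|split|].
  - by move=> _ ->; exact: oner_neq0.
  - by [].
  - by move=> _ _ -> ->; rewrite mulr1.
  - by move=> _ ->; rewrite invr1.
  move=> x z dx dz; have s2 : subgroup (derk 2 G1) by exact: sg_derk.
  apply: (cmm_eq1 hD (sgn0 s2 dx) (sgn0 s2 dz)); apply: c2 => //.
  exact: EV (d2 _ dz).
have cG1 := solv_subnormal_central dV sG1 sG1s.
apply: ncX; apply: (abelian_subnormal_central dU sX) => x z Xx Xz.
have XV w : X w -> V w by move=> Xw; apply: EV; exact: Dgen_sub.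
by apply: cG1; [split; [exact: nsub nX _ Xx|exact: XV]|exact: XV].
Qed.

Lemma subnormal_subnorm G : subgroup G -> subnormal G ->
  exists n, subnorm [set: D] n G.
Proof.
move=> sG [n [S [S0 Sn hS]]]; exists n.
suff h k : (k <= n)%N -> subnorm [set: D] k (S (n - k)%N).
  by have := h n (leqnn n); rewrite subnn S0.
elim: k => [|k IH] kn.
  rewrite subn0 Sn; have -> : @Dstar D = star [set: D]; last exact: subnorm_star.
  by apply/seteqP; split=> x; [move=> ?; split|case].
apply: subnorm_step (IH (ltnW kn)) _.
have -> : (n - k = (n - k.+1).+1)%N by lia.
by apply: hS; lia.
Qed.

End Subnormal.

(** * Residual finiteness *)

Section ResidualFiniteness.

Lemma finite_field_root (k : finFieldType) (h : {poly k}) : (1 < size h)%N ->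
  exists (k' : finFieldType) (i : {rmorphism k -> k'}) (b : k'),
    root (map_poly i h) b.
Proof.
move=> h1; have h0 : h != 0 by rewrite -size_poly_gt0 (ltn_trans _ h1).
have [L [[|b rs] hrs _]] := FinSplittingFieldFor h0.
  have := eqp_size hrs; rewrite big_nil size_poly1 size_map_poly => e.
  by rewrite e in h1.
exists (FinFieldExtType L), (in_alg L), b.
by rewrite (eqp_root hrs) big_cons rootM root_XsubC eqxx.
Qed.

(** A root of ['X * h + 1] in an extension is not a root of [h]. *)
Lemma finite_field_nonroot (k : finFieldType) (h : {poly k}) : h != 0 ->
  exists (k' : finFieldType) (i : {rmorphism k -> k'}) (b : k'),
    ~~ root (map_poly i h) b.
Proof.
move=> h0; have [|k' [i [b rb]]] := @finite_field_root k ('X * h + 1).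
  rewrite size_polyDl ?size_mulXn ?size_mul ?polyX_eq0 // size_polyX ?size_poly1 /=.
    by rewrite ltnS size_poly_gt0.
  by rewrite ltnS size_poly_gt0.
exists k', i, b; apply: contraL rb => /rootP hb.
by rewrite rmorphD rmorphM /= rmorph1 rootE hornerD hornerM hb mulr0 add0r hornerC oner_eq0.
Qed.

Variable K : fieldType.

(* [A] stands for its image in [K], hence the condition on the kernel of [ev]. *)
Definition residually_finite (A : idomainType) (ev : {rmorphism A -> K}) :=
  forall r, ev r != 0 -> exists (k : finFieldType) (psi : {rmorphism A -> k}),
    (forall a, ev a = 0 -> psi a = 0) /\ psi r != 0.

(** As [psi] must kill the kernel of [ev], the prime is forced in positive characteristic; in
    characteristic zero any prime above [|r|] works. *)
Lemma residually_finite_int : residually_finite (intr : {rmorphism int -> K}).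
Proof.
have abszE (R : nzRingType) (a : int) : (a%:~R == 0 :> R) = (`|a|%N%:R == 0 :> R).
  by case: a => n; rewrite ?NegzE ?mulrNz ?oppr_eq0 -?pmulrn //.
move=> r; rewrite /= abszE => r0.
suff [p [pp hp pr]] : exists p, [/\ prime p, (forall n, n%:R = 0 :> K -> (p %| n)%N) &
    ~~ (p %| `|r|)%N].
  exists ('F_p : finFieldType), intr; split=> [a|] /=.
    move=> /eqP; rewrite abszE => /eqP /hp pa; apply/eqP.
    by rewrite abszE -(dvdn_pcharf (pchar_Fp pp)).
  by rewrite abszE -(dvdn_pcharf (pchar_Fp pp)).
case: (pselect (exists p, p \in [pchar K])) => [[p pK]|noch].
  exists p; split; first by case/andP: pK.
    by move=> n n0; rewrite (dvdn_pcharf pK) n0.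
  by rewrite (dvdn_pcharf pK).
have ch0 : [pchar K] =i pred0.
  by move=> p; apply/negbTE/negP => pK; apply: noch; exists p.
have [p rp pp] := prime_above `|r|; exists p; split=> // [n|].
  by move=> /eqP; rewrite ((pcharf0P K).1 ch0) => /eqP ->.
have rn0 : (0 < `|r|)%N by rewrite lt0n; apply: contraNneq r0 => ->.
by apply/negP => /(dvdn_leq rn0); rewrite leqNgt rp.
Qed.

Section Adjoin.
Variables (A : idomainType) (ev : {rmorphism A -> K}) (a : K).
Hypothesis rf : residually_finite ev.

Definition ev_adjoin : {rmorphism {poly A} -> K} := horner_eval a \o map_poly ev.
Local Notation "p ^ev" := (map_poly ev p) (at level 2).

Section Extend.
Variables (k : finFieldType) (psi : {rmorphism A -> k}).
Hypothesis psi0 : forall c, ev c = 0 -> psi c = 0.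
Variables (k' : finFieldType) (i : {rmorphism k -> k'}) (b : k').

Let psi' : {rmorphism {poly A} -> k'} := horner_eval b \o map_poly (i \o psi).

Lemma map_poly_ev0 p : p^ev = 0 -> map_poly psi p = 0.
Proof.
move=> p0; apply/polyP => j; rewrite coef_map /= coef0 psi0 //.
by rewrite -coef_map p0 coef0.
Qed.

End Extend.

(** [ev] may kill a leading coefficient; removing it keeps the image and lowers the size, so
    polynomials of minimal size have leading coefficients with nonzero image. *)
Let truncate p : ev (lead_coef p) = 0 -> p != 0 ->
  exists p' : {poly A}, [/\ (size p' < size p)%N, p'^ev = p^ev & (p - p')^ev = 0].
Proof.
move=> l0 p0; exists (take_poly (size p).-1 p).
have e : (take_poly (size p).-1 p)^ev = p^ev.
  apply/polyP => j; rewrite !coef_map coef_take_poly /=; case: ltnP => // pj.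
  rewrite rmorph0; apply/esym; case: (eqVneq j (size p).-1) => [->//|jp].
  rewrite nth_default ?rmorph0 // -(prednK (n := size p)) ?size_poly_gt0 //.
  by rewrite ltn_neqAle eq_sym jp.
split=> //; last by rewrite rmorphB /= e subrr.
by rewrite (leq_ltn_trans (size_take_poly _ _)) // prednK ?size_poly_gt0.
Qed.

(** If [a] is transcendental over the image of [ev], it is sent to a nonroot of the reduction of
    [r]. Otherwise it is sent to a root of the reduction of a minimal polynomial [q], and the
    reduction has to preserve the leading coefficient of [q] and a nonzero constant combination of
    [r] and [q]. *)
Lemma residually_finite_adjoin : residually_finite ev_adjoin.
Proof.
move=> r; rewrite -[_ r]/((r^ev).[a]) => r0.
have rev0 : r^ev != 0 by apply: contraNneq r0 => ->; rewrite horner0.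
pose P n := exists q : {poly A}, [/\ q^ev != 0, (q^ev).[a] = 0 & size q = n].
case: (pselect (exists n, P n)) => [/ex_min|nP]; last first.
  have tr p : (p^ev).[a] = 0 -> p^ev = 0.
    move=> pa; apply/eqP; apply: contraT => p0.
    by case: nP; exists (size p), p.
  pose j := (size r^ev).-1; have rj : ev r`_j != 0.
    by rewrite -coef_map -lead_coefE lead_coef_eq0.
  have [k [psi [psi0 pr]]] := rf rj.
  have rpsi : map_poly psi r != 0.
    by apply: contraNneq pr => e; rewrite -coef_map e coef0.
  have [k' [i [b rb]]] := finite_field_nonroot rpsi.
  pose psi' : {rmorphism {poly A} -> k'} := horner_eval b \o map_poly (i \o psi).
  have psi'E p : psi' p = (map_poly i (map_poly psi p)).[b] by rewrite -map_poly_comp.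
  exists k', psi'; split=> [p /tr p0|]; rewrite psi'E.
    by rewrite (map_poly_ev0 psi0) // rmorph0 horner0.
  by rewrite -rootE.
move=> [n [[q [qev qa sq]] qmin]].
have q0 : q != 0 by apply: contraNneq qev => ->; rewrite rmorph0.
have lq : ev (lead_coef q) != 0.
  apply/eqP => l0; have [q' [sq' e _]] := truncate l0 q0.
  have : P (size q') by exists q'; rewrite e.
  by move/qmin; rewrite leqNgt -sq sq'.
(* [I] is the ideal generated by [r], [q] and the kernel of [ev] on coefficients. An element [h] of
   least size stands for their gcd: it divides every element of [I] up to a power of its leading
   coefficient and modulo that kernel. *)
pose I h := exists s t z : {poly A}, h = r * s + q * t + z /\ z^ev = 0.
pose Q n := exists h, [/\ I h, h^ev != 0 & size h = n].
have [|nh [[h [Ih hev sh]] hmin]] := @ex_min Q.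
  exists (size r), r; split=> //; exists 1, 0, 0.
  by rewrite mulr1 mulr0 !addr0 rmorph0.
have h0 : h != 0 by apply: contraNneq hev => ->; rewrite rmorph0.
have ID u v : I u -> I v -> I (u + v).
  move=> [s [t [z [-> z0]]]] [s' [t' [z' [-> z0']]]].
  exists (s + s'), (t + t'), (z + z'); rewrite rmorphD /= z0 z0' addr0; split=> //.
  by rewrite !mulrDr addrACA; congr (_ + _); rewrite addrACA.
have IM u v : I u -> I (u * v).
  move=> [s [t [z [-> z0]]]]; exists (s * v), (t * v), (z * v).
  by rewrite rmorphM /= z0 mul0r !mulrDl !mulrA.
have Iz z : z^ev = 0 -> I z by move=> z0; exists 0, 0, z; rewrite !mulr0 !add0r.
have Ir : I r by exists 1, 0, 0; rewrite mulr1 mulr0 !addr0 rmorph0.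
have Iq : I q by exists 0, 1, 0; rewrite mulr1 mulr0 !addr0 add0r rmorph0.
have lh : ev (lead_coef h) != 0.
  apply/eqP => l0; have [h' [sh' e ez]] := truncate l0 h0.
  have : Q (size h').
    exists h'; rewrite e; split=> //; rewrite -[h'](subKr h); apply: ID => //.
    by rewrite -mulrN1; apply: IM; apply: Iz.
  by move/hmin; rewrite leqNgt -sh sh'.
have divh u : I u -> exists m (w : {poly A}), ev (lead_coef h) ^+ m *: u^ev = w^ev * h^ev /\
    (size w <= size u - (size h).-1)%N.
  move=> Iu; exists (scalp u h), (u %/ h); rewrite Pdiv.Idomain.size_divp //; split=> //.
  have e := Pdiv.Idomain.divp_eq u h; set m := scalp u h in e *.
  have rem0 : (u %% h)^ev = 0.
    apply/eqP; apply: contraT => n0; have : Q (size (u %% h)).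
      exists (u %% h); split=> //.
      have -> : u %% h = u * (lead_coef h ^+ m)%:P + h * (- (u %/ h)).
        by rewrite mulrC mul_polyC e mulrN addrAC [h * _]mulrC subrr add0r.
      by apply: ID; apply: IM.
    by move/hmin; rewrite leqNgt -sh Pdiv.Idomain.ltn_modp h0.
  by move: (congr1 (map_poly ev) e); rewrite linearZ_LR /= rmorphXn rmorphD rmorphM /= rem0 addr0.
have ha : (h^ev).[a] != 0.
  have [m [w [/(congr1 (fun p => p.[a])) e _]]] := divh _ Ir.
  move: e; rewrite hornerZ hornerM => e; apply: contraNneq r0 => e0.
  by move/eqP: e; rewrite e0 mulr0 mulf_eq0 expf_eq0 (negPf lh) andbF /=.
have [m [w [e sw]]] := divh _ Iq.
have wa : (w^ev).[a] = 0.
  move: (congr1 (fun p => p.[a]) e); rewrite hornerZ hornerM qa mulr0 => /esym/eqP.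
  by rewrite mulf_eq0 (negPf ha) orbF => /eqP.
have wev : w^ev != 0.
  apply: contraNneq qev => w0; move/eqP: e.
  by rewrite w0 mul0r scaler_eq0 expf_eq0 (negPf lh) andbF.
(* The cofactor [w] of [h] in [q] vanishes at [a] since [h] does not; it is therefore as long as
   [q], and [h] is a constant. *)
have /qmin : P (size w) by exists w.
move=> nw; have sh1 : size h = 1%N.
  have := leq_trans nw sw; rewrite -sq.
  have : (0 < size h)%N by rewrite size_poly_gt0.
  have : (0 < size q)%N by rewrite size_poly_gt0.
  lia.
have /size_poly1P [c c0 hc] : size h == 1%N by rewrite sh1.
have cev : ev c != 0.
  by apply: contraNneq hev => e0; rewrite hc map_polyC /= e0.
have [k [psi [psi0 pqc]]] : exists (k : finFieldType) (psi : {rmorphism A -> k}),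
    (forall a, ev a = 0 -> psi a = 0) /\ psi (lead_coef q * c) != 0.
  by apply: rf; rewrite rmorphM mulf_neq0.
move: pqc; rewrite rmorphM mulf_eq0 negb_or => /andP [pq pc].
have spq : size (map_poly psi q) = size q by apply: size_map_poly_id0.
have sq1 : (1 < size (map_poly psi q))%N.
  rewrite spq ltnNge; apply/negP => sq1; have := size1_polyC sq1.
  move=> qc; move: qa lq; rewrite qc map_polyC hornerC lead_coefC => -> .
  by rewrite eqxx.
have [k' [i [b rb]]] := finite_field_root sq1.
pose psi' : {rmorphism {poly A} -> k'} := horner_eval b \o map_poly (i \o psi).
have psi'E p : psi' p = (map_poly i (map_poly psi p)).[b] by rewrite -map_poly_comp.
have psi'z p : p^ev = 0 -> psi' p = 0.
  by move=> p0; rewrite psi'E (map_poly_ev0 psi0) // rmorph0 horner0.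
have psi'q : psi' q = 0 by rewrite psi'E; apply/rootP.
have psi'C d : psi' d%:P = i (psi d) by rewrite psi'E !map_polyC hornerC.
exists k', psi'; split=> [p pa|].
  have ep := Pdiv.Idomain.divp_eq p q.
  have rem0 : (p %% q)^ev = 0.
    apply/eqP; apply: contraT => n0; have : P (size (p %% q)).
      exists (p %% q); split=> //.
      move: (congr1 ev_adjoin ep); rewrite -mul_polyC rmorphM pa mulr0 rmorphD rmorphM.
      by rewrite [ev_adjoin q]qa mulr0 add0r.
    by move/qmin; rewrite leqNgt -sq Pdiv.Idomain.ltn_modp q0.
  move: (congr1 psi' ep); rewrite -mul_polyC rmorphM rmorphD rmorphM psi'q (psi'z _ rem0).
  rewrite mulr0 addr0 psi'C rmorphXn /= rmorphXn => /eqP.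
  by rewrite mulf_eq0 expf_eq0 fmorph_eq0 (negPf pq) andbF => /eqP.
have [s [t [z [hE z0]]]] := Ih.
move: (congr1 psi' hE); rewrite hc psi'C !rmorphD !rmorphM psi'q mul0r addr0 (psi'z _ z0) addr0.
move=> ec; apply: contraNneq pc => e0; move: ec; rewrite e0 mul0r => /eqP.
by rewrite fmorph_eq0.
Qed.

End Adjoin.

Lemma residually_finite_cover (s : seq K) :
  exists (A : idomainType) (ev : {rmorphism A -> K}), residually_finite ev /\
    forall x, x \in s -> exists c, ev c = x.
Proof.
elim: s => [|a s [A [ev [rf hs]]]].
  by exists int, intr; split=> //; exact: residually_finite_int.
exists {poly A}, (ev_adjoin ev a); split; first exact: residually_finite_adjoin.
move=> x; rewrite inE => /orP [/eqP ->|/hs [c <-]].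
  by exists 'X; rewrite /= /horner_eval map_polyX hornerX.
by exists c%:P; rewrite /= /horner_eval map_polyC hornerC.
Qed.

End ResidualFiniteness.

(** * Finiteness modulo the center *)

Section FiniteModCenter.
Variables (D : unitRingType) (hD : is_division_ring D).
Implicit Types (X H N A S E : set D) (l : seq D).

Local Notation F := (@center D).

Lemma divring_center : divring F.
Proof.
have -> : F = centr [set: D]; last exact: divring_centr.
by apply/seteqP; split=> x cx y; [move=> _|]; exact: cx.
Qed.
Local Notation dF := divring_center.

Lemma cj_central g z : g != 0 -> F z -> cj g z = z.
Proof. by move=> g0 Fz; apply: (cj_id hD) => //; apply/esym/Fz. Qed.

Lemma normz_center g : g != 0 -> normz F g.
Proof. by move=> g0; split=> // e Fe; rewrite cj_central // invdn0. Qed.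

Definition finite_mod X E := exists l, forall x, X x ->
  exists y z, [/\ y \in l, E z, z != 0 & x = y * z].

Lemma finite_mod_sub X l : (forall x, X x -> exists y z,
    [/\ y \in l, F z, z != 0 & x = y * z]) ->
  X `<=` @Dstar D ->
  exists l', (forall y, y \in l' -> X y) /\
    forall x, X x -> exists y z, [/\ y \in l', F z, z != 0 & x = y * z].
Proof.
move=> hl X0; pose g y := xget 1 [set x | X x /\ exists z, [/\ F z, z != 0 & x = y * z]].
exists [seq g y | y <- l & `[< X (g y) >]]; split.
  by move=> _ /mapP [y + ->]; rewrite mem_filter => /andP [/asboolP].
move=> x Xx; have [y [z [yl Fz z0 xE]]] := hl x Xx.
have [Xg [w [Fw w0 gE]]] : X (g y) /\ exists z, [/\ F z, z != 0 & g y = y * z].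
  by rewrite /g; case: xgetP => [//|/(_ x) []]; split=> //; exists z.
exists (g y), (w^-1 * z); split.
- by apply: map_f; rewrite mem_filter yl andbT; apply/asboolP.
- by apply: (drM dF) => //; exact: (drV dF).
- by rewrite muldn0 ?invdn0.
- by rewrite xE gE; gw.
Qed.

(** Among the first powers of [x] two lie in the same class; the difference of their exponents is at
    most [size l], so it divides the factorial. *)
Lemma finite_mod_power X l x : subgroup X -> (forall x, X x -> exists y z,
    [/\ y \in l, F z, z != 0 & x = y * z]) -> X x -> F (x ^+ (size l).+1`!).
Proof.
move=> sX hl Xx; have x0 := sgn0 sX Xx.
have hx (n : nat) := hl (x ^+ n) (sgX n sX Xx).
pose y n := xget 0 [set y | exists z, [/\ y \in l, F z, z != 0 & x ^+ n = y * z]].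
have hy n : exists z, [/\ y n \in l, F z, z != 0 & x ^+ n = y n * z].
  by rewrite /y; case: xgetP => [//|h]; have [w [z hw]] := hx n; case: (h w); exists z.
have [|i [j [ij js e]]] := @pigeonhole D l y; first by move=> n; have [z []] := hy n.
have [z [_ Fz z0 ze]] := hy i; have [w [_ Fw w0 we]] := hy j.
have Fij : F (x ^+ (j - i)).
  have -> : x ^+ (j - i) = z^-1 * w.
    apply: (mulId hD (expdn0 hD i x0)); rewrite -exprD subnK ?(ltnW ij) // we -e ze.
    by rewrite -mulrA Fw -(Fz (y i)); gw.
  by apply: (drM dF) => //; exact: (drV dF).
have /dvdnP [q ->] : (j - i %| (size l).+1`!)%N.
  by apply: dvdn_fact; rewrite subn_gt0 ij /=; lia.
by rewrite mulnC exprM; exact: (drX dF).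
Qed.

(* [H] permutes the finite set [X / F]; since [X / F] has finite exponent [e],
   two conjugates of [y] in the same class differ by an [e]-th root of unity. *)
Lemma finite_mod_normalizer X H : normal X H -> centr X `<=` F ->
  finite_mod X F -> finite_mod H F.
Proof.
move=> nX cX [l0 /finite_mod_sub]; have sX := nsgN nX; have sH := nsgG nX.
case/(_ (fun x => sgn0 sX)) => l [lX hl].
have aF : abelian F by move=> x y Fx _; exact: Fx.
have [vs hvs] := roots_of_unity_finite hD dF aF (fact_gt0 (size l).+1).
have conj_finite y : y \in l -> exists s : seq D, forall h, H h -> cj h y \in s.
  move=> /lX Xy; have y0 := sgn0 sX Xy.
  pose g w := xget 1 [set h | H h /\ exists z, [/\ F z, z != 0 & cj h y = w * z]].
  exists [seq v * cj (g w) y | v <- vs, w <- l] => h Hh; have h0 := sgn0 sH Hh.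
  have [w [z [wl Fz z0 e]]] := hl _ (normal_cj nX Hh Xy).
  have [Hg [z' [Fz' z0' e']]] : H (g w) /\ exists z, [/\ F z, z != 0 & cj (g w) y = w * z].
    by rewrite /g; case: xgetP => [//|/(_ h) []]; split=> //; exists z.
  apply/allpairsP; exists (z * z'^-1, w); split=> //=.
    have g0 := sgn0 sH Hg; set v := z * z'^-1; have v0 : v != 0 by rewrite muldn0 ?invdn0.
    have Fv : F v by apply: (drM dF) => //; exact: (drV dF).
    apply: hvs => //; set k := (_ `!)%N.
    have Fyk : F (y ^+ k) by exact: (finite_mod_power sX hl Xy).
    have cX_ u : u != 0 -> cj u (y ^+ k) = cj u y ^+ k.
      move=> u0; elim: (k) => [|i IH]; first by rewrite !expr0 cj1.
      by rewrite !exprS cjM // IH.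
    have yk0 : y ^+ k != 0 by exact: expdn0.
    apply: (mulId hD yk0); rewrite mul1r -{2}(cj_central h0 Fyk) -{1}(cj_central g0 Fyk).
    rewrite !cX_ // -exprMn_comm; last exact: Fv.
    by congr (_ ^+ _); rewrite e e' Fv /v -!mulrA [z' * _]Fz'; gw.
  rewrite e e'; have [w0 zv] : w != 0 /\ F z'^-1.
    by split; [exact: sgn0 sX (lX _ wl)|exact: (drV dF)].
  by rewrite -mulrA zv -!mulrA Fz -!mulrA; congr (_ * _); gw.
have [s hs] : exists s : seq D, forall y h, y \in l -> H h -> cj h y \in s.
  elim: (l) conj_finite => [|y l' IH] hc; first by exists [::].
  have [s1 h1] := hc y (mem_head _ _); have [|s2 h2] := IH.
    by move=> z zl; apply: hc; rewrite inE zl orbT.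
  exists (s1 ++ s2) => z h; rewrite inE mem_cat => /orP [/eqP ->|zl] Hh.
    by rewrite h1.
  by rewrite (h2 z h zl Hh) orbT.
pose T h := [seq cj h y | y <- l].
pose tuples := [seq [seq s`_(t i) | i <- enum 'I_(size l)] |
   t : {ffun 'I_(size l) -> 'I_(size s)}].
pose g t := xget 1 [set h | H h /\ T h = t].
exists [seq g t | t <- tuples] => h Hh; have h0 := sgn0 sH Hh.
have Tt : T h \in tuples.
  apply/mapP.
  have hi (i : 'I_(size l)) : (index (cj h l`_i) s < size s)%N.
    by rewrite index_mem hs // mem_nth.
  exists [ffun i => Ordinal (hi i)]; first by rewrite mem_enum.
  apply: (@eq_from_nth _ 0); first by rewrite /= !size_map -enumT size_enum_ord.
  move=> i; rewrite size_map => il; rewrite (nth_map 0) //.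
  rewrite (nth_map (Ordinal il)) ?size_enum_ord // ffunE /= nth_enum_ord //.
  by rewrite nth_index // hs // mem_nth.
have [Hg Tg] : H (g (T h)) /\ T (g (T h)) = T h.
  by rewrite /g; case: xgetP => [//|/(_ h) []].
have g0 := sgn0 sH Hg; exists (g (T h)), ((g (T h))^-1 * h); split.
- exact: map_f.
- apply: cX => x Xx; have [y [z [yl Fz _ ->]]] := hl x Xx.
  have y0 := sgn0 sX (lX _ yl).
  have e : cj (g (T h)) y = cj h y.
    have := congr1 (fun s => s`_(index y l)) Tg.
    by rewrite /T !(nth_map 0) ?index_mem // nth_index.
  suff e2 : (g (T h))^-1 * h * y = y * ((g (T h))^-1 * h).
    by rewrite mulrA e2 -[RHS]mulrA Fz !mulrA.
  have -> : (g (T h))^-1 * h * y = (g (T h))^-1 * (cj h y * h) by rewrite /cj; gw.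
  by rewrite -e /cj; gw.
- by rewrite muldn0 ?invdn0.
- by gw.
Qed.

(** If [a] is not central, the elements [a + t] with [t] in [F] lie in distinct classes modulo the
    center. So [F] is finite, then [D], and Wedderburn's theorem applies. *)
Lemma finite_center_abelian : finite_mod [set x | x != 0] F -> forall x y : D, x * y = y * x.
Proof.
move=> [l hl] a b; apply: contrapT => nab.
have nFa : ~ F a by move=> Fa; apply: nab; exact: Fa.
pose g y := xget 0 [set t | F t /\ exists z, [/\ F z, z != 0 & a + t = y * z]].
have Fl t : F t -> t \in map g l.
  move=> Ft; have at0 t' : F t' -> a + t' != 0.
    by move=> Ft'; rewrite addr_eq0; apply/eqP => e; apply: nFa; rewrite e; exact: (drN dF).
  have [y [z [yl Fz z0 e]]] := hl (a + t) (at0 t Ft).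
  apply/mapP; exists y => //.
  have [Fg [w [Fw w0 e']]] : F (g y) /\ exists z, [/\ F z, z != 0 & a + g y = y * z].
    by rewrite /g; case: xgetP => [//|/(_ t) []]; split=> //; exists z.
  have y0 : y != 0 by apply: contraNneq (at0 t Ft) => y0; rewrite e y0 mul0r.
  set t' := g y in Fg e' *; pose v := w^-1 * z.
  have Fv : F v by apply: (drM dF) => //; exact: (drV dF).
  have ev : a + t = (a + t') * v by rewrite e e' /v; gw.
  case: (eqVneq v 1) => [v1|v1]; first by move: ev; rewrite v1 mulr1 => /addrI.
  have v10 : 1 - v != 0 by rewrite subr_eq0 eq_sym.
  have F1v : F (1 - v) by apply: (drB dF) => //; exact: (dr1 dF).
  case: nFa; have -> : a = (t' * v - t) * (1 - v)^-1.
    apply: (mulId hD v10); rewrite -mulrA mulVd // mulr1 mulrBr mulr1.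
    by apply/eqP; rewrite subr_eq addrAC eq_sym subr_eq -mulrDl addrC -ev.
  apply: (drM dF); last exact: (drV dF).
  by apply: (drB dF) => //; exact: (drM dF).
apply: nab; apply: (@finite_divring_abelian D hD (0 :: [seq y * z | y <- l, z <- map g l]) [set: D]) => //.
move=> x _; case: (eqVneq x 0) => [->|x0]; first exact: mem_head.
have [y [z [yl Fz z0 ->]]] := hl x x0; rewrite inE; apply/orP; right.
by apply/allpairsP; exists (y, z); split=> //=; exact: Fl.
Qed.

Lemma Dgen_centr S : Dgen S = [set: D] -> centr S `<=` F.
Proof.
move=> gS x cx y; suff h : centr [set x] y by apply/esym; exact: h.
have : Dgen S y by rewrite gS.
apply: (Dgen_min (divring_centr hD _)) => z Sz _ ->; exact/esym/cx.
Qed.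

(** A noncentral subnormal subgroup generates [D], so its centralizer is [F], and
    [finite_mod_normalizer] carries finiteness up the chain to all of [D]. *)
Lemma subnormal_infinite n X : subnorm [set: D] n X -> ~ X `<=` F ->
  ~ finite_mod X F.
Proof.
move=> sX nX fX; suff h : finite_mod [set x : D | x != 0] F.
  by apply: nX => x _ y; exact: (finite_center_abelian h).
elim: sX nX fX => [|k Y H sH IH nY] ncY fY.
  by case: fY => l hl; exists l => x x0; apply: hl.
have ncH : ~ H `<=` F by move=> h; apply: ncY => x /(nsub nY); exact: h.
apply: IH => //; apply: (finite_mod_normalizer nY _ fY); apply: Dgen_centr.
apply: (Dgen_subnormal hD (divringT D) (subnorm_step sH nY)) => c.
by apply: ncY => x Yx y; exact: c.
Qed.

(** A nontrivial relation among the powers of [w], divided by its term of lowest degree, expresses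
    [w^-1] as a polynomial in [w] over [E]. *)
Lemma finite_span_divring E S l : divring E -> subring S -> E `<=` S ->
  S `<=` span E [set` l] -> divring S.
Proof.
move=> dE sS ES Sl; split=> // w Sw.
case: (eqVneq w 0) => [->|w0]; first by rewrite invr0; case: sS.
have [S0 S1 SN SD SM] := sS.
have SX k : S (w ^+ k) by elim: k => [|k IH]; rewrite ?expr0 ?exprS; [|exact: SM].
have [||c [Ec [j cj0] ec]] := @span_dependent D hD E l (size l).+1 (fun j => w ^+ j) dE.
- by [].
- by move=> j; apply: Sl.
have [|k [[kl ck] kmin]] := @ex_min (fun k => exists kl : (k < (size l).+1)%N, c (Ordinal kl) != 0).
  exists j, (ltn_ord j); move: cj0; congr (c _ != 0); exact: val_inj.
pose k0 := Ordinal kl.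
pose d := - \sum_(i < (size l).+1 | i != k0) (c k0)^-1 * c i * w ^+ (i - k).-1.
suff -> : w^-1 = d.
  apply: SN; rewrite -big_filter; apply: (big_ind S) => // i _.
  by apply: SM => //; apply: ES; apply: (drM dE) => //; exact: (drV dE).
apply: (mulId hD w0); rewrite mulVd // mulNr mulr_suml.
apply: (mulId hD (expdn0 hD k w0)); rewrite mul1r mulNr mulr_suml.
move: ec; rewrite (bigD1 k0) //= => /eqP; rewrite addr_eq0 => /eqP ec.
apply: (mulDI hD ck); rewrite ec mulrN mulr_sumr; congr (- _).
apply: eq_bigr => i ik; case: (ltnP k i) => ki.
  by rewrite -!mulrA mulVKd // -exprS -exprD; congr (_ * _ ^+ _); lia.
have -> : c i = 0; last by rewrite !(mul0r, mulr0).
apply/eqP; apply: contraT => ci.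
have ik' : (i < k)%N by rewrite ltn_neqAle ki andbT; apply: contra ik => /eqP e; apply/eqP/val_inj.
have : (k <= i)%N.
  by apply: kmin; exists (ltn_ord i); move: ci; congr (c _ != 0); exact: val_inj.
by rewrite leqNgt ik'.
Qed.

Lemma exists_basis E V l : divring E -> (forall x, x \in l -> V x) ->
  V `<=` span E [set` l] ->
  exists n (b : 'I_n -> D), [/\ forall i, V (b i),
    forall v, V v -> exists c : 'I_n -> D, (forall i, E (c i)) /\ v = \sum_i c i * b i &
    forall c : 'I_n -> D, (forall i, E (c i)) -> \sum_i c i * b i = 0 ->
      forall i, c i = 0].
Proof.
move=> dE lV hl.
pose P n := exists b : 'I_n -> D, (forall i, V (b i)) /\
  forall v, V v -> exists c : 'I_n -> D, (forall i, E (c i)) /\ v = \sum_i c i * b i.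
have [|n [[b [Vb sb]] min]] := @ex_min P.
  exists (size l), (fun i => l`_i); split=> [i|v Vv]; first by apply: lV; exact: mem_nth.
  by have [c Ec vE] := span_seqP dE (hl v Vv); exists c.
exists n, b; split=> // c Ec e i; apply/eqP; apply: contraT => ci.
case: n b Vb sb min c Ec e i ci => [|n] b Vb sb min c Ec e i ci; first by case: i ci.
suff : P n by move/min; rewrite ltnn.
exists (fun k => b (lift i k)); split=> // v /sb [d [Ed ->]].
pose q := d i * (c i)^-1; have Eq : E q by apply: (drM dE) => //; exact: (drV dE).
exists (fun k => d (lift i k) - q * c (lift i k)); split=> [k|].
  by apply: (drB dE) => //; exact: (drM dE).
transitivity (\sum_i (d i - q * c i) * b i).
  under [RHS]eq_bigr do rewrite mulrBl -mulrA.
  by rewrite sumrB -mulr_sumr e mulr0 subr0.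
by rewrite (bigD1_ord i) //= /q -mulrA mulVd // mulr1 subrr mul0r add0r.
Qed.

End FiniteModCenter.

(** * Solvable maximal subgroups *)

Section SolvableMaximal.
Variables (D : unitRingType) (hD : is_division_ring D).
Variables (G M : set D) (n : nat).
Hypotheses (snG : subnorm [set: D] n G) (maxM : maximal_subgroup M G).
Hypotheses (solM : solv M) (nabM : ~ abelian M).
Implicit Types (H N S E : set D) (l : seq D).

Local Notation F := (@center D).
Local Notation dF := (divring_center hD).
Local Notation dT := (divringT D).

Lemma sg_M : subgroup M. Proof. by case: maxM. Qed.
Lemma sg_G : subgroup G. Proof. exact: (subnorm_sg hD dT snG). Qed.
Lemma MsubG : M `<=` G. Proof. by case: maxM. Qed.

Lemma maximalP H : subgroup H -> M `<=` H -> H `<=` G -> H = M \/ H = G.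
Proof. by case: maxM => _ _ _; exact. Qed.

Lemma exists_outside : exists2 u, G u & ~ M u.
Proof.
case: maxM => _ MG nMG _; apply: contrapT => no; apply: nMG; apply/seteqP; split=> //.
by move=> g Gg; apply: contrapT => nMg; apply: no; exists g.
Qed.

Lemma commute_center X : commute_with X [set: D] -> X `<=` F.
Proof. by move=> cX x Xx y; exact: cX. Qed.

Lemma center_abelian X : X `<=` F -> abelian X.
Proof. by move=> XF x y /XF Fx _; exact: Fx. Qed.

Lemma normal_solv_central X : normal X G -> solv X -> X `<=` F.
Proof.
move=> nX sX; apply: commute_center.
exact: (solv_subnormal_central hD dT (subnorm_step snG nX) sX).
Qed.

Lemma normal_Dgen X : normal X G -> ~ X `<=` F -> Dgen X = [set: D].
Proof.
move=> nX ncX; apply: (Dgen_subnormal hD dT (subnorm_step snG nX)) => cX.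
by apply: ncX; exact: commute_center.
Qed.

Lemma G_noncentral : ~ G `<=` F.
Proof. by move=> GF; apply: nabM => x y /MsubG/GF Fx _; exact: Fx. Qed.

Definition mulset (X Y : set D) := [set z | exists x y, [/\ X x, Y y & z = x * y] ] : set D.

Lemma sg_mulset X Y : subgroup X -> subgroup Y -> Y `<=` normz X ->
  subgroup (mulset X Y).
Proof.
move=> sX sY YX; split.
- by move=> _ [x [y [/(sgn0 sX) x0 /(sgn0 sY) y0 ->]]]; exact: muldn0.
- by exists 1, 1; rewrite mulr1; split=> //; exact: sg1.
- move=> _ _ [x [y [Xx Yy ->]]] [x' [y' [Xx' Yy' ->]]].
  exists (x * cj y x'), (y * y'); split; [|exact: sgM|].
    by apply: (sgM sX) => //; exact: normz_cj (YX _ Yy) _.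
  by have y0 := sgn0 sY Yy; rewrite /cj; gw.
- move=> _ [x [y [Xx Yy ->]]]; exists (cj y^-1 x^-1), y^-1; split.
  + by apply: normz_cjV (YX _ Yy) _; exact: sgV.
  + exact: sgV.
  + by have y0 := sgn0 sY Yy; rewrite /cj; gw.
Qed.

Lemma normal_mulset X Y H : normal X H -> normal Y H -> normal (mulset X Y) H.
Proof.
move=> nX nY; have sX := nsgN nX; have sY := nsgN nY; have sH := nsgG nX.
apply: normalP => //.
- apply: sg_mulset => // y /(nsub nY); exact: normal_normz.
- by move=> _ [x [y [/(nsub nX) ? /(nsub nY) ? ->]]]; exact: sgM.
move=> g _ Hg [x [y [Xx Yy ->]]]; exists (cj g x), (cj g y).
by split; [exact: normal_cj nX _ _|exact: normal_cj nY _ _|rewrite cjM // (sgn0 sH)].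
Qed.

Lemma mulset_l X Y : subgroup Y -> X `<=` mulset X Y.
Proof. by move=> sY x Xx; exists x, 1; rewrite mulr1; split=> //; exact: sg1. Qed.

Lemma mulset_r X Y : subgroup X -> Y `<=` mulset X Y.
Proof. by move=> sX y Yy; exists 1, y; rewrite mul1r; split=> //; exact: sg1. Qed.

(** By maximality the product of [X] and [M] is [M] or [G]; in the first case [X] is solvable, hence
    central. *)
Lemma normal_supplement X : normal X G -> ~ X `<=` F -> G `<=` mulset X M.
Proof.
move=> nX ncX; have sX := nsgN nX.
have sXM : subgroup (mulset X M).
  apply: sg_mulset => //; first exact: sg_M.
  by move=> m /MsubG; exact: normal_normz.
have XMG : mulset X M `<=` G.
  by move=> _ [x [m [/(nsub nX) Gx /MsubG Gm ->]]]; exact: sgM sg_G _ _.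
case: (maximalP sXM (mulset_r sX) XMG) => [e|-> //].
case: ncX; apply: (normal_solv_central nX).
apply: (solvS hD sX sg_M _ solM) => x Xx; rewrite -e; apply: mulset_l => //; exact: sg_M.
Qed.

Lemma normal_M_G : ~ normal M G.
Proof.
by move=> nM; apply: nabM; apply: center_abelian; exact: (normal_solv_central nM).
Qed.

(** Otherwise [G] is the product of [M] and central elements, so that [M] is normal in [G], hence
    central. *)
Lemma center_sub_M : G `&` F `<=` M.
Proof.
have sGF : subgroup (G `&` star F) by apply: sgI; [exact: sg_G|exact: (sg_star hD dF)].
have sH : subgroup (mulset (G `&` star F) M).
  apply: sg_mulset => //; first exact: sg_M.
  move=> m Mm; have m0 := sgn0 sg_M Mm; split=> // e [Ge Fe].
    by rewrite (cj_central hD) //; case: Fe.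
  by rewrite (cj_central hD) ?invdn0 //; case: Fe.
have HG : mulset (G `&` star F) M `<=` G.
  by move=> _ [x [m [[Gx _] /MsubG Gm ->]]]; exact: sgM sg_G _ _.
case: (maximalP sH (mulset_r sGF) HG) => e x [Gx Fx].
  by rewrite -e; apply: (mulset_l sg_M); split=> //; split=> //; exact: sgn0 sg_G _.
case: normal_M_G; apply: normalP; [exact: sg_M|exact: sg_G|exact: MsubG|].
move=> g m; rewrite -{1}e => -[z [m' [[_ [Fz z0]] Mm' ->]]] Mm.
rewrite (cjJ hD) (cj_id hD z0 (Fz _)); exact: sgcj sg_M _ _.
Qed.

Definition DgenF S := Dgen (S `|` F).

Lemma divring_DgenF S : divring (DgenF S). Proof. exact: divring_Dgen. Qed.
Lemma DgenF_sub S : S `<=` DgenF S.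
Proof. by move=> x Sx; apply: Dgen_sub; left. Qed.
Lemma DgenF_center S : F `<=` DgenF S.
Proof. by move=> x Sx; apply: Dgen_sub; right. Qed.
Lemma DgenF_min S E : divring E -> S `<=` E -> F `<=` E -> DgenF S `<=` E.
Proof. by move=> dE SE FE; apply: Dgen_min => // x [/SE|/FE]. Qed.

Lemma normz_DgenF S g : normz S g -> normz (DgenF S) g.
Proof.
move=> ng; apply: (normz_Dgen hD); apply: normzU => //.
by apply: (normz_center hD); exact: normz_n0 ng.
Qed.

Lemma abelian_DgenF S : abelian S -> abelian (DgenF S).
Proof.
move=> aS; apply: (abelian_Dgen hD) => x y [Sx|Fx] [Sy|Fy]; try exact: Fx.
  exact: aS.
exact/esym/Fy.
Qed.

Lemma DgenF_centr S : DgenF S = [set: D] -> centr S `<=` F.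
Proof.
move=> gS x cx; apply: (Dgen_centr hD gS) => y [Sy|Fy]; first exact: cx.
exact/esym/Fy.
Qed.

(** By maximality the normalizer of [E] in [G] is [M] or [G]. In the first case [star E & G] lies in
    [M]; in the second it is normal in [G], so central or generating. *)
Lemma normalizer_dichotomy E : divring E -> M `<=` normz E ->
  [\/ star E `&` G `<=` F, E = [set: D] | star E `&` G `<=` M].
Proof.
move=> dE ME; pose H := G `&` normz E.
have sH : subgroup H by apply: sgI; [exact: sg_G|exact: sg_normz].
have MH : M `<=` H by move=> m Mm; split; [exact: MsubG|exact: ME].
case: (maximalP sH MH (fun x Hx => proj1 Hx)) => HE.
  apply: Or33 => x [Ex Gx]; rewrite -HE; split=> //; exact: normz_star.
have GE : G `<=` normz E by rewrite -HE => x [].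
case: (pselect (star E `&` G `<=` F)) => [|nc]; first by move=> ?; exact: Or31.
apply: Or32; apply/seteqP; split=> //.
have sX : subgroup (star E `&` G) by apply: sgI; [exact: (sg_star hD dE)|exact: sg_G].
have nX : normal (star E `&` G) G.
  apply: (normalP sX sg_G) => [x []//|g x Gg [Ex Gx]]; split; last exact: sgcj sg_G _ _.
  exact: normz_cj (normz_star_sub hD dE (GE _ Gg)) Ex.
by rewrite -(normal_Dgen nX nc); apply: Dgen_min => // x [[]].
Qed.

(** The group [G & E] is subnormal in [E] and solvable, hence central in [E]. *)
Lemma star_abelian E : divring E -> star E `&` G `<=` M ->
  forall x y, G x -> E x -> E y -> x * y = y * x.
Proof.
move=> dE EM; have sE := subnorm_I hD dT dE (@subsetT _ E) snG.
have sGE := subnorm_sg hD dE sE.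
have sol : solv (G `&` E).
  apply: (solvS hD sGE sg_M _ solM) => x Ex; apply: EM; split; last by case: Ex.
  by split; [case: Ex|exact: sgn0 Ex].
move=> x y Gx Ex Ey; exact: (solv_subnormal_central hD dE sE sol).
Qed.

Lemma dichotomy N : normal N M -> abelian N \/ DgenF N = [set: D].
Proof.
move=> nN; have sN := nsgN nN; pose E := DgenF N.
have dE := divring_DgenF N; have NM := nsub nN.
have NE : N `<=` star E `&` G.
  move=> x Nx; split; last by apply: MsubG; exact: NM.
  by split; [exact: DgenF_sub|exact: sgn0 Nx].
have ME : M `<=` normz E.
  by move=> m Mm; apply: normz_DgenF; exact: normal_normz nN _ Mm.
case: (normalizer_dichotomy dE ME) => [h|h|h]; [left|by right|left].
  by apply: center_abelian => x /NE /h.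
move=> x y /NE [[Ex _] Gx] /NE [[Ey _] _].
exact: (star_abelian dE h).
Qed.

Lemma sg_center : subgroup (M `&` F).
Proof.
have -> : M `&` F = M `&` star F; last by apply: sgI; [exact: sg_M|exact: (sg_star hD dF)].
apply/seteqP; split=> x [Mx]; last by case.
by move=> Fx; do !split=> //; exact: sgn0 sg_M _.
Qed.

Lemma normal_center_M : normal (M `&` F) M.
Proof.
apply: (normalP sg_center sg_M) => [x []//|g x Mg [Mx Fx]].
by rewrite (cj_central hD) //; exact: sgn0 sg_M _.
Qed.

(* If [M / (M & F)] is finite, then [G] is finitely generated modulo [F], hence
   residually finite modulo [F] when [D] is finite-dimensional. But a noncentral
   normal subgroup of [G] has index at most [|M / (M & F)|], as it supplements
   the maximal subgroup [M]. *)
Section FiniteStabilizer.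
Variable l : seq D.
Hypothesis Fl : [set: D] `<=` span F [set` l].
Hypothesis fM : finite_mod M F.

Lemma finite_stabilizer_absurd : False.
Proof.
have aF : abelian F by exact: center_abelian.
have [K [f fF]] := divring_field dF hD aF.
have fc x : F (f x) by apply/fF; exists x.
have [d [b [_ sb free]]] := exists_basis hD dF (fun _ _ => I) Fl.
have sbK v : exists c : 'I_d -> K, v = \sum_i f (c i) * b i.
  have [c [Fc ->]] := sb v I.
  have /choice [c' hc'] : forall i, exists z, f z = c i by move=> i; apply/fF.
  by exists c'; apply: eq_bigr => i _; rewrite hc'.
have freeK (c c' : 'I_d -> K) : \sum_i f (c i) * b i = \sum_i f (c' i) * b i ->
    forall i, c i = c' i.
  move=> e i; apply: (fmorph_inj f); apply/eqP; rewrite -subr_eq0; apply/eqP.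
  apply: (free (fun i => f (c i) - f (c' i))) => [j|]; first exact: (drB dF).
  by under eq_bigr do rewrite mulrBl; rewrite sumrB e subrr.
have /choice [cf hcf] : forall v, exists c : 'I_d -> K, v = \sum_i f (c i) * b i.
  exact: sbK.
have [lM0 hlM0] := fM.
have [lM [lMM hlM]] := finite_mod_sub hD hlM0 (fun x => sgn0 sg_M (x := x)).
have [u Gu nMu] := exists_outside.
(* By maximality [u] and [M] generate [G], so modulo [F] the group [G] is generated by [u] and
   finitely many representatives of [M]. *)
pose gs := u :: lM.
have gsG x : x \in gs -> G x.
  by rewrite inE => /orP [/eqP ->//|/lMM]; exact: MsubG.
have gs0 : [set` gs] `<=` @Dstar D by move=> x /gsG; exact: sgn0 sg_G.
pose Gam := gen [set` gs]; have sGam : subgroup Gam := sg_gen hD gs0.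
have GamG : Gam `<=` G by apply: gen_min; [exact: sg_G|exact: gsG].
have GGam g : G g -> exists y z, [/\ Gam y, F z, z != 0 & g = y * z].
  move=> Gg; have sGF : subgroup (star F) by exact: (sg_star hD dF).
  pose H := mulset Gam (star F) `&` G.
  have sH : subgroup H.
    apply: sgI; last exact: sg_G.
    apply: sg_mulset => // z [Fz z0]; have zV : F z^-1 by exact: (drV dF).
    split=> // e Ge; rewrite (cj_id hD) //; exact: invdn0.
  have MH : M `<=` H.
    move=> m Mm; split; last exact: MsubG.
    have [y [z [yl Fz z0 ->]]] := hlM _ Mm; exists y, z; split=> //.
    by apply: sgen_sub; rewrite /= inE yl orbT.
  case: (maximalP sH MH (fun x Hx => proj2 Hx)) => HE.
    case: nMu; rewrite -HE; split=> //; exists u, 1; rewrite mulr1; split=> //.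
      by apply: sgen_sub; rewrite /= mem_head.
    exact: (sg1 sGF).
  by move: Gg; rewrite -HE => -[[y [z [Gy [Fz z0] ->]]] _]; exists y, z.
pose coefs (g : D) : seq K := [seq cf (b i * g) j | i <- enum 'I_d, j <- enum 'I_d].
pose gs' := gs ++ map (fun x => x^-1) gs.
have [A [ev [rf hs]]] := residually_finite_cover (flatten (map coefs gs')).
(* [X] lifts to [A] the matrix of right multiplication by [g]; only its image under [ev] is
   determined by [g]. *)
pose rep g (X : 'M[A]_d) := forall i, b i * g = \sum_j f (ev (X i j)) * b j.
have rep_gs g : g \in gs' -> exists X, rep g X.
  move=> ggs; have /choice [X hX] : forall ij : 'I_d * 'I_d, exists c, ev c = cf (b ij.1 * g) ij.2.
    move=> [i j]; apply: hs; apply/flattenP; exists (coefs g); first exact: map_f.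
    by apply/allpairsP; exists (i, j); rewrite !mem_enum.
  exists (\matrix_(i, j) X (i, j)) => i; rewrite {1}[b i * g]hcf.
  by apply: eq_bigr => j _; rewrite mxE hX.
have rep_uniq g X X' : rep g X -> rep g X' -> forall i j, ev (X i j) = ev (X' i j).
  by move=> rX rX' i; apply: freeK; rewrite -rX -rX'.
have rep1 : rep 1 1%:M.
  move=> i; rewrite mulr1 (bigD1 i) //= mxE eqxx rmorph1 rmorph1 mul1r big1 ?addr0 //.
  by move=> j ji; rewrite mxE eq_sym (negPf ji) !rmorph0 mul0r.
have repM g g' X X' : rep g X -> rep g' X' -> rep (g * g') (X *m X').
  move=> rX rX' i; rewrite mulrA rX mulr_suml.
  under eq_bigr do rewrite -mulrA rX' mulr_sumr.
  rewrite exchange_big /=; apply: eq_bigr => j _.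
  rewrite mxE !rmorph_sum mulr_suml; apply: eq_bigr => k _.
  by rewrite !rmorphM mulrA.
have repGam g : Gam g -> exists X, rep g X.
  pose H : set D := [set g | g != 0 /\ exists X Y, rep g X /\ rep g^-1 Y].
  suff h : Gam `<=` H by move=> /h [_ [X [Y []]]]; exists X.
  apply: gen_min => [|x xgs].
    split.
    - by move=> x [].
    - by split; [exact: oner_neq0|exists 1%:M, 1%:M; rewrite invr1].
    - move=> x y [x0 [X [X' [rX rX']]]] [y0 [Y [Y' [rY rY']]]].
      split; first exact: muldn0.
      by exists (X *m Y), (Y' *m X'); rewrite (invMd hD); split; exact: repM.
    - move=> x [x0 [X [X' [rX rX']]]]; split; first exact: invdn0.
      by exists X', X; rewrite invrK.
  split; first exact: gs0.
  have [|X rX] := @rep_gs x; first by rewrite mem_cat xgs.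
  have [|Y rY] := @rep_gs x^-1; last by exists X, Y.
  by rewrite mem_cat; apply/orP; right; apply: map_f.
have d0 : (0 < d)%N.
  case: (posnP d) => // d0; case/negP: (oner_neq0 D); rewrite (hcf 1) big1 //.
  by case=> i il; exfalso; rewrite d0 in il.
pose k0 : 'I_d := Ordinal d0.
have wit g X : rep g X -> ~ F g -> exists r : A, ev r != 0 /\
    ((exists i j, i != j /\ r = X i j) \/ exists i, r = X i i - X k0 k0).
  move=> rX nF; apply: contrapT => no; apply: nF.
  have offd i j : i != j -> ev (X i j) = 0.
    move=> ij; apply/eqP; apply: contraT => e.
    by case: no; exists (X i j); split=> //; left; exists i, j.
  have diag i : ev (X i i) = ev (X k0 k0).
    apply/eqP; rewrite -subr_eq0 -rmorphB; apply: contraT => e.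
    by case: no; exists (X i i - X k0 k0); split=> //; right; exists i.
  have -> : g = f (ev (X k0 k0)); last exact: fc.
  rewrite -[LHS]mul1r -[RHS]mulr1 (hcf 1) mulr_suml mulr_sumr; apply: eq_bigr => i _.
  rewrite -mulrA rX (bigD1 i) //= diag big1 ?addr0 => [|j ji].
    by rewrite !mulrA; congr (_ * _); exact: fc.
  by rewrite offd ?rmorph0 ?mul0r // eq_sym.
have [h hG hinj] : exists2 h : nat -> D, (forall i, Gam (h i)) &
    forall i j, (i < j)%N -> ~ F ((h i)^-1 * h j).
  have next (s : seq D) : exists y, Gam y /\ forall x, x \in s -> x != 0 -> ~ F (x^-1 * y).
    apply: contrapT => no; apply: (subnormal_infinite hD snG G_noncentral).
    exists s => g /GGam [y [z [Gy Fz z0 ->]]].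
    apply: contrapT => no'; apply: no; exists y; split=> // x xs x0 Fxy; apply: no'.
    have y0 := sgn0 sGam Gy.
    exists x, (x^-1 * y * z); split=> //; first exact: (drM dF).
      by rewrite !muldn0 ?invdn0.
    by gw.
  have /choice [nx hnx] := next.
  pose hs' := fix hs' n := if n is n'.+1 then nx (hs' n') :: hs' n' else [::].
  exists (fun i => nx (hs' i)) => [i|i j ij]; first exact: (hnx _).1.
  apply: (hnx (hs' j)).2; last exact: sgn0 sGam (hnx _).1.
  elim: j ij => // j IH; rewrite ltnS leq_eqVlt /= inE => /orP [/eqP ->|/IH ->].
    by rewrite eqxx.
  by rewrite orbT.
pose N := size lM.
have /choice [r hr] : forall ij : nat * nat, exists r : A, ev r != 0 /\
    ((ij.1 < ij.2)%N -> forall X, rep ((h ij.1)^-1 * h ij.2) X ->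
     exists r', ev r' = ev r /\
     ((exists i j, i != j /\ r' = X i j) \/ exists i, r' = X i i - X k0 k0)).
  move=> [i j] /=; case: (ltnP i j) => ij; last first.
    by exists 1; rewrite rmorph1 oner_neq0.
  have [X rX] := repGam _ (sgM sGam (sgV sGam (hG i)) (hG j)).
  have [r [r0 hr]] := wit _ _ rX (hinj _ _ ij); exists r; split=> // _ Y rY.
  have eXY := rep_uniq _ _ _ rX rY.
  case: hr => [[a [c [ac ->]]]|[a ->]].
    by exists (Y a c); split; [rewrite eXY|left; exists a, c].
  exists (Y a a - Y k0 k0); split; first by rewrite !rmorphB /= !eXY.
  by right; exists a.
(* The product of the witnesses of all pairs is nonzero, so one reduction keeps every witness
   nonzero, and [h 0], ..., [h N] stay distinct modulo scalars. *)
have [|k [psi [psi0 psir]]] := rf (\prod_(i < N.+1) \prod_(j < N.+1) r (nat_of_ord i, nat_of_ord j)).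
  rewrite rmorph_prod; apply/prodf_neq0 => i _; rewrite rmorph_prod.
  by apply/prodf_neq0 => j _; have [] := hr (nat_of_ord i, nat_of_ord j).
have psie x y : ev x = ev y -> psi x = psi y.
  by move=> e; apply/eqP; rewrite -subr_eq0 -rmorphB psi0 // rmorphB e subrr.
have psir1 i j : (i < N.+1)%N -> (j < N.+1)%N -> psi (r (i, j)) != 0.
  move=> iN jN; move: psir; rewrite rmorph_prod => /prodf_neq0/(_ (Ordinal iN) isT).
  by rewrite rmorph_prod => /prodf_neq0/(_ (Ordinal jN) isT).
have psi_rep g X Y : rep g X -> rep g Y -> map_mx psi X = map_mx psi Y.
  move=> rX rY; apply/matrixP => i j; rewrite !mxE; apply: psie; exact: rep_uniq rX rY _ _.
pose ker : set D := [set g | Gam g /\ exists X, rep g X /\ map_mx psi X = 1%:M].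
have sker : subgroup ker.
  split.
  - by move=> x [/(sgn0 sGam)].
  - by split; [exact: sg1 sGam|exists 1%:M; rewrite map_mx1].
  - move=> x y [Gx [X [rX eX]]] [Gy [Y [rY eY]]]; split; first exact: (sgM sGam).
    by exists (X *m Y); split; [exact: repM|rewrite map_mxM eX eY mulmx1].
  - move=> x [Gx [X [rX eX]]]; have x0 := sgn0 sGam Gx.
    split; first exact: (sgV sGam); have [Y rY] := repGam _ (sgV sGam Gx).
    exists Y; split=> //; have rXY := repM _ _ _ _ rX rY.
    rewrite muldV // in rXY; have := psi_rep _ _ _ rXY rep1.
    by rewrite map_mxM eX mul1mx map_mx1.
pose R := mulset ker (star F) `&` G.
have normF_any (S : set D) : star F `<=` normz S.
  move=> z [Fz z0]; have zV : F z^-1 by exact: (drV dF).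
  split=> // e Se; rewrite (cj_id hD) //; exact: invdn0.
have sR : subgroup R.
  apply: sgI; last exact: sg_G.
  by apply: sg_mulset => //; exact: (sg_star hD dF).
have kerR : ker `<=` R.
  by move=> x Kx; split; [apply: mulset_l => //; exact: (sg_star hD dF)|case: Kx => /GamG].
have nR : normal R G.
  apply: (normalP sR sg_G) => [x []//|g v Gg [vR Gv]]; split; last exact: sgcj sg_G _ _.
  have [x [z [Kx [Fz z0] vE]]] := vR.
  have [y [w [Gy Fw w0 gE]]] := GGam _ Gg; have y0 := sgn0 sGam Gy.
  exists (cj y x), z; split=> //; last first.
    by rewrite vE gE (cjJ hD) (cj_id hD w0 (Fw _)) cjM // (cj_central hD y0 Fz).
  case: Kx => Gx [X [rX eX]]; split; first exact: (sgcj sGam).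
  have [Y rY] := repGam _ Gy; have [Y' rY'] := repGam _ (sgV sGam Gy).
  exists (Y *m X *m Y'); split; first by apply: (repM _ _ _ _ _ rY') => //; exact: (repM _ _ _ _ rY rX).
  rewrite !map_mxM eX mulmx1 -map_mxM -(map_mx1 psi).
  by apply: psi_rep rep1; have := repM _ _ _ _ rY rY'; rewrite muldV.
(* There are finitely many matrices over [k], so the congruence subgroup has finite index modulo
   [F], and a central [R] would make [G] finite modulo [F]. *)
have ncR : ~ R `<=` F.
  move=> RF; apply: (subnormal_infinite hD snG G_noncentral).
  pose T g (Z : 'M[k]_d) := Gam g /\ exists X, rep g X /\ map_mx psi X = Z.
  pose gZ Z := xget 1 [set g | T g Z].
  exists [seq gZ Z | Z : 'M[k]_d] => g /GGam [y [z [Gy Fz z0 ->]]].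
  have [X rX] := repGam _ Gy; pose Z := map_mx psi X.
  have [Gg [X' [rX' eX']]] : T (gZ Z) Z.
    rewrite /gZ; case: xgetP => [//|/(_ y) []]; split=> //; by exists X.
  have [Y rY] := repGam _ (sgV sGam Gg); have g0 := sgn0 sGam Gg; have y0 := sgn0 sGam Gy.
  have Fgy : F ((gZ Z)^-1 * y).
    apply: RF; apply: kerR; split; first by apply: (sgM sGam) => //; exact: (sgV sGam).
    exists (Y *m X); split; first exact: repM.
    rewrite map_mxM -/Z -eX' -map_mxM -(map_mx1 psi); apply: psi_rep rep1.
    by have := repM _ _ _ _ rY rX'; rewrite mulVd.
  exists (gZ Z), ((gZ Z)^-1 * y * z); split.
  - by apply/mapP; exists Z => //; rewrite mem_enum.
  - exact: (drM dF).
  - by rewrite !muldn0 ?invdn0.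
  - by gw.
have RF z : G z -> F z -> R z.
  move=> Gz Fz; split=> //; exists 1, z; rewrite mul1r; split=> //.
    exact: (sg1 sker).
  by split=> //; exact: sgn0 sg_G _.
have supp := normal_supplement nR ncR.
have dec i : exists y, y \in lM /\ exists r z, [/\ R r, F z, z != 0 & h i = r * y * z].
  have [r' [m [Rr Mm e]]] := supp _ (GamG _ (hG i)).
  have [y [z [yl Fz z0 mE]]] := hlM _ Mm.
  by exists y; split=> //; exists r', z; rewrite e mE mulrA.
have /choice [y hy] := dec.
(* Since [R] supplements [M], two of [h 0], ..., [h N] share a representative of [M] modulo [F], and
   their quotient lies in [R]: its reduction is scalar, against the choice of the witnesses. *)
have [|i [j [ij jN eij]]] := @pigeonhole D lM y; first by move=> i; case: (hy i).
have [yl [r1 [z1 [Rr1 Fz1 z10 e1]]]] := hy i.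
have [_ [r2 [z2 [Rr2 Fz2 z20 e2]]]] := hy j.
have Gy : G (y i) by apply: MsubG; exact: lMM.
have y0 := sgn0 sg_G Gy.
have r10 := sgn0 sR Rr1; have r20 := sgn0 sR Rr2.
pose gam := (h i)^-1 * h j.
have Ggam : Gam gam by apply: (sgM sGam) => //; exact: (sgV sGam).
have Rgam : R gam.
  have gE : gam = cj (y i)^-1 (r1^-1 * r2) * (z1^-1 * z2).
    rewrite /gam e1 e2 -eij /cj; gw.
    have zV : F z1^-1 by exact: (drV dF).
    by rewrite zV -!mulrA Fz2.
  have R' : R (cj (y i)^-1 (r1^-1 * r2)).
    by apply: (normal_cj nR); [exact: sgV sg_G _|apply: (sgM sR) => //; exact: sgV].
  rewrite gE; apply: (sgM sR) => //; apply: RF; last first.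
    by apply: (drM dF) => //; exact: (drV dF).
  apply: (sg_mulr hD sg_G (nsub nR R') (sgn0 sR R')); rewrite -gE; exact: GamG.
have [X rX] := repGam _ Ggam.
have [[x [z [[Gx [X0 [rX0 eX0]]] [Fz z0] gE]]] _] := Rgam.
have x0 := sgn0 sGam Gx.
have Gz : Gam z by apply: (sg_mulr hD sGam Gx x0); rewrite -gE.
have [Z rZ] := repGam _ Gz.
have XZ : map_mx psi X = map_mx psi Z.
  rewrite (psi_rep _ _ (X0 *m Z) rX) ?map_mxM ?eX0 ?mul1mx // gE; exact: repM.
have [c [fc' hz]] : exists c : K, f c = z /\ True by have [c] := (fF z).1 Fz; exists c.
have Zij a a' : f (ev (Z a a')) = if a == a' then z else 0.
  rewrite -fc'; have := freeK (fun j => ev (Z a j)) (fun j => if a == j then c else 0).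
  move=> -> //; first by case: eqP => // _; rewrite rmorph0.
  rewrite -rZ -Fz -fc' (bigD1 a) //= eqxx big1 ?addr0 // => a'' /negPf.
  by rewrite eq_sym => ->; rewrite rmorph0 mul0r.
have Xab a a' : psi (X a a') = psi (Z a a').
  by move/matrixP: XZ => /(_ a a'); rewrite !mxE.
have [_ /(_ ij X rX) [r' [er' hr']]] := hr (i, j).
have := psir1 i j (ltn_trans ij _) _; rewrite -(psie _ _ er') => /(_ _ _)/negP; apply; rewrite ?ltnS //.
case: hr' => [[a [a' [aa' ->]]]|[a ->]].
  rewrite Xab psi0 //; apply: (fmorph_inj f).
  by rewrite rmorph0 Zij (negPf aa').
rewrite rmorphB /= !Xab -rmorphB psi0 //; apply: (fmorph_inj f).
by rewrite !rmorphB /= !Zij !eqxx subrr rmorph0.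
Qed.

End FiniteStabilizer.
End SolvableMaximal.

(** * Groups of class two modulo the center *)

Section EquivModCenter.
Variables (D : unitRingType) (hD : is_division_ring D).
Implicit Types (x y z w g : D) (X : set D).

Local Notation F := (@center D).
Local Notation dF := (divring_center hD).

Definition eqF x y := exists z, [/\ F z, z != 0 & x = y * z].

Lemma eqF_refl x : eqF x x.
Proof. by exists 1; rewrite mulr1 oner_neq0; split=> //; exact: (dr1 dF). Qed.

Lemma eqF_sym x y : eqF x y -> eqF y x.
Proof.
move=> [z [Fz z0 ->]]; exists z^-1; split; [exact: (drV dF)|exact: invdn0|].
by gw.
Qed.

Lemma eqF_trans y x z : eqF x y -> eqF y z -> eqF x z.
Proof.
move=> [a [Fa a0 ->]] [b [Fb b0 ->]]; exists (b * a).
by rewrite mulrA; split=> //; [exact: (drM dF)|exact: muldn0].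
Qed.

Lemma eqFM x x' y y' : eqF x x' -> eqF y y' -> eqF (x * y) (x' * y').
Proof.
move=> [a [Fa a0 ->]] [b [Fb b0 ->]]; exists (a * b); split.
- exact: (drM dF).
- exact: muldn0.
- by rewrite -!mulrA; congr (_ * _); rewrite mulrA (Fa y') -mulrA.
Qed.

Lemma eqFV x y : eqF x y -> eqF x^-1 y^-1.
Proof.
move=> [a [Fa a0 ->]]; have Fa' : F a^-1 by exact: (drV dF).
by exists a^-1; split=> //; [exact: invdn0|rewrite (invMd hD) Fa'].
Qed.

Lemma eqFcj g x y : g != 0 -> eqF x y -> eqF (cj g x) (cj g y).
Proof.
move=> g0 [a [Fa a0 ->]]; exists a; split=> //.
by rewrite (cjM hD) // (cj_central hD g0 Fa).
Qed.

Lemma eqF_mul x z : F z -> z != 0 -> eqF (x * z) x.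
Proof. by move=> Fz z0; exists z. Qed.

Lemma eqF_divP x y : y != 0 -> x != 0 -> F (y^-1 * x) -> eqF x y.
Proof.
move=> y0 x0 h; exists (y^-1 * x); split=> //; first by rewrite muldn0 ?invdn0.
by gw.
Qed.

Lemma cmm_eqF x x' y y' : x' != 0 -> y' != 0 -> eqF x x' -> eqF y y' ->
  cmm x y = cmm x' y'.
Proof.
move=> x0 y0 [a [Fa a0 ->]] [b [Fb b0 ->]].
rewrite !cmm_cj cjJ // (cj_id hD a0 (Fa _)) cjM // (cj_central hD x0 Fb).
by gw.
Qed.

Definition fixes b x := eqF (cj b x) x.

Lemma fixesM b x y : b != 0 -> fixes b x -> fixes b y -> fixes b (x * y).
Proof. by move=> b0 fx fy; rewrite /fixes cjM //; exact: eqFM. Qed.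

Lemma fixesV b x : fixes b x -> fixes b x^-1.
Proof. by move=> fx; rewrite /fixes (cjV hD); exact: (eqFV fx). Qed.

Lemma fixes_mul b c x : b != 0 -> fixes b x -> fixes c x -> fixes (b * c) x.
Proof.
move=> b0 fb fc; rewrite /fixes cjJ //; apply: (eqF_trans (y := cj b x)) => //.
exact: eqFcj.
Qed.

Lemma fixes_eqF b x y : b != 0 -> eqF x y -> fixes b x -> fixes b y.
Proof.
move=> b0 xy fx; apply: (eqF_trans (y := cj b x)); first exact/eqFcj/eqF_sym.
by apply: eqF_trans xy.
Qed.

Lemma fixes_cj m b x : m != 0 -> fixes (cj m b) x <-> fixes b (cj m^-1 x).
Proof.
move=> m0; have mV : m^-1 != 0 by exact: invdn0.
have e : cj (cj m b) x = cj m (cj b (cj m^-1 x)) by rewrite -!cjJ // mulrA.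
split=> h; rewrite /fixes.
  by rewrite -[cj b _](cjK hD _ m0) -e; exact: eqFcj.
by rewrite e -{2}(cjKV hD x m0); exact: eqFcj.
Qed.

Lemma fixes_center b x : b != 0 -> F x -> fixes b x.
Proof. by move=> b0 Fx; rewrite /fixes (cj_central hD b0 Fx); exact: eqF_refl. Qed.

Lemma fixes_cmm b x : x != 0 -> b != 0 -> fixes b x <-> F (cmm b x).
Proof.
move=> x0 b0; split=> [[z [Fz z0 e]]|Fc].
  by rewrite cmm_cj e -Fz; gw.
exists (cmm b x); split=> //; first by rewrite /cmm !muldn0 ?invdn0.
by rewrite -Fc /cmm /cj; gw.
Qed.

End EquivModCenter.

Section Class2Groups.
Variables (D : unitRingType) (hD : is_division_ring D).
Variables (G M : set D) (n : nat).
Hypotheses (snG : subnorm [set: D] n G) (maxM : maximal_subgroup M G).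
Hypotheses (solM : solv M) (nabM : ~ abelian M).
Implicit Types (H N S E : set D) (l : seq D).

Local Notation F := (@center D).
Local Notation dF := (divring_center hD).
Local Notation dT := (divringT D).
Let sM : subgroup M := sg_M maxM.
Let Mn0 m : M m -> m != 0. Proof. exact: sgn0. Qed.

(** Commutators induce an alternating pairing on [N] modulo [F], nondegenerate by [class2_centr];
    [M & F] is included so that [N] is exactly the kernel of the action of [M] on [N] modulo [F]
    ([class2_trivial]). *)
Definition class2 N := [/\ normal N M, ~ abelian N,
  forall x y, N x -> N y -> F (cmm x y) & M `&` F `<=` N].

Section Class2.
Variable N : set D.
Hypothesis c2 : class2 N.

Let nN : normal N M. Proof. by case: c2. Qed.
Let sN : subgroup N. Proof. exact: nsgN nN. Qed.
Let Nn0 x : N x -> x != 0. Proof. exact: sgn0. Qed.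
Let Ncmm x y : N x -> N y -> F (cmm x y). Proof. by case: c2 => _ _ h _; exact: h. Qed.
Let NE : N `<=` normz F. Proof. by move=> x /Nn0; exact: normz_center. Qed.

Lemma class2_DgenF : DgenF N = [set: D].
Proof. by case: (dichotomy hD snG maxM solM nN) => //; case: c2. Qed.

Lemma class2_centr : centr N `<=` F.
Proof. exact: (DgenF_centr hD class2_DgenF). Qed.

(** [m] is a fraction with a denominator centralizing [N], that is, a central one. *)
Lemma class2_span m : M m -> span F N m.
Proof.
move=> Mm; have Fm : Frac F N m.
  have h : Dgen (F `|` N) m by rewrite setUC -/(DgenF N) class2_DgenF.
  exact: (Dgen_Frac hD dF sN NE Ncmm h).
have NR : N `<=` span F N by move=> x; exact: (span_mem dF).
have [f [Rf f0 Rfm /class2_centr Ff]] :=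
  exists_centralizing_denominator hD dF sN NE sN NR NE Ncmm (Mn0 Mm) Fm (normal_normz nN Mm).
by rewrite -[m](mulKd hD m f0); apply: (spanZ dF) => //; exact: (drV dF).
Qed.

Lemma class2_fixes x y : N x -> N y -> fixes x y.
Proof. by move=> Nx Ny; apply/(fixes_cmm hD); [exact: Nn0|exact: Nn0|exact: Ncmm]. Qed.

(** By minimal supports [m] is a monomial times an element centralizing [N]; the latter is central,
    so [m] lies in [N] up to a central factor, which belongs to [M]. *)
Lemma class2_trivial m : M m -> (forall k, N k -> fixes m k) -> N m.
Proof.
move=> Mm fm; have NR : N `<=` span F N by move=> x; exact: (span_mem dF).
have [|e [t [h [[Fe e0] Nt _ mE /class2_centr Fh]]]] :=
  monomial_times_centralizing hD dF sN NE sN NE Ncmm (class2_span Mm) (Mn0 Mm).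
  by move=> q Nq; apply/(fixes_cmm hD); [exact: Nn0|exact: Mn0|exact: fm].
have t0 := Nn0 Nt; rewrite mE -mulrA -Fh mulrA; apply: (sgM sN) => //.
case: c2 => _ _ _; apply; split; last exact: (drM dF).
have -> : e * h = m * t^-1 by rewrite mE -(mulrA e) -(Fh t); gw.
by apply: (sgM sM) => //; apply: (nsub nN); exact: sgV.
Qed.

(* Elements of [N] in distinct classes modulo [F] are [F]-independent, as they
   have distinct characters [cmm k t]. *)
Lemma class2_independent T t : T `<=` N -> N t -> span F T t ->
  exists2 t', T t' & eqF t t'.
Proof.
move=> TN Nt; have t0 := Nn0 Nt.
case/(span_free_rep hD dF) => [[|k] [e [s [he hs tE free]]]].
  by move: t0; rewrite tE big_ord0 eqxx.
exists (s ord0) => //; have Ns i : N (s i) by apply: TN.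
have s0 i : s i != 0 by exact: Nn0.
apply: (eqF_divP hD) => //; apply: class2_centr => k' Nk; have k0 := Nn0 Nk.
pose c i := (cmm k' (s i) - cmm k' t) * e i.
have cF i : F (c i).
  by apply: (drM dF); [apply: (drB dF); exact: Ncmm|case: (he i)].
have cjE u : u != 0 -> cmm k' u * u = cj k' u by move=> u0; rewrite /cmm /cj; gw.
have cE i : c i * s i = cj k' (e i * s i) - cmm k' t * (e i * s i).
  have [Fe e0] := he i; rewrite cjM // (cj_central hD k0 Fe) -cjE //.
  by rewrite /c !mulrBl -Fe -!mulrA.
have c0 : \sum_i c i * s i = 0.
  under eq_bigr do rewrite cE.
  rewrite sumrB -mulr_sumr -tE cjE // [X in _ - cj k' X]tE.
  by rewrite /cj mulr_sumr mulr_suml subrr.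
have := free c cF c0 ord0; rewrite /c => /eqP; have [Fe e0] := he ord0.
rewrite (muld_eq0 hD) (negPf e0) orbF subr_eq0 => /eqP ce.
have si0 := s0 ord0; apply/esym/(cj_idP hD) => //; rewrite cjM // (cjV hD).
have -> : cj k' (s ord0) = cmm k' t * s ord0 by rewrite -ce cjE.
rewrite -(cjE t) //.
have := Ncmm Nk Nt; have cn0 : cmm k' t != 0 by rewrite /cmm !muldn0 ?invdn0.
move: (cmm k' t) cn0 => z z0 Fz; rewrite (invMd hD) -mulrA; congr (_ * _).
by gw.
Qed.

(* [m] is a finite sum of monomials, and [cmm m k] permutes their classes. *)
Lemma class2_finite m : M m -> exists l, forall k, N k ->
  exists2 y, y \in l & eqF (cmm m k) y.
Proof.
move=> Mm; have m0 := Mn0 Mm.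
case/(span_free_rep hD dF): (class2_span Mm) => [[|d] [e [s [he hs mE free]]]].
  by move: m0; rewrite mE big_ord0 eqxx.
have s0 i : s i != 0 by exact: Nn0.
exists [seq s ord0 * (s j)^-1 | j <- enum 'I_d.+1] => k Nk; have k0 := Nn0 Nk.
set w := cmm m k; have Nw : N w by exact: (normal_cmm nN Mm Nk).
have w0 := Nn0 Nw.
(* Equating [w^-1 * m] with [k * m * k^-1] writes [w^-1 * s ord0] through the [s j] and the other
   [w^-1 * s i]. It shares its class with one of the [s j], as the classes of the [s i] are
   distinct. *)
pose T : set D := [set t | (exists j, t = s j) \/ exists j, t = w^-1 * s (lift ord0 j)].
have NT : T `<=` N.
  by move=> t [[j ->]|[j ->]] //; apply: (sgM sN) => //; exact: sgV.
have Nws : N (w^-1 * s ord0) by apply: (sgM sN) => //; exact: sgV.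
have wm : w^-1 * m = k * m * k^-1 by rewrite /w /cmm; gw.
have [Fe0 e00] := he ord0.
have spT : span F T (e ord0 * (w^-1 * s ord0)).
  have -> : e ord0 * (w^-1 * s ord0) =
      k * m * k^-1 - \sum_(i < d) e (lift ord0 i) * (w^-1 * s (lift ord0 i)).
    rewrite -wm mE big_ord_recl mulrDr mulr_sumr.
    have E i : w^-1 * (e i * s i) = e i * (w^-1 * s i).
      by case: (he i) => Fe _; rewrite mulrA -Fe mulrA.
    by under eq_bigr do rewrite E; rewrite E addrK.
  apply: (spanB dF) => //.
    rewrite mE mulr_sumr mulr_suml; apply: span_sum => i _.
    have [Fe _] := he i; have si0 := s0 i.
    have -> : k * (e i * s i) / k = (e i * cmm k (s i)) * s i.
      by rewrite mulrA -Fe -!mulrA; congr (_ * _); rewrite /cmm; gw.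
    apply: span1; last by left; exists i.
    by apply: (drM dF) => //; apply: Ncmm.
  apply: span_sum => i _; apply: span1; first by case: (he (lift ord0 i)).
  by right; exists i.
have spw : span F T (w^-1 * s ord0).
  by rewrite -[_ * _](mulKd hD _ e00); apply: (spanZ dF) => //; exact: (drV dF).
have [t [[j ->]|[j ->]] wt] := class2_independent NT Nws spw.
  exists (s ord0 * (s j)^-1); first by apply: map_f; rewrite mem_enum.
  have h : eqF (w * (w^-1 * s ord0) * (s j)^-1) (w * s j * (s j)^-1).
    by apply: eqFM => //; [apply: eqFM => //; exact: eqF_refl|exact: eqF_refl].
  by apply: (eqF_sym hD); move: h; rewrite mulVKd // -mulrA muldV ?mulr1.
have [z [Fz z0 e1]] : eqF (s ord0) (s (lift ord0 j)).
  have := eqFM hD (eqF_refl hD w) wt; by rewrite !mulVKd.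
pose c i := if i == ord0 then 1 else if i == lift ord0 j then - z else 0.
have /(free _) : forall i, F (c i).
  move=> i; rewrite /c; case: eqP => _; first exact: (dr1 dF).
  by case: eqP => _; [exact: (drN dF)|exact: (dr0 dF)].
have -> : \sum_i c i * s i = 0; last by move=> /(_ erefl ord0)/eqP; rewrite /c eqxx oner_eq0.
rewrite big_ord_recl {1}/c eqxx mul1r (bigD1 j) //= {1}/c eqxx.
rewrite big1 ?addr0; last first.
  move=> i ij; rewrite /c -val_eqE /= (inj_eq (@lift_inj _ ord0)) (negPf ij) mul0r //.
by rewrite mulNr Fz e1 subrr.
Qed.

(* A group [N] which is finite modulo [F] makes [D] finite-dimensional, and [M]
   acts faithfully on [N / F] modulo [N]. *)
Lemma class2_finite_absurd : ~ finite_mod N F.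
Proof.
move=> [l0 /(finite_mod_sub hD)]; case/(_ (fun x Nx => Nn0 Nx)) => l [lN hl].
have Rl : span F N `<=` span F [set` l].
  apply: span_min => [|x y|e t Fe /hl [y [z [yl Fz z0 ->]]]]; first exact: span0.
    exact: spanD.
  rewrite -[y * z]Fz mulrA; apply: span1 => //; exact: (drM dF).
have R1 : span F N 1 by apply: (span_mem dF); exact: (sg1 sN).
have sR : subring (span F N).
  split=> //; first exact: span0.
  - by move=> x; exact: (spanN dF).
  - by move=> x y; exact: spanD.
  - by move=> x y; exact: (crossM hD dF sN NE).
have FR : F `<=` span F N.
  by move=> x Fx; rewrite -[x]mulr1; apply: (spanZ dF).
have dR := finite_span_divring hD dF sR FR Rl.
have Fl : [set: D] `<=` span F [set` l].
  move=> x _; apply: Rl; have : DgenF N x by rewrite class2_DgenF.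
  by apply: DgenF_min => // y Ny; exact: (span_mem dF).
apply: (finite_stabilizer_absurd hD snG maxM solM nabM Fl).
pose pat m (t : {ffun 'I_(size l) -> 'I_(size l)}) :=
  forall i : 'I_(size l), eqF (cj m l`_i) l`_(t i).
have hpat m : M m -> exists t, pat m t.
  move=> Mm; have /choice [t ht] : forall i : 'I_(size l), exists j : 'I_(size l),
      eqF (cj m l`_i) l`_j.
    move=> i; have Nl : N l`_i by apply: lN; exact: mem_nth.
    have [y [z [yl Fz z0 e]]] := hl _ (normal_cj nN Mm Nl).
    have yi : (index y l < size l)%N by rewrite index_mem.
    by exists (Ordinal yi); rewrite /= nth_index //; exists z.
  by exists [ffun i => t i] => i; rewrite ffunE.
pose g t := xget 1 [set m | M m /\ pat m t].
exists [seq g t * y | t <- enum {ffun 'I_(size l) -> 'I_(size l)}, y <- l] => m Mm.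
have [t ht] := hpat m Mm.
have [Mg hg] : M (g t) /\ pat (g t) t by rewrite /g; case: xgetP => [//|/(_ m) []].
have g0 := Mn0 Mg; have m0 := Mn0 Mm; have gV : (g t)^-1 != 0 by exact: invdn0.
have Ngm : N ((g t)^-1 * m).
  apply: class2_trivial; first by apply: (sgM sM) => //; exact: sgV.
  move=> k Nk; have [y [z [yl Fz z0 ->]]] := hl k Nk.
  have gm0 : (g t)^-1 * m != 0 by exact: muldn0.
  apply: (fixes_eqF hD gm0 (eqF_sym hD (eqF_mul y Fz z0))).
  have yi : (index y l < size l)%N by rewrite index_mem.
  have := ht (Ordinal yi); have := hg (Ordinal yi); rewrite /= !nth_index // => h1 h2.
  rewrite /fixes cjJ // -{2}(cjK hD y g0); apply: (eqFcj hD gV).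
  exact: (eqF_trans hD h2 (eqF_sym hD h1)).
have [y [z [yl Fz z0 e]]] := hl _ Ngm.
exists (g t * y), z; split=> //; last by rewrite -mulrA -e; gw.
by apply/allpairsP; exists (t, y); rewrite mem_enum.
Qed.

End Class2.
End Class2Groups.

Section NoNoncentralAbelian.
Variables (D : unitRingType) (hD : is_division_ring D).
Variables (G M : set D) (n : nat).
Hypotheses (snG : subnorm [set: D] n G) (maxM : maximal_subgroup M G).
Hypotheses (solM : solv M) (nabM : ~ abelian M).
Implicit Types (H N S E : set D) (l : seq D) (m g b v w x y : D).

Local Notation F := (@center D).
Local Notation dF := (divring_center hD).
Local Notation dT := (divringT D).
Let sM : subgroup M := sg_M maxM.
Let sG : subgroup G := sg_G hD snG.
Let MG : M `<=` G := MsubG maxM.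
Let Mn0 m : M m -> m != 0. Proof. exact: sgn0. Qed.

Lemma last_derived C : C 1 -> ~ M `<=` C -> exists B, [/\ normal B M, ~ B `<=` C &
  forall x y, B x -> B y -> C (cmm x y)].
Proof.
move=> C1 nMC; case: solM => k0 hk0.
have [|[|k] [hk min]] := @ex_min (fun k => derk k M `<=` C).
- by exists k0 => x /hk0 ->.
- by case: nMC.
exists (derk k M); split; first exact: (normal_derk hD k (normal_refl sM)).
  by move=> /min; rewrite ltnn.
by move=> x y Bx By; apply: hk; apply: der_cmm => //; exact: (sg_derk hD k sM).
Qed.

Hypothesis abelian_central : forall A, normal A M -> abelian A -> A `<=` F.

Lemma exists_class2 : exists N, class2 M N.
Proof.
have nMF : ~ M `<=` F by move=> MF; apply: nabM; exact: center_abelian.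
have [B [nB nBF cB]] := last_derived (dr1 dF) nMF.
exists (mulset B (M `&` F)); split.
- by apply: (normal_mulset hD nB); exact: (normal_center_M hD maxM).
- move=> aN; apply: nBF; apply: abelian_central => // x y Bx By.
  by apply: aN; apply: mulset_l => //; exact: (sg_center hD maxM).
- move=> _ _ [x [a [Bx [/Mn0 a0 Fa] ->]]] [y [b [By [/Mn0 b0 Fb] ->]]].
  have x0 := sgn0 (nsgN nB) Bx; have y0 := sgn0 (nsgN nB) By.
  rewrite (cmm_eqF hD x0 y0 (eqF_mul x Fa a0) (eqF_mul y Fb b0)); exact: cB.
- by apply: mulset_r; exact: nsgN nB.
Qed.

(** Were all commutators of [M] central, a noncentral [x] together with [M & F] would generate an
    abelian normal subgroup. *)
Lemma class2_proper N : class2 M N -> ~ M `<=` N.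
Proof.
move=> [nN nabN cN FN] MN.
have [x [Nx nFx]] : exists x, N x /\ ~ F x.
  apply: contrapT => no; apply: nabN; apply: center_abelian => x Nx.
  by apply: contrapT => nFx; apply: no; exists x.
pose X := [set x] `|` (M `&` F); have x0 := sgn0 (nsgN nN) Nx.
have X0 : X `<=` @Dstar D by move=> y [->|[/Mn0]].
have XM : X `<=` M by move=> y [->|[]] //; exact: (nsub nN Nx).
apply: nFx; apply: (abelian_central (A := gen X)); last 2 first.
- apply: (abelian_gen hD X0) => y z [->|[_ Fy]] [->|[_ Fz]] //; exact: Fy.
- by apply: sgen_sub; left.
have sX := sg_gen hD X0.
apply: (normalP sX sM); first exact: (gen_min sM XM).
move=> g y Mg; have g0 := Mn0 Mg; apply: (gen_cj hD X0 X0 g0) => {}y [->|[My Fy]].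
  have -> : cj g x = cmm g x * x by rewrite /cmm /cj; gw.
  apply: (sgM sX); apply: sgen_sub; last by left.
  right; split; first exact: (sgcmm sM Mg (nsub nN Nx)).
  by apply: cN => //; exact: MN.
by rewrite (cj_central hD g0 Fy); apply: sgen_sub; right.
Qed.

(** * Orbits of [B] on [N] modulo the center *)

Section Orbits.
Variables N B : set D.
Hypotheses (c2 : class2 M N) (nB : normal B M) (nBN : ~ B `<=` N).
Hypothesis cB : forall x y, B x -> B y -> N (cmm x y).

Let nN : normal N M. Proof. by case: c2. Qed.
Let sN : subgroup N. Proof. exact: nsgN nN. Qed.
Let sB : subgroup B. Proof. exact: nsgN nB. Qed.
Let Nn0 x : N x -> x != 0. Proof. exact: sgn0. Qed.
Let Bn0 x : B x -> x != 0. Proof. exact: sgn0. Qed.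
Let BM : B `<=` M. Proof. exact: nsub nB. Qed.
Let Ncmm x y : N x -> N y -> F (cmm x y). Proof. by case: c2 => _ _ h _; exact: h. Qed.
Let Nfixes x y : N x -> N y -> fixes x y. Proof. exact: (class2_fixes hD c2). Qed.

Definition orbit_in x l := forall b, B b -> exists2 y, y \in l & eqF (cj b x) y.

(** The orbit of [cmm b k] is finite: [B] being abelian modulo [N], conjugation by [c] multiplies
    [b] by an element of [N], which acts trivially on [N] modulo [F], and [cmm b] takes finitely
    many values on [N] modulo [F]. *)
Lemma exists_finite_orbit : exists x l, [/\ N x, ~ F x & orbit_in x l].
Proof.
have [b [Bb nNb]] : exists b, B b /\ ~ N b.
  apply: contrapT => no; apply: nBN => b Bb.
  by apply: contrapT => nNb; apply: no; exists b.
have [k [Nk nf]] : exists k, N k /\ ~ fixes b k.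
  apply: contrapT => no; apply: nNb.
  apply: (class2_trivial hD snG maxM solM c2 (BM Bb)) => k Nk.
  by apply: contrapT => nf; apply: no; exists k.
have [l hl] := class2_finite hD snG maxM solM c2 (BM Bb).
have k0 := Nn0 Nk; have b0 := Bn0 Bb.
exists (cmm b k), l; split; first exact: (normal_cmm nN (BM Bb) Nk).
  by move/(fixes_cmm hD k0 b0).
move=> c Bc; have c0 := Bn0 Bc; rewrite (cj_cmm hD) //.
have Nk' : N (cj c k) by exact: (normal_cj nN (BM Bc) Nk).
move: (cj c k) Nk' => k' Nk'; have [y yl ly] := hl k' Nk'; exists y => //.
have Nv : N (cmm b^-1 c) by apply: cB => //; exact: (sgV sB).
have -> : cj c b = b * cmm b^-1 c by rewrite /cmm /cj; gw.
apply: eqF_trans ly => //; rewrite !cmm_cj (cjJ hD).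
apply: eqFM => //; last exact: (eqF_refl hD).
by apply: eqFcj => //; exact: Nfixes.
Qed.

Section Stabilizer.
Variables (n0 : D) (l0 : seq D).
Hypotheses (Nn : N n0) (nFn : ~ F n0) (orb : orbit_in n0 l0).
Hypothesis minl : forall x l, N x -> ~ F x -> orbit_in x l -> (size l0 <= size l)%N.

Definition stab : set D := [set b | B b /\ fixes b n0].
Local Notation J := stab.

(* Otherwise [x] would have a shorter orbit modulo [F] than [n0]. *)
Lemma stab_maximal x c : N x -> ~ F x -> (forall b, J b -> fixes b x) -> B c ->
  fixes c x -> J c.
Proof.
move=> Nx nFx Jx Bc fcx; split=> //; apply: contrapT => nfc.
have [y0 y0l e0] := orb Bc.
have [y1 y1l e1] := orb (sg1 sB).
rewrite (cj_id hD (oner_neq0 D)) ?mul1r ?mulr1 // in e1.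
pose r y := xget 1 [set b | B b /\ eqF (cj b n0) y].
have rP b y : B b -> eqF (cj b n0) y -> eqF (cj b x) (cj (r y) x).
  move=> Bb e; have [Br er] : B (r y) /\ eqF (cj (r y) n0) y.
    by rewrite /r; case: xgetP => [//|/(_ b) []].
  have r0 := Bn0 Br; have rV : (r y)^-1 != 0 by exact: invdn0.
  have : J ((r y)^-1 * b).
    split; first by apply: (sgM sB) => //; exact: (sgV sB).
    rewrite /fixes (cjJ hD) -{2}(cjK hD n0 r0); apply: (eqFcj hD rV).
    exact: (eqF_trans hD e (eqF_sym hD er)).
  move/Jx; rewrite /fixes (cjJ hD) => /(eqFcj hD r0).
  by rewrite (cjKV hD).
have cx : eqF x (cj c x) by exact: (eqF_sym hD).
have y1x : eqF x (cj (r y1) x).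
  have := rP 1 y1 (sg1 sB).
  by rewrite !(cj_id hD (oner_neq0 D)) ?mul1r ?mulr1 //; apply.
have lt : (size (rem y1 l0) < size l0)%N.
  by rewrite size_rem // ltn_predL; case: (l0) y1l.
have := minl Nx nFx (l := [seq cj (r y) x | y <- rem y1 l0]).
rewrite size_map leqNgt lt => /(_ _)/negP; apply=> //.
have inr y : y \in l0 -> y != y1 -> y \in rem y1 l0.
  by rewrite (perm_mem (perm_to_rem y1l)) inE => /orP [/eqP ->|]; rewrite ?eqxx.
move=> b Bb; have [y yl e] := orb Bb; have bx := rP b y Bb e.
case: (eqVneq y y1) => [yE|ny]; last first.
  by exists (cj (r y) x) => //; apply: map_f; exact: inr.
exists (cj (r y0) x).
  apply: map_f; apply: inr => //; apply/eqP => y01; apply: nfc.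
  by apply: (eqF_trans hD e0); rewrite y01; exact: (eqF_sym hD).
rewrite yE in bx; apply: (eqF_trans hD bx).
apply: (eqF_trans hD (eqF_sym hD y1x)).
exact: (eqF_trans hD cx (rP c y0 Bc e0)).
Qed.

(** Fixed points modulo [F] of the stabilizer of [cj m n0] in [B]. *)
Definition fixed m : set D := [set v | N v /\ forall b, J b -> fixes (cj m b) v].
Local Notation V := fixed.

Let JB b : J b -> B b. Proof. by case. Qed.
Let cjB m b : M m -> B b -> B (cj m b). Proof. exact: normal_cj nB. Qed.
Let cjJn0 m b : M m -> J b -> cj m b != 0. Proof. by move=> Mm /JB Bb; apply/Bn0/cjB. Qed.
Let VN m : V m `<=` N. Proof. by move=> v []. Qed.
Let Vn0 m v : V m v -> v != 0. Proof. by move=> /VN /Nn0. Qed.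

Lemma sg_fixed m : M m -> subgroup (V m).
Proof.
move=> Mm; split.
- by move=> v /Vn0.
- split=> [|b Jb]; first exact: sg1.
  by apply: (fixes_center hD); [exact: cjJn0|exact: (dr1 dF)].
- move=> x y [Nx fx] [Ny fy]; split=> [|b Jb]; first exact: (sgM sN).
  by apply: (fixesM hD); [exact: cjJn0|exact: fx|exact: fy].
- move=> x [Nx fx]; split=> [|b Jb]; first exact: (sgV sN).
  by apply: (fixesV hD); exact: fx.
Qed.

Lemma fixed_center m : M m -> M `&` F `<=` V m.
Proof.
move=> Mm x [Mx Fx]; split=> [|b Jb]; first by case: c2 => _ _ _; apply.
by apply: (fixes_center hD) => //; exact: cjJn0.
Qed.

Lemma fixed_base m : M m -> V m (cj m n0).
Proof.
move=> Mm; have m0 := Mn0 Mm; split=> [|b [Bb fb]]; first exact: normal_cj nN Mm Nn.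
by apply/(fixes_cj hD) => //; rewrite (cjK hD).
Qed.

Lemma noncentral_base m : M m -> ~ F (cj m n0).
Proof.
move=> Mm Fc; apply: nFn; have m0 := Mn0 Mm.
by rewrite -(cjK hD n0 m0) (cj_central hD) ?invdn0.
Qed.

Lemma fixed_cj g m v : M g -> M m -> V m v -> V (g * m) (cj g v).
Proof.
move=> Mg Mm [Nv fv]; have g0 := Mn0 Mg; split=> [|b Jb]; first exact: normal_cj nN Mg Nv.
by rewrite (cjJ hD); apply/(fixes_cj hD) => //; rewrite (cjK hD) //; exact: fv.
Qed.

(** Commutators of [B] lie in [N] and act trivially on [N] modulo [F], so conjugating the stabilizer
    by [b] does not change its fixed points. *)
Lemma fixed_mulB b m v : B b -> M m -> V m v -> V (b * m) v.
Proof.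
move=> Bb Mm [Nv fv]; split=> // c Jc; have m0 := Mn0 Mm; have b0 := Bn0 Bb.
have Bb' : B (cj m^-1 b) by apply: cjB => //; exact: (sgV sM).
have c0 := Bn0 (JB Jc).
have -> : cj (b * m) c = cj m (cmm (cj m^-1 b) c) * cj m c.
  by rewrite /cmm /cj; gw.
have Nw : N (cj m (cmm (cj m^-1 b) c)).
  by apply: (normal_cj nN Mm); apply: cB => //; exact: JB.
by apply: (fixes_mul hD); [exact: Nn0|exact: Nfixes|exact: fv].
Qed.

Lemma fixed_cjB b m v : B b -> M m -> V m v -> V m (cj b v).
Proof.
move=> Bb Mm Vv; have b0 := Bn0 Bb; rewrite -(mulKd hD m b0).
have Mb := BM Bb.
apply: fixed_mulB; [exact: (sgV sB)|exact: (sgM sM)|exact: fixed_cj].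
Qed.

Section Displacement.
Variables b1 m : D.
Hypotheses (Bb1 : B b1) (Mm : M m) (nJ : ~ J (cj m^-1 b1)).
Let b10 : b1 != 0. Proof. exact: Bn0. Qed.
Let beta := cmm b1.

Let beta_V v : V m v -> V m (beta v).
Proof.
move=> Vv; have sV := sg_fixed Mm; rewrite /beta cmm_cj.
by apply: (sgM sV); [exact: fixed_cjB|exact: (sgV sV)].
Qed.

(** [cmm b1] is an endomorphism of [V m] modulo [F]; its kernel is fixed by [b1], which lies outside
    the stabilizer, so by [stab_maximal] the kernel is central. *)
Lemma displacement_inj x y : V m x -> V m y -> eqF (cmm b1 x) (cmm b1 y) -> eqF x y.
Proof.
move=> Vx Vy e; have m0 := Mn0 Mm; have mV : m^-1 != 0 by exact: invdn0.
have sV := sg_fixed Mm; have x0 := Vn0 Vx; have y0 := Vn0 Vy.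
apply: (eqF_divP hD) => //; apply: contrapT => nF; apply: nJ.
have Vxy : V m (y^-1 * x) by apply: (sgM sV) => //; exact: (sgV sV).
have xy0 := Vn0 Vxy; have MV : M m^-1 by exact: (sgV sM).
apply: (@stab_maximal (cj m^-1 (y^-1 * x))).
- by apply: normal_cj nN MV (VN Vxy).
- move=> Fc; apply: nF; rewrite -(cjKV hD (y^-1 * x) m0) (cj_central hD) //.
- move=> b Jb; apply/(fixes_cj hD) => //; case: Vxy => _; exact.
- exact: cjB.
apply/(fixes_cj hD) => //; rewrite invrK (cjKV hD) //.
have fxy : eqF (cj b1 x * x^-1 * x) (cj b1 y * y^-1 * x).
  by rewrite -!cmm_cj; apply: (eqFM hD e); exact: (eqF_refl hD).
have b1yV : eqF (cj b1 y^-1) (cj b1 y)^-1 by rewrite (cjV hD); exact: (eqF_refl hD).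
have by0 : cj b1 y != 0 by rewrite cj_eq0.
rewrite /fixes (cjM hD) ?b10 //; have := eqFM hD b1yV fxy.
move: (cj b1 x) (cj b1 y^-1) (cj b1 y) by0 => p q r r0; by gw.
Qed.

(** The image is finite modulo [F], so two iterates of the displacement at [w] agree, and
    injectivity cancels them down to [w] itself. *)
Lemma displacement_surj w : V m w -> exists2 u, V m u & eqF w (cmm b1 u).
Proof.
move=> Vw; have [l hl] := class2_finite hD snG maxM solM c2 (BM Bb1).
have Vi i : V m (iter i beta w) by elim: i => //= i; exact: beta_V.
have /choice [f hf] : forall i, exists y, y \in l /\ eqF (iter i.+1 beta w) y.
  by move=> i; have [y] := hl _ (VN (Vi i)); exists y.
have [i [j [ij _ fij]]] := pigeonhole (fun i => (hf i).1).
have e : eqF (iter i.+1 beta w) (iter j.+1 beta w).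
  by apply: (eqF_trans hD (hf i).2); rewrite fij; apply: (eqF_sym hD); exact: (hf j).2.
elim: i.+1 j.+1 (ij : (i.+1 < j.+1)%N) e => [|k IH] [|k'] //= kk e.
  by exists (iter k' beta w).
by apply: (IH k' kk); exact: displacement_inj.
Qed.

End Displacement.

(** For [b1] in the stabilizer attached to [m] but not to [m'], every [w] in [V m'] is some
    [[b1, u]] modulo [F]. As [b1] fixes [v], the pairing gives [[v, b1 u b1^-1] = [v, u]], so [v]
    commutes with [w]. *)
Lemma fixed_dichotomy m m' : M m -> M m' -> V m' `<=` V m \/
  forall v w, V m v -> V m' w -> v * w = w * v.
Proof.
move=> Mm Mm'.
case: (pselect (exists b, J b /\ ~ J (cj m'^-1 (cj m b)))) => [[b [Jb nJ]]|no]; last first.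
  left=> v [Nv fv]; split=> // b Jb.
  have J' : J (cj m'^-1 (cj m b)) by apply: contrapT => nJ; apply: no; exists b.
  by rewrite -(cjKV hD (cj m b) (Mn0 Mm')); exact: fv.
right=> v w Vv Vw; have Bb1 : B (cj m b) by apply: cjB => //; exact: JB.
have fb : fixes (cj m b) v by case: Vv => _; exact.
move: (cj m b) Bb1 nJ fb => b1 Bb1 nJ [z [Fz z0 vz]].
have [u Vu wu] := displacement_surj Bb1 Mm' nJ Vw.
have b10 := Bn0 Bb1; have u0 := Vn0 Vu; have v0 := Vn0 Vv; have w0 := Vn0 Vw.
have Nv := VN Vv; have Nu := VN Vu.
have bu0 : cj b1 u != 0 by rewrite cj_eq0.
apply: (cmm1P hD) => //.
have -> : cmm v w = cmm v (cj b1 u * u^-1).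
  by apply: (cmm_eqF hD) => //; [rewrite muldn0 ?invdn0|exact: (eqF_refl hD)].
have e : cmm v (cj b1 u) = cmm v u.
  have Fvu := Ncmm Nv Nu; rewrite -[RHS](cj_central hD b10 Fvu) (cj_cmm hD) // vz.
  apply/esym; apply: (cmm_eqF hD) => //; last exact: (eqF_refl hD).
  by exists z.
have FV : F (cmm v u^-1) by apply: Ncmm => //; exact: (sgV sN).
have -> : cmm v (cj b1 u * u^-1) = cmm v (cj b1 u) * cj (cj b1 u) (cmm v u^-1).
  by move: (cj b1 u) bu0 => p p0; rewrite /cmm /cj; gw.
rewrite e (cj_central hD bu0 FV).
have uV : u^-1 != 0 by exact: invdn0.
rewrite -(cj_central hD uV (Ncmm Nv Nu)).
by rewrite /cmm /cj; gw.
Qed.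

Lemma fixed_eq_or_commute m m' : M m -> M m' -> V m' = V m \/
  forall v w, V m v -> V m' w -> v * w = w * v.
Proof.
move=> Mm Mm'; have [h1|] := fixed_dichotomy Mm Mm'; last by right.
have [h2|h2] := fixed_dichotomy Mm' Mm; first by left; apply/seteqP.
by right=> v w Vv Vw; apply/esym; exact: h2.
Qed.

(** Now [V 1] is itself of class two, and some [b] in [B] lies outside [J], since otherwise [B]
    would act trivially on [V 1] and lie in it. The displacement by [b] is injective with finite
    image, hence [V 1] is finite modulo [F]. *)
Lemma fixed_normal_absurd : (forall m, M m -> V m = V 1) -> False.
Proof.
move=> hV; have M1 : M 1 by exact: (sg1 sM).
have c2' : class2 M (V 1).
  have nV : normal (V 1) M.
    apply: (normalP (sg_fixed M1) sM) => [v /VN /(nsub nN)//|g v Mg Vv].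
    by rewrite -(hV g Mg); have := fixed_cj Mg M1 Vv; rewrite mulr1.
  split=> //; last exact: fixed_center.
    move=> aV; apply: (noncentral_base M1); apply: (abelian_central nV aV).
    exact: fixed_base.
  by move=> x y /VN Nx /VN Ny; exact: Ncmm.
have cj1 x : cj 1 x = x by rewrite (cj_id hD (oner_neq0 D)) // mul1r mulr1.
have [b [Bb nJb]] : exists b, B b /\ ~ J b.
  apply: contrapT => no; apply: nBN => b Bb; apply: (@VN 1).
  apply: (class2_trivial hD snG maxM solM c2' (BM Bb)) => k [_ fk].
  have Jb : J b by apply: contrapT => nJb; apply: no; exists b.
  by have := fk b Jb; rewrite cj1.
have nJ : ~ J (cj 1^-1 b) by rewrite invr1 cj1.
have inj := displacement_inj Bb M1 nJ.
have [l hl] := class2_finite hD snG maxM solM c2 (BM Bb).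
apply: (class2_finite_absurd hD snG maxM solM nabM c2').
pose r y := xget 1 [set x | V 1 x /\ eqF (cmm b x) y].
exists [seq r y | y <- l] => x Vx; have [y yl e] := hl x (VN Vx).
have [Vr er] : V 1 (r y) /\ eqF (cmm b (r y)) y.
  by rewrite /r; case: xgetP => [//|/(_ x) []].
have [z [Fz z0 xE]] : eqF x (r y).
  by apply: inj => //; apply: (eqF_trans hD e); exact: (eqF_sym hD).
by exists (r y), z; split=> //; exact: map_f.
Qed.

(* [G] permutes the division rings [E m]. The kernel of this action contains an
   element of [E 1] outside [M], so that it meets [E 1] in a noncentral subnormal
   subgroup, which generates [D]. *)
Lemma fixed_not_normal_absurd m1 : M m1 -> V m1 <> V 1 -> False.
Proof.
move=> Mm1 neq; have M1 : M 1 by exact: (sg1 sM).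
(* Distinct [V m] commute with each other; were [V 1] abelian, they would together generate an
   abelian normal subgroup containing the noncentral [n0]. *)
have nabV : ~ abelian (V 1).
  move=> aV; pose U : set D := [set v | exists2 m, M m & V m v].
  have UM : U `<=` M by move=> v [m _ /VN /(nsub nN)].
  have U0 : U `<=` @Dstar D by move=> v /UM /Mn0.
  have aU : abelian U.
    move=> v w [m Mm Vv] [m' Mm' Vw]; have m0 := Mn0 Mm.
    have [e|] := fixed_eq_or_commute Mm Mm'; last exact.
    rewrite {}e in Vw; have MV : M m^-1 by exact: (sgV sM).
    have := aV _ _; rewrite -(mulVd hD m0) => aV'.
    have := aV' _ _ (fixed_cj MV Mm Vv) (fixed_cj MV Mm Vw).
    have mV : m^-1 != 0 by exact: invdn0.
    rewrite -!(cjM hD) // => /(congr1 (cj m)).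
    by rewrite !(cjKV hD).
  have nU : normal (gen U) M.
    apply: (normalP (sg_gen hD U0) sM); first exact: (gen_min sM UM).
    move=> g v Mg; apply: (gen_cj hD U0 U0 (Mn0 Mg)) => {}v [m Mm Vv].
    by apply: sgen_sub; exists (g * m); [exact: (sgM sM)|exact: fixed_cj].
  apply: (noncentral_base M1); apply: (abelian_central nU (abelian_gen hD U0 aU)).
  by apply: sgen_sub; exists 1 => //; exact: fixed_base.
pose E m := DgenF (V m); have dE m : divring (E m) by exact: divring_DgenF.
have [u [Gu Eu nMu]] : exists u, [/\ G u, E 1 u & ~ M u].
  apply: contrapT => no; apply: nabV => x y Vx Vy.
  have h : star (E 1) `&` G `<=` M.
    by move=> u [[Eu _] Gu]; apply: contrapT => nMu; apply: no; exists u.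
  have Gx : G x by apply: MG; apply: (nsub nN); exact: VN Vx.
  by apply: (star_abelian hD snG maxM solM (dE 1) h Gx); exact: DgenF_sub.
have u0 := sgn0 sG Gu; have uV : u^-1 != 0 by exact: invdn0.
have comE m : M m -> V m <> V 1 -> forall x y, E 1 x -> E m y -> x * y = y * x.
  move=> Mm nV; have [e|c] := fixed_eq_or_commute M1 Mm; first by case: nV.
  have h : E m `<=` centr (V 1).
    apply: DgenF_min; first exact: (divring_centr hD).
      by move=> w Vw v Vv; apply/esym; exact: c.
    by move=> z Fz y _; exact: Fz.
  have h' : E 1 `<=` centr (E m).
    apply: DgenF_min; first exact: (divring_centr hD).
      by move=> v Vv y Ey; apply/esym; exact: (h y Ey v Vv).
    by move=> z Fz y _; exact: Fz.
  by move=> x y Ex Ey; exact: h'.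
(* [u] lies in [E 1], hence in [E m] or in its centralizer. *)
have uE m : M m -> normz (E m) u.
  move=> Mm; case: (pselect (V m = V 1)) => [e|ne].
    by apply: (normz_star (dE m)); split=> //; rewrite /E e.
  by apply: (normz_centr_in hD u0) => y Ey; exact: (comE m Mm ne).
have cjE g m e : M g -> M m -> E m e -> E (g * m) (cj g e).
  move=> Mg Mm; have g0 := Mn0 Mg; apply: (Dgen_cj hD g0) => x [Vx|Fx].
    by apply: DgenF_sub; exact: fixed_cj.
  by rewrite (cj_central hD g0 Fx); exact: DgenF_center.
pose perm g := forall m, M m -> exists2 m', M m' & forall e, E m e <-> E m' (cj g e).
have permM g h : perm g -> perm h -> perm (g * h).
  move=> pg ph m Mm; have [m' Mm' h1] := ph m Mm; have [m'' Mm'' h2] := pg m' Mm'.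
  by exists m'' => // e; rewrite (cjJ hD) h1 h2.
have permG g : M g -> perm g.
  move=> Mg m Mm; have g0 := Mn0 Mg; exists (g * m); first exact: (sgM sM).
  move=> e; split; first exact: cjE.
  move/(cjE _ _ _ (sgV sM Mg) (sgM sM Mg Mm)); by rewrite mulKd // (cjK hD).
have permN g : (forall m, M m -> normz (E m) g) -> perm g.
  move=> ng m Mm; exists m => // e; split; first exact: (normz_cj (ng m Mm)).
  exact: (normz_cjE hD (ng m Mm)).
pose H : set D := [set g | [/\ G g, perm g & perm g^-1]].
have sH : subgroup H.
  split.
  - by move=> g [/(sgn0 sG)].
  - by split; [exact: (sg1 sG)|exact: permG|rewrite invr1; exact: permG].
  - move=> g h [Gg pg pg'] [Gh ph ph']; split; first exact: (sgM sG).
      exact: permM.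
    by rewrite (invMd hD); exact: permM.
  - by move=> g [Gg pg pg']; split; [exact: (sgV sG)| |rewrite invrK].
have MH : M `<=` H.
  by move=> m Mm; split; [exact: MG|exact: permG|apply: permG; exact: (sgV sM)].
have Hu : H u.
  split=> //; first exact: permN.
  by apply: permN => m Mm; apply: (sgV (sg_normz hD (E m))); exact: uE.
have GH : G `<=` H.
  have HG : H `<=` G by move=> g [].
  case: (maximalP maxM sH MH HG) => [e|<- //]; case: nMu.
  by rewrite -e.
pose G1 : set D := [set g | G g /\ forall m, M m -> normz (E m) g].
have sG1 : subgroup G1.
  split.
  - by move=> g [/(sgn0 sG)].
  - by split; [exact: (sg1 sG)|move=> m _; exact: (sg1 (sg_normz hD (E m)))].
  - move=> g h [Gg ng] [Gh nh]; split=> [|m Mm]; first exact: (sgM sG).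
    by apply: (sgM (sg_normz hD (E m))); [exact: ng|exact: nh].
  - move=> g [Gg ng]; split=> [|m Mm]; first exact: (sgV sG).
    by apply: (sgV (sg_normz hD (E m))); exact: ng.
have nG1 : normal G1 G.
  apply: (normalP sG1 sG) => [g []//|h g Gh [Gg ng]]; split; first exact: (sgcj sG).
  move=> m Mm; have h0 := sgn0 sG Gh; have g0 := sgn0 sG Gg.
  have [_ _ /(_ m Mm) [m' Mm' hm]] := GH _ Gh.
  have hm' x : E m' x -> E m (cj h x) by move=> Ex; apply/hm; rewrite (cjK hD).
  have [_ n1 n2] := ng m' Mm'.
  split; first by rewrite cj_eq0.
    by move=> e /hm /n1 /hm'; rewrite -!(cjJ hD).
  by move=> e /hm /n2 /hm'; rewrite -!(cjJ hD) -(cjV hD).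
have G1u : G1 u by [].
have sX : subgroup (G1 `&` E 1).
  have -> : G1 `&` E 1 = G1 `&` star (E 1).
    apply/seteqP; split=> x [G1x]; last by case.
    by move=> Ex; split=> //; split=> //; exact: (sgn0 sG1 G1x).
  by apply: sgI => //; exact: (sg_star hD (dE 1)).
have nX : normal (G1 `&` E 1) G1.
  apply: (normalP sX sG1) => [x []//|g x G1g [G1x Ex]].
  split; first exact: (sgcj sG1).
  by case: G1g => _ /(_ 1 M1) /normz_cj; apply.
(* This group contains [u], which is not central because central elements of [G] lie in [M]. So
   [E 1 = D], whereas [E m1] commutes with [E 1] and contains a noncentral element. *)
have ET : Dgen (G1 `&` E 1) = [set: D].
  apply: (Dgen_subnormal hD dT (subnorm_step (subnorm_step snG nG1) nX)).
  move=> c; apply: nMu; apply: (center_sub_M hD snG maxM solM nabM); split=> //.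
  by move=> y; exact: c.
apply: (noncentral_base Mm1) => y; apply/esym; apply: (comE m1 Mm1 neq).
  have : Dgen (G1 `&` E 1) y by rewrite ET.
  by apply: Dgen_min => // x [].
by apply: DgenF_sub; exact: fixed_base.
Qed.

End Stabilizer.

Lemma orbits_absurd : False.
Proof.
pose P k := exists x l, [/\ N x, ~ F x, orbit_in x l & size l = k].
have [|k [[x [l [Nx nFx ox sk]]] min]] := @ex_min P.
  by have [x [l [Nx nFx ox]]] := exists_finite_orbit; exists (size l), x, l.
have minl y l' : N y -> ~ F y -> orbit_in y l' -> (size l <= size l')%N.
  by move=> Ny nFy oy; rewrite sk; apply: min; exists y, l'.
case: (pselect (forall m, M m -> fixed x m = fixed x 1)) => [h|].
  exact: (fixed_normal_absurd Nx nFx ox minl h).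
move=> /existsNP [m /not_implyP [Mm ne]].
exact: (fixed_not_normal_absurd Nx nFx ox minl Mm ne).
Qed.

End Orbits.

Lemma no_noncentral_abelian_absurd : False.
Proof.
have [N c2] := exists_class2.
have N1 : N 1 by case: c2 => nN _ _ _; exact: (sg1 (nsgN nN)).
have [B [nB nBN cB]] := last_derived N1 (class2_proper c2).
exact: (orbits_absurd c2 nB nBN cB).
Qed.

End NoNoncentralAbelian.

(** * Noncentral abelian normal subgroups *)

Section NoncentralAbelian.
Variables (D : unitRingType) (hD : is_division_ring D).
Variables (G M : set D) (n : nat).
Hypotheses (snG : subnorm [set: D] n G) (maxM : maximal_subgroup M G).
Hypotheses (solM : solv M) (nabM : ~ abelian M).
Implicit Types (A H N S E : set D) (l : seq D) (m g b v w x y : D).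

Local Notation F := (@center D).
Local Notation dF := (divring_center hD).
Local Notation dT := (divringT D).
Let sM : subgroup M := sg_M maxM.
Let MG : M `<=` G := MsubG maxM.
Let Mn0 m : M m -> m != 0. Proof. exact: sgn0. Qed.

(** The centralizer of [A] in [M] generates with [F] a division ring commuting with [A], so not all
    of [D]; by the dichotomy it is abelian, and it contains its own centralizer in [M] because it
    contains [A]. *)
Lemma exists_self_centralizing A : normal A M -> abelian A -> ~ A `<=` F ->
  exists C, [/\ normal C M, abelian C, ~ C `<=` F & M `&` centr C `<=` C].
Proof.
move=> nA aA ncA; have AM := nsub nA; pose C := M `&` centr A.
have AC : A `<=` C by move=> x Ax; split; [exact: AM|move=> y Ay; exact: aA].
have sC : subgroup C.
  have -> : C = M `&` star (centr A).
    by apply/seteqP; split=> x [Mx]; [do !split=> //; exact: Mn0|case].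
  by apply: sgI => //; apply: (sg_star hD); exact: (divring_centr hD).
have nC : normal C M.
  apply: (normalP sC sM) => [x []//|g x Mg [Mx cx]]; split; first exact: (sgcj sM).
  exact: (normz_cj (normz_centr hD (normal_normz nA Mg)) cx).
exists C; split=> //.
- case: (dichotomy hD snG maxM solM nC) => // CT; case: ncA => x Ax.
  by apply: (DgenF_centr hD CT) => y [_ cy]; exact/esym/cy.
- by move=> CF; apply: ncA => x /AC /CF.
- by move=> x [Mx cx]; split=> // y /AC Cy; exact: cx.
Qed.

Variable C : set D.
Hypotheses (nC : normal C M) (aC : abelian C) (ncC : ~ C `<=` F).
Hypothesis selfC : M `&` centr C `<=` C.
Let sC : subgroup C. Proof. exact: nsgN nC. Qed.
Let CM : C `<=` M. Proof. exact: nsub nC. Qed.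
Let Cn0 x : C x -> x != 0. Proof. exact: sgn0. Qed.

Local Notation L := (DgenF C).
Let dL : divring L. Proof. exact: divring_DgenF. Qed.
Let aL : abelian L. Proof. exact: (abelian_DgenF hD aC). Qed.
Let CL : C `<=` L. Proof. exact: DgenF_sub. Qed.
Let FL : F `<=` L. Proof. exact: DgenF_center. Qed.

Lemma normz_field m : M m -> normz L m.
Proof. by move=> Mm; apply: (normz_DgenF hD); exact: normal_normz nC _ Mm. Qed.

Lemma centr_field x : M x -> centr L x -> C x.
Proof. by move=> Mx cx; apply: selfC; split=> // y /CL; exact: cx. Qed.

(** [star L & G] is not central and [L] is not all of [D], so this group lies in [M]; its elements
    commute with [C], hence lie in [C]. *)
Lemma field_group : star L `&` G = C.
Proof.
apply/seteqP; split=> x; last first.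
  by move=> Cx; split; [split; [exact: CL|exact: Cn0]|exact: MG (CM Cx)].
move=> [[Lx x0] Gx].
have ML : M `<=` normz L by move=> m; exact: normz_field.
have CLG y : C y -> (star L `&` G) y.
  by move=> Cy; split; [split; [exact: CL|exact: Cn0]|exact: MG (CM Cy)].
case: (normalizer_dichotomy hD snG maxM dL ML) => [h|h|h].
- by case: ncC => y /CLG /h.
- by case: nabM => y z _ _; apply: aL; rewrite h.
- by apply: centr_field => [|y Ly]; [apply: h|exact: aL].
Qed.

(* [D] is the division ring of fractions of [L[N]]. A denominator of [m] and then
   the resulting element of [L[N]] can be chosen to centralize [L], up to a
   monomial [e * t]. *)
Lemma abelian_by_abelian_full N : normal N M -> C `<=` N -> ~ N `<=` C ->
  (forall x y, N x -> N y -> C (cmm x y)) -> M `<=` N.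
Proof.
move=> nN CN nNC cN m Mm; have sN := nsgN nN; have NM := nsub nN.
have m0 := Mn0 Mm.
have NT : DgenF N = [set: D].
  case: (dichotomy hD snG maxM solM nN) => // aN; case: nNC => x Nx.
  by apply: selfC; split=> [|y /CN Ny]; [exact: NM|exact: aN].
have NL : N `<=` normz L by move=> x /NM; exact: normz_field.
have cNL x y : N x -> N y -> L (cmm x y) by move=> Nx Ny; apply: CL; exact: cN.
have Frm : Frac L N m.
  apply: (Dgen_Frac hD dL sN NL cNL); have : DgenF N m by rewrite NT.
  apply: DgenF_min; first exact: divring_Dgen.
    by move=> x Nx; apply: Dgen_sub; right.
  by move=> x /FL Lx; apply: Dgen_sub; left.
have sQ := sg_star hD dL.
have QL : star L `<=` normz L by move=> x; exact: (normz_star dL).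
have QR : star L `<=` span L N by move=> x [Lx _]; exact: (cross_coef sN).
have QN x t : star L x -> N t -> L (cmm x t).
  move=> [Lx x0] Nt; have t0 := sgn0 sN Nt.
  have -> : cmm x t = x * cj t x^-1 by rewrite /cmm /cj; gw.
  by apply: (drM dL) => //; apply: (normz_cj (NL _ Nt)); exact: (drV dL).
have nm : normz (star L) m by apply: (normz_star_sub hD dL); exact: normz_field.
have [f [Rf f0 Rfm cf]] :=
  exists_centralizing_denominator hD dL sN NL sQ QR QL QN m0 Frm nm.
have centr_star x : centr (star L) x -> centr L x.
  move=> cx y Ly; case: (eqVneq y 0) => [->|y0]; first by rewrite mul0r mulr0.
  exact: cx.
have fm0 : f * m != 0 by exact: muldn0.
have hq q : star L q -> L (cmm (f * m) q).
  move=> [Lq q0]; have Lmq := normz_cj (normz_field Mm) Lq.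
  rewrite cmm_cj (cjJ hD) (cj_id hD f0 (centr_star _ cf _ Lmq)).
  by apply: (drM dL) => //; exact: (drV dL).
have [e [t [h [[Le e0] Nt _ mE ch]]]] :=
  monomial_times_centralizing hD dL sN NL sQ QL QN Rfm fm0 hq.
have t0 := sgn0 sN Nt.
have Ntm : C (t^-1 * m).
  apply: centr_field; first by apply: (sgM sM) => //; apply: (sgV sM); exact: NM.
  have -> : t^-1 * m = cj t^-1 (f^-1 * e) * h.
    have -> : m = f^-1 * (e * t * h) by rewrite -mE; gw.
    by rewrite /cj; gw.
  have dcL := divring_centr hD L; apply: (drM dcL); last exact: centr_star.
  apply: (normz_cjV (normz_centr hD (NL _ Nt))); apply: (drM dcL).
    by apply: (drV dcL); exact: centr_star.
  by move=> y Ly; exact: aL.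
by rewrite -(mulVKd hD m t0); apply: (sgM sN) => //; exact: CN.
Qed.

Lemma cmmMl x y z : x != 0 -> y != 0 -> z != 0 ->
  cmm (x * y) z = cj x (cmm y z) * cmm x z.
Proof. by move=> x0 y0 z0; rewrite /cmm /cj; gw. Qed.

Lemma cmm_inv x y : x != 0 -> y != 0 -> cmm x y = (cmm y x)^-1.
Proof. by move=> x0 y0; rewrite /cmm; gw. Qed.

Lemma quotient_abelian x y : M x -> M y -> C (cmm x y).
Proof.
have nMC : ~ M `<=` C by move=> MC; apply: nabM => u v /MC Cu /MC Cv; exact: aC.
have [B [nB nBC cB]] := last_derived hD maxM solM (sg1 sC) nMC.
have sB := nsgN nB; have BM := nsub nB.
pose N := mulset B C.
have nN : normal N M by exact: (normal_mulset hD nB nC).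
have step u v : M u -> M v -> (forall b, B b -> C (cmm b v)) -> N u -> C (cmm u v).
  move=> Mu Mv h [b [c [Bb Cc ->]]].
  have b0 := sgn0 sB Bb; have c0 := Cn0 Cc; have v0 := Mn0 Mv.
  rewrite cmmMl //; apply: (sgM sC); last exact: h.
  by apply: (normal_cj nC); [exact: BM|exact: (normal_cmm' nC Mv Cc)].
have full : M `<=` N.
  apply: abelian_by_abelian_full => //.
  - by apply: mulset_r.
  - by move=> NC; apply: nBC => b Bb; apply: NC; exact: (mulset_l sC).
  move=> u v Nu Nv; have Mu := nsub nN Nu; have Mv := nsub nN Nv.
  apply: (step _ _) => // b Bb; have b0 := sgn0 sB Bb; have Mb := BM _ Bb.
  rewrite cmm_inv ?Mn0 //; apply: (sgV sC); apply: (step _ _) => // b' Bb'.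
  exact: cB.
move=> Mx My; apply: (step _ _) => //; last exact: full.
move=> b Bb; have b0 := sgn0 sB Bb; have Mb := BM _ Bb.
rewrite cmm_inv ?Mn0 //; apply: (sgV sC); apply: (step _ _) => //; last exact: full.
by move=> b' Bb'; exact: cB.
Qed.

(** Since [M / C] is abelian, [x] and [C] generate a normal subgroup that is abelian modulo [C],
    hence all of [M]. *)
Lemma cyclic_quotient x m : M x -> ~ C x -> M m ->
  exists c (i : int), C c /\ m = c * x ^ i.
Proof.
move=> Mx nCx; have x0 := Mn0 Mx; have ux := hD x0.
pose N : set D := [set z | exists c (i : int), C c /\ z = c * x ^ i].
have NM : N `<=` M by move=> _ [c [i [/CM Mc ->]]]; apply: (sgM sM) => //; exact: (sgXz _ sM).
have CN : C `<=` N by move=> c Cc; exists c, 0; rewrite expr0z mulr1.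
have sN : subgroup N.
  split.
  - by move=> z /NM /Mn0.
  - exact/CN/(sg1 sC).
  - move=> _ _ [c [i [Cc ->]]] [d [j [Cd ->]]]; have xi0 := expdzn0 hD i x0.
    exists (c * cj (x ^ i) d), (i + j); split.
      by apply: (sgM sC) => //; apply: (normal_cj nC) => //; exact: (sgXz _ sM).
    rewrite exprzDr // /cj; move: (x ^ i) (x ^ j) xi0 => a b a0; by gw.
  - move=> _ [c [i [Cc ->]]]; have xi0 := expdzn0 hD (- i) x0; have c0 := Cn0 Cc.
    exists (cj (x ^ (- i)) c^-1), (- i); split.
      by apply: (normal_cj nC); [exact: (sgXz _ sM)|exact: (sgV sC)].
    have e : x ^ i = (x ^ (- i))^-1 by rewrite invr_expz opprK.
    by rewrite e /cj; move: (x ^ (- i)) xi0 => a a0; gw.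
have nN : normal N M.
  apply: (normalP sN sM) => // g y Mg Ny; have g0 := Mn0 Mg; have y0 := sgn0 sN Ny.
  have -> : cj g y = cmm g y * y by rewrite /cmm /cj; gw.
  by apply: (sgM sN) => //; apply: CN; apply: quotient_abelian => //; exact: NM.
apply: (abelian_by_abelian_full nN CN); last first.
  by move=> u v /NM Mu /NM Mv; exact: quotient_abelian.
by move=> NC; apply: nCx; apply: NC; exists 1, 1; rewrite expr1z mul1r; split=> //; exact: (sg1 sC).
Qed.

(** Every power [x ^+ d] outside [C] generates [M] modulo [C], so [C] contains [x ^ (1 - d * i)] for
    some [i]. The case [d = 2] shows that the order [p] is finite, and a proper divisor [d != 1] of
    [p] would divide [1 - d * i]. *)
Lemma quotient_order x : M x -> ~ C x ->
  exists p, prime p /\ forall z : int, C (x ^ z) <-> (p %| `|z|)%N.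
Proof.
move=> Mx nCx; have x0 := Mn0 Mx; have ux := hD x0.
have CX (z : int) : C (x ^ z) <-> C (x ^+ `|z|%N).
  case: z => k //=; rewrite /exprz; split; last exact: (sgV sC).
  by move/(sgV sC); rewrite invrK.
have root d : ~ C (x ^+ d) -> exists i : int, C (x ^ (1 - d%:Z * i)).
  move=> nd; have Md : M (x ^+ d) by exact: (sgX _ sM).
  have [c [i [Cc e]]] := cyclic_quotient Md nd Mx; exists i.
  rewrite exprzDr // expr1z {1}e exprnP exprz_exp.
  by rewrite -mulrA -exprzDr // subrr expr0z mulr1.
have [|p [[p0 Cp] min]] := @ex_min (fun r => (0 < r)%N /\ C (x ^+ r)).
  case: (pselect (C (x ^+ 2))) => [C2|/root [i Ci]]; first by exists 2%N.
  exists `|(1 - 2%:Z * i)%R|%N; split; last exact/CX.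
  by rewrite absz_gt0; apply/eqP; lia.
have dvd (z : int) : C (x ^ z) <-> (p %| `|z|)%N.
  have Cpz (q : int) : C (x ^ (q * p%:Z)).
    by rewrite mulrC -exprz_exp; apply: (sgXz _ sC); exact: Cp.
  split=> [Cz|pz]; last first.
    have /dvdzP [q ->] : (p %| z)%Z by rewrite dvdzE.
    exact: Cpz.
  have pz0 : (p%:Z != 0) by rewrite -lt0n.
  have r0 : (0 <= (z %% p)%Z)%R by exact: modz_ge0.
  have rp : ((z %% p)%Z < p)%R by rewrite ltz_pmod.
  have Cr : C (x ^ (z %% p)%Z).
    have -> : (z %% p)%Z = z + (- (z %/ p)%Z) * p by rewrite {2}(divz_eq z p) mulNr addrAC subrr add0r.
    by rewrite exprzDr //; exact: (sgM sC).
  move: r0 rp Cr; case er: (z %% p)%Z => [r|//] _ rp Cr.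
  rewrite -[(p %| _)%N]/((p %| z)%Z); apply/dvdz_mod0P; rewrite er.
  case: r rp Cr {er} => // r rp Cr; have := min r.+1 (conj isT Cr).
  by move: rp; rewrite ltz_nat; lia.
exists p; split=> //; apply/primeP; split.
  case: (p) p0 Cp => // -[|//] _; by rewrite expr1.
move=> d dp; apply/orP; have [d1|d1] := eqVneq d 1%N; first by left.
right; apply: contraT => dnp; have dlt : (d < p)%N by rewrite ltn_neqAle dnp dvdn_leq.
have d0 : (0 < d)%N by exact: dvdn_gt0 dp.
have [|i /dvd] := @root d.
  by move=> Cd; have := min d (conj d0 Cd); rewrite leqNgt dlt.
move=> h; have h' : (d %| 1 - d%:Z * i)%Z by rewrite dvdzE; exact: dvdn_trans h.
have : (d %| 1 - d%:Z * i + d%:Z * i)%Z by apply: (rpredD h'); exact: dvdz_mulr.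
by rewrite subrK dvdzE dvdn1 absz_nat (negPf d1).
Qed.

End NoncentralAbelian.

(** * Cyclic maximal subfields *)

Section Characters.
Variables (D : unitRingType) (hD : is_division_ring D) (L : set D).

(* Dedekind's and Artin's argument: eliminating one term of a relation of minimal
   support by means of a value separating two characters. *)
Lemma support_elim k (P : ('I_k -> D) -> Prop) (chi : 'I_k -> D -> D) :
  (forall c y j, P c -> L y -> P (fun i => c i * (chi i y - chi j y))) ->
  (forall i j, i != j -> exists2 y, L y & chi i y != chi j y) ->
  (forall c j, P c -> (forall i, i != j -> c i = 0) -> c j = 0) ->
  forall c, P c -> forall i, c i = 0.
Proof.
move=> Pelim sep P1 c; move: {2}_.+1 (ltnSn #|[pred i | c i != 0]|) => s.
elim: s c => // s IH c cs Pc j; case: (eqVneq (c j) 0) => // cj0.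
case: (pselect (forall i, i != j -> c i = 0)) => [h|]; first exact: P1.
move=> /existsNP [i /not_implyP [ij ci0]].
have [y Ly ny] := sep i j ij.
pose c' i := c i * (chi i y - chi j y).
have lt : (#|[pred i | c' i != 0%R]| < s)%N.
  rewrite -ltnS (leq_trans _ cs) // ltnS; apply: proper_card; apply/properP; split.
    by apply/fintype.subsetP => k'; rewrite !inE (muld_eq0 hD) negb_or => /andP [].
  by exists j; rewrite !inE // /c' subrr mulr0 eqxx.
have /eqP := IH c' lt (Pelim c y j Pc Ly) i; rewrite (muld_eq0 hD) subr_eq0.
by rewrite (negPf ny) orbF => /eqP.
Qed.

Hypotheses (dL : divring L) (aL : abelian L).
Local Notation F := (@center D).

Lemma dedekind k (chi : 'I_k -> D -> D) (c : 'I_k -> D) :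
  (forall i, F_automorphism F L (chi i)) ->
  (forall i j, i != j -> exists2 y, L y & chi i y != chi j y) ->
  (forall i, L (c i)) -> (forall y, L y -> \sum_i c i * chi i y = 0) ->
  forall i, c i = 0.
Proof.
move=> auto sep Lc0 c0.
have chiM i y z : L y -> L z -> chi i (y * z) = chi i y * chi i z.
  by move=> Ly Lz; case: (auto i) => _ _ /(_ y z Ly Lz) [].
have chiL i y : L y -> L (chi i y) by case: (auto i) => h _ _ _ _; exact: h.
have chi1 i : chi i 1 = 1.
  by case: (auto i) => _ h _ _ _; apply: h => y; rewrite mul1r mulr1.
apply: (@support_elim k (fun c => (forall i, L (c i)) /\
  forall y, L y -> \sum_i c i * chi i y = 0) chi) => // {c Lc0 c0}.
- move=> c y j [Lc c0] Ly; split=> [i|z Lz].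
    by apply: (drM dL) => //; apply: (drB dL); exact: chiL.
  transitivity (\sum_i c i * chi i (y * z) - chi j y * \sum_i c i * chi i z).
    rewrite mulr_sumr -sumrB; apply: eq_bigr => i _.
    rewrite chiM // mulrBr mulrBl -!mulrA; congr (_ - _).
    by rewrite !mulrA; congr (_ * _); apply: aL => //; exact: chiL.
  by rewrite !c0 ?mulr0 ?subr0 //; exact: (drM dL).
- move=> c j [Lc /(_ 1 (dr1 dL))]; rewrite (bigD1 j) //= chi1 mulr1 => + h.
  by rewrite big1 ?addr0 // => i /h ->; rewrite mul0r.
Qed.

(** For [k > d] a nontrivial combination of the automorphisms vanishes at the [d] elements [b i],
    hence on [L] by linearity over [F]. *)
Lemma dedekind_bound k d (chi : 'I_k -> D -> D) (b : 'I_d -> D) :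
  (forall i, F_automorphism F L (chi i)) ->
  (forall i j, i != j -> exists2 y, L y & chi i y != chi j y) ->
  F `<=` L -> (forall i, L (b i)) ->
  (forall v, L v -> exists c : 'I_d -> D, (forall i, F (c i)) /\ v = \sum_i c i * b i) ->
  (k <= d)%N.
Proof.
move=> auto sep FL Lb sb; rewrite leqNgt; apply/negP => dk.
have chiL i y : L y -> L (chi i y) by case: (auto i) => h _ _ _ _; exact: h.
have [c [Lc [j cj0] c0]] := homogeneous_system hD dL dk (fun j i => chiL j _ (Lb i)).
move: cj0; rewrite (dedekind auto sep Lc) ?eqxx // => v /sb [f [Ff ->]].
have chi_lin i : chi i (\sum_l f l * b l) = \sum_l f l * chi i (b l).
  have [_ fixF chiDM _ _] := auto i.
  have [chi0 _] : chi i (\sum_(l <- [::] : seq 'I_d) f l * b l) = 0 /\ True.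
    by rewrite big_nil fixF // => z; rewrite mul0r mulr0.
  elim: (index_enum _) => [|l r IH]; first by rewrite chi0 big_nil.
  rewrite !big_cons; have Lfl : L (f l) by exact: FL.
  rewrite (chiDM _ _ _ _).1; last 2 first.
  - exact: (drM dL).
  - by apply: (dr_sum dL) => l'; apply: (drM dL) => //; exact: FL.
  by rewrite IH (chiDM _ _ _ _).2 // fixF.
under eq_bigr do rewrite chi_lin mulr_sumr.
rewrite exchange_big /= big1 // => l _.
transitivity (f l * \sum_i c i * chi i (b l)); last by rewrite c0 mulr0.
by rewrite mulr_sumr; apply: eq_bigr => i _; rewrite !mulrA; congr (_ * _); exact/esym/Ff.
Qed.

Lemma F_automorphism_cj m : normz L m -> F_automorphism F L (cj m).
Proof.
move=> nm; have m0 := normz_n0 nm; split.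
- by move=> y; exact: (normz_cj nm).
- by move=> y Fy; exact: (cj_central hD).
- by move=> y z _ _; rewrite cjD cjM.
- move=> y Ly; exists (cj m^-1 y); rewrite cjKV //; split=> //.
  exact: (normz_cjV nm).
- by move=> y z _ _ /(congr1 (cj m^-1)); rewrite !cjK.
Qed.

End Characters.

Lemma dependent_span (D : unitRingType) (hD : is_division_ring D) (E V : set D) k :
  divring E ->
  (forall w : 'I_k.+1 -> D, (forall i, V (w i)) -> exists c : 'I_k.+1 -> D,
    [/\ forall i, E (c i), exists j, c j != 0 & \sum_i c i * w i = 0]) ->
  exists l : seq D, (forall y, y \in l -> V y) /\ V `<=` span E [set` l].
Proof.
move=> dE; elim: k => [|k IH] dep.
  exists [::]; split=> // v Vv; have [c [_ [j cj0] e]] := dep (fun=> v) (fun=> Vv).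
  rewrite ord1 in cj0; move: e; rewrite big_ord1 => /eqP.
  by rewrite (muld_eq0 hD) (negPf cj0) => /eqP ->; exact: span0.
case: (pselect (forall w : 'I_k.+1 -> D, (forall i, V (w i)) -> exists c : 'I_k.+1 -> D,
    [/\ forall i, E (c i), exists j, c j != 0 & \sum_i c i * w i = 0])) => [/IH //|].
move=> /existsNP [w /not_implyP [Vw nw]].
exists [seq w i | i <- enum 'I_k.+1]; split=> [y /mapP [i _ ->] //|v Vv].
pose w' (i : 'I_k.+2) := if unlift ord0 i is Some j then w j else v.
have [|c [Ec [j cj0]]] := dep w'; first by move=> i; rewrite /w'; case: unliftP.
rewrite big_ord_recl {1}/w' unlift_none.
under eq_bigr do rewrite /w' liftK.
case: (eqVneq (c ord0) 0) => [c00|c00 e].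
  rewrite c00 mul0r add0r => e; case: nw; exists (fun i => c (lift ord0 i)); split=> //.
  case: (unliftP ord0 j) => [i ji|j0]; first by exists i; rewrite -ji.
  by rewrite j0 c00 eqxx in cj0.
rewrite -(mulKd hD v c00); apply: (spanZ dE); first exact: (drV dE).
have -> : c ord0 * v = - \sum_(i < k.+1) c (lift ord0 i) * w i.
  by apply/eqP; rewrite -subr_eq0 opprK; apply/eqP.
apply: (spanN dE); apply: span_sum => i _; apply: span1 => //=.
by apply: map_f; rewrite mem_enum.
Qed.

Lemma dim_over_finType (D : unitRingType) (T : finType) (E V : set D) (b : T -> D) :
  (forall t, V (b t)) ->
  (forall c : T -> D, (forall t, E (c t)) -> \sum_t c t * b t = 0 -> forall t, c t = 0) ->
  (forall v, V v -> exists c : T -> D, (forall t, E (c t)) /\ v = \sum_t c t * b t) ->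
  dim_over E V #|T|.
Proof.
move=> Vb free sp; exists (fun i => b (enum_val i)); split=> [i|c Ec c0 i|v /sp [c [Ec ->]]].
- exact: Vb.
- rewrite -[i]enum_valK; apply: (free (fun t => c (enum_rank t))) => [t|]; first exact: Ec.
  rewrite -[RHS]c0 (reindex_onto enum_val enum_rank) /=; last by move=> t _; exact: enum_rankK.
  by apply: eq_big => [j|j _]; rewrite enum_valK ?eqxx.
- exists (fun i => c (enum_val i)); split=> [i|]; first exact: Ec.
  rewrite (reindex_onto enum_val enum_rank) /=; last by move=> t _; exact: enum_rankK.
  by apply: eq_big => [j|j _]; rewrite ?enum_valK ?eqxx.
Qed.

Section CyclicField.
Variables (D : unitRingType) (hD : is_division_ring D) (L : set D) (x : D) (p : nat).
Hypotheses (dL : divring L) (aL : abelian L) (pp : prime p).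
Hypotheses (nx : normz L x) (Lxp : L (x ^+ p)).
Hypothesis act : forall i, (forall y, L y -> cj (x ^+ i) y = y) -> (p %| i)%N.
Hypothesis gensD : forall R, divring R -> L `<=` R -> R x -> R = [set: D].
Implicit Types (y z d : D).

Local Notation F := (@center D).
Local Notation dF := (divring_center hD).
Local Notation s i := (cj (x ^+ i)).
Let x0 : x != 0. Proof. exact: normz_n0 nx. Qed.
Let p0 : (0 < p)%N. Proof. exact: prime_gt0. Qed.
Let xi0 i : x ^+ i != 0. Proof. exact: expdn0. Qed.

Lemma normz_power i : normz L (x ^+ i).
Proof. by apply: sgX => //; exact: sg_normz. Qed.

Let sL i y : L y -> L (s i y). Proof. exact: (normz_cj (normz_power i)). Qed.

Lemma powerD i j y : s (i + j) y = s i (s j y).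
Proof. by rewrite exprD (cjJ hD). Qed.

Lemma power_mulp q : L (x ^+ (q * p)).
Proof. by rewrite mulnC exprM; exact: (drX dL). Qed.

Lemma power_mod i y : L y -> s (i %% p) y = s i y.
Proof.
move=> Ly; rewrite {2}(divn_eq i p) powerD [RHS](cj_id hD) //.
by apply: aL; [exact: power_mulp|exact: sL].
Qed.

Lemma power_sep i j : (i < p)%N -> (j < p)%N -> i != j -> exists2 y, L y & s i y != s j y.
Proof.
wlog ij : i j / (i < j)%N => [W|_ jp _].
  move=> ip jp; rewrite neq_ltn => /orP [ij|ij]; first by apply: W; rewrite ?ltn_eqF.
  have [|y Ly ny] := W j i ij jp ip; first by rewrite ltn_eqF.
  by exists y => //; rewrite eq_sym.
apply: contrapT => no.
have : (p %| j - i)%N.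
  apply: act => y Ly; apply: contrapT => ny; apply: no; exists y => //.
  apply/eqP => e; apply: ny; rewrite -{2}(cjK hD y (xi0 i)) e.
  by rewrite -{2}(subnKC (ltnW ij)) powerD (cjK hD).
by apply/negP; rewrite gtnNdvd ?subn_gt0 // (leq_ltn_trans (leq_subr i j)).
Qed.

Definition combination d := exists c : 'I_p -> D,
  (forall i, L (c i)) /\ d = \sum_i c i * x ^+ i.

Let comb0 : combination 0.
Proof.
exists (fun=> 0); split=> [_|]; first exact: (dr0 dL).
by rewrite big1 // => i _; rewrite mul0r.
Qed.

Let combD y z : combination y -> combination z -> combination (y + z).
Proof.
move=> [c [Lc ->]] [c' [Lc' ->]]; exists (fun i => c i + c' i); split=> [i|].
  exact: (drD dL).
by rewrite -big_split; apply: eq_bigr => i _; rewrite mulrDl.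
Qed.

Let comb_sum k (f : 'I_k -> D) : (forall i, combination (f i)) -> combination (\sum_i f i).
Proof. by move=> h; apply: big_ind => //; exact: combD. Qed.

Let comb_mono e i : L e -> combination (e * x ^+ i).
Proof.
move=> Le; have im : (i %% p < p)%N by rewrite ltn_mod.
exists (fun j => if j == Ordinal im then e * x ^+ (i %/ p * p) else 0); split=> [j|].
  by case: ifP => _; [apply: (drM dL) => //; exact: power_mulp|exact: (dr0 dL)].
rewrite (bigD1 (Ordinal im)) //= eqxx big1 ?addr0; last first.
  by move=> j /negPf ->; rewrite mul0r.
by rewrite {1}(divn_eq i p) exprD mulrA.
Qed.

Let comb_mul y z : combination y -> combination z -> combination (y * z).
Proof.
move=> [c [Lc ->]] [c' [Lc' ->]]; rewrite mulr_suml; apply: comb_sum => i.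
rewrite mulr_sumr; apply: comb_sum => j.
have -> : c i * x ^+ i * (c' j * x ^+ j) = c i * s i (c' j) * x ^+ (i + j).
  by have := xi0 i; rewrite exprD /cj; move: (x ^+ i) (x ^+ j) => a b a0; gw.
by apply: comb_mono; apply: (drM dL) => //; exact: sL.
Qed.

(** Combinations form a ring of finite dimension over [L], hence a division ring, and it contains
    [L] and [x]. *)
Lemma combinationT d : combination d.
Proof.
have LS : L `<=` combination by move=> y Ly; rewrite -[y]mulr1 -(expr0 x); exact: comb_mono.
have sub : combination `<=` span L [set` [seq x ^+ (nat_of_ord i) | i <- enum 'I_p]].
  move=> _ [c [Lc ->]]; apply: span_sum => i _; apply: span1 => //=.
  by apply/mapP; exists i => //; rewrite mem_enum.
have rS : subring (combination : set D).
  split=> //; first exact: LS (dr1 dL).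
  move=> y Sy; rewrite -mulN1r; apply: comb_mul => //; apply: LS.
  exact: (drN dL) (dr1 dL).
have Sx : combination x by rewrite -[x]mul1r -[x]expr1; apply: comb_mono; exact: (dr1 dL).
by have := gensD (finite_span_divring hD dL rS LS sub) LS Sx; move=> /seteqP [_]; apply.
Qed.

Lemma combination_free (c : 'I_p -> D) : (forall i, L (c i)) ->
  \sum_i c i * x ^+ i = 0 -> forall i, c i = 0.
Proof.
move=> Lc0 c0; apply: (@support_elim D hD L p (fun c => (forall i, L (c i)) /\
  \sum_i c i * x ^+ i = 0) (fun i y => s i y)) => // {c Lc0 c0}.
- move=> c y j [Lc c0] Ly; split=> [i|].
    by apply: (drM dL) => //; apply: (drB dL); exact: sL.
  transitivity ((\sum_i c i * x ^+ i) * y - s j y * \sum_i c i * x ^+ i).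
    rewrite mulr_suml mulr_sumr -sumrB; apply: eq_bigr => i _.
    rewrite mulrBr mulrBl; congr (_ - _).
      by have := xi0 i; rewrite /cj; move: (x ^+ i) => a a0; gw.
    by rewrite mulrA; congr (_ * _); apply: aL => //; exact: sL.
  by rewrite c0 mul0r mulr0 subr0.
- by move=> i j ij; exact: power_sep.
- move=> c j [Lc]; rewrite (bigD1 j) //= => + h.
  rewrite big1 ?addr0 => [/eqP|i /h ->]; last by rewrite mul0r.
  by rewrite (muld_eq0 hD) (negPf (xi0 j)) orbF => /eqP.
Qed.

Lemma centr_sub : centr L `<=` L.
Proof.
move=> d cd; have [c [Lc dE]] := combinationT d.
have ci (i : 'I_p) : nat_of_ord i != 0%N -> c i = 0.
  move=> i0; have [y Ly] := power_sep (ltn_ord i) p0 i0.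
  rewrite expr0 (cj_id hD (oner_neq0 D)) ?mul1r ?mulr1 // => ny.
  pose c' j := c j * (s j y - y).
  have Lc' j : L (c' j) by apply: (drM dL) => //; apply: (drB dL) => //; exact: sL.
  have /combination_free /(_ i) /eqP : \sum_j c' j * x ^+ j = 0.
    transitivity (d * y - y * d); last by rewrite cd // subrr.
    rewrite dE mulr_suml mulr_sumr -sumrB; apply: eq_bigr => j _.
    rewrite /c' mulrBr mulrBl; congr (_ - _).
      by have := xi0 j; rewrite /cj; move: (x ^+ j) => a a0; gw.
    by rewrite mulrA; congr (_ * _); exact: aL.
  rewrite /c' (muld_eq0 hD) subr_eq0 (negPf ny) orbF; move/(_ Lc')/eqP; exact.
rewrite dE; apply: (dr_sum dL) => i; case: (eqVneq (nat_of_ord i) 0%N) => [->|/ci ->].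
  by rewrite expr0 mulr1.
by rewrite mul0r; exact: (dr0 dL).
Qed.

Let FL : F `<=` L. Proof. by move=> z Fz; apply: centr_sub => y _; exact: Fz. Qed.

Lemma maximal_subfield_field : maximal_subfield L.
Proof.
split; first by split; [case: dL|move=> y Ly _; exact: (drV dL)|exact: aL].
move=> K [_ _ aK] LK; apply/seteqP; split=> // y Ky.
by apply: centr_sub => z /LK Kz; exact: aK.
Qed.

Lemma fixed_central y : L y -> cj x y = y -> F y.
Proof.
move=> Ly /(cj_idP hD x0) e d; have := gensD (divring_centr hD [set y]).
move=> /(_ _ _)/seteqP [||_ /(_ d I) h].
- by move=> z Lz _ ->; exact: aL.
- by move=> _ ->.
- by rewrite h.
Qed.

Definition trace y := \sum_(i < p) s i y.

Lemma trace_central y : L y -> F (trace y).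
Proof.
move=> Ly; apply: fixed_central.
  by apply: (dr_sum dL) => i; exact: sL.
rewrite /trace.
have -> : cj x (\sum_(i < p) s i y) = \sum_(i < p) s i.+1 y.
  rewrite /cj mulr_sumr mulr_suml; apply: eq_bigr => i _.
  by have := xi0 i; rewrite exprS; move: (x ^+ i) => a a0; gw.
have : \sum_(i < p.+1) s i y = \sum_(i < p.+1) s i y by [].
rewrite {1}big_ord_recl big_ord_recr /= expr0 -(power_mod p Ly) modnn expr0.
by rewrite addrC => /addrI <-.
Qed.

Lemma trace_neq0 a : L a -> a != 0 -> exists2 y, L y & trace (y * a) != 0.
Proof.
move=> La a0; apply: contrapT => no.
suff e : forall i : 'I_p, (fun=> 1 : D) i = 0 by have /eqP := e (Ordinal p0); rewrite oner_eq0.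
apply: (dedekind hD dL aL (chi := fun i y => s (nat_of_ord i) y)).
- by move=> i; apply: (F_automorphism_cj hD); exact: normz_power.
- by move=> i j ij; exact: power_sep.
- by move=> _; exact: (dr1 dL).
move=> y Ly; under eq_bigr do rewrite mul1r.
apply/eqP; apply: contraT => ty; case: no; exists (y * a^-1).
  by apply: (drM dL) => //; exact: (drV dL).
by have -> : y * a^-1 * a = y by gw.
Qed.

(* Applying the trace to a solution of the system [sum_j c_j s^-i (u_j) = 0]
   makes its coefficients central. *)
Lemma field_dependent k (u : 'I_k -> D) : (p < k)%N -> (forall j, L (u j)) ->
  exists c : 'I_k -> D,
    [/\ forall j, F (c j), exists j, c j != 0 & \sum_j c j * u j = 0].
Proof.
move=> pk Lu.
have Lsu j (i : 'I_p) : L (cj (x ^+ i)^-1 (u j)).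
  exact: (normz_cjV (normz_power i)).
have [c [Lc [j cn0] c0]] := homogeneous_system hD dL pk Lsu.
have [y Ly ty] := trace_neq0 (Lc j) cn0.
exists (fun j => trace (y * c j)); split.
- by move=> l; apply: trace_central; exact: (drM dL).
- by exists j.
under eq_bigr do rewrite /trace mulr_suml.
rewrite exchange_big big1 //= => i _.
transitivity (s i (y * \sum_j c j * cj (x ^+ i)^-1 (u j))); last by rewrite c0 mulr0 cj0.
rewrite mulr_sumr /cj mulr_sumr mulr_suml; apply: eq_bigr => l _.
by have := xi0 i; move: (x ^+ i) => a a0; gw.
Qed.

Lemma field_basis : exists b : 'I_p -> D, [/\ forall i, L (b i),
  forall c : 'I_p -> D, (forall i, F (c i)) -> \sum_i c i * b i = 0 -> forall i, c i = 0 &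
  forall v, L v -> exists c : 'I_p -> D, (forall i, F (c i)) /\ v = \sum_i c i * b i].
Proof.
have [l [lL Ll]] := dependent_span hD dF (fun w => field_dependent (ltnSn p) (u := w)).
have [k [b [Lb sb free]]] := exists_basis hD dF lL Ll.
have kp : k = p.
  apply/eqP; rewrite eqn_leq; apply/andP; split.
    rewrite leqNgt; apply/negP => pk.
    have [c [Fc [j cj0] c0]] := field_dependent pk Lb.
    by rewrite (free c Fc c0) eqxx in cj0.
  apply: (@dedekind_bound D hD L dL aL p k (fun i => s i) b) => //.
    by move=> i; apply: (F_automorphism_cj hD); exact: normz_power.
  by move=> i j ij; exact: power_sep.
by move: b Lb sb free; rewrite kp => b Lb sb free; exists b.
Qed.

Lemma dim_square : dim_over F [set: D] (p ^ 2).
Proof.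
have [b [Lb free sb]] := field_basis.
have -> : (p ^ 2)%N = #|{: 'I_p * 'I_p}| by rewrite card_prod card_ord mulnn.
apply: (@dim_over_finType D ('I_p * 'I_p)%type F setT (fun t => b t.2 * x ^+ t.1)) => //.
- move=> c Fc c0 [i j] /=; apply: (free (fun j => c (i, j))) => // {j}.
  apply: (@combination_free (fun i => \sum_j c (i, j) * b j)) => [k|].
    by apply: (dr_sum dL) => j; apply: (drM dL) => //; exact: FL.
  rewrite -[RHS]c0 (eq_bigr (fun k : 'I_p => \sum_j c (k, j) * (b j * x ^+ k))).
    by rewrite pair_bigA /=; apply: eq_bigr => -[].
  by move=> k _; rewrite mulr_suml; apply: eq_bigr => j _; rewrite mulrA.
move=> d _; have [c [Lc ->]] := combinationT d.
have /choice [f hf] : forall i, exists f : 'I_p -> D,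
    (forall j, F (f j)) /\ c i = \sum_j f j * b j by move=> i; exact: sb.
exists (fun t => f t.1 t.2); split=> [t|]; first exact: (hf _).1.
rewrite (eq_bigr (fun i : 'I_p => \sum_j f i j * (b j * x ^+ i))).
  by rewrite pair_bigA.
by move=> i _; rewrite (hf i).2 mulr_suml; apply: eq_bigr => j _; rewrite mulrA.
Qed.

Lemma finite_galois_field : finite_galois F L.
Proof.
split=> //; first by have [b [? ? ?]] := field_basis; exists p, b.
move=> y Ly h; apply: fixed_central => //; apply: h.
exact: (F_automorphism_cj hD).
Qed.

(** A further automorphism would make [p + 1] distinct ones, while [L] has dimension [p] over
    [F]. *)
Lemma galois_power t : F_automorphism F L t -> exists i : 'I_p,
  forall y, L y -> t y = s i y.
Proof.
move=> at_; apply: contrapT => no; have [b [Lb _ sb]] := field_basis.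
pose chi (i : 'I_p.+1) := if unlift ord0 i is Some j then s (nat_of_ord j) else t.
suff : (p.+1 <= p)%N by rewrite ltnn.
have sept (i : 'I_p) : exists2 y, L y & t y != s i y.
  apply: contrapT => no'; apply: no; exists i => y Ly; apply/eqP.
  by apply: contraT => ny; case: no'; exists y.
apply: (@dedekind_bound D hD L dL aL p.+1 p chi b) => //.
  move=> i; rewrite /chi; case: unliftP => [j _|_] //.
  by apply: (F_automorphism_cj hD); exact: normz_power.
move=> i j; rewrite /chi; case: (unliftP ord0 i) => [i' ->|->];
  case: (unliftP ord0 j) => [j' ->|->].
- by rewrite (inj_eq (@lift_inj _ ord0)) => ij; exact: power_sep.
- by have [y Ly ny] := sept i'; exists y => //; rewrite eq_sym.
- by move=> _; exact: sept.
- by rewrite eqxx.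
Qed.

Lemma galois_cyclic : gal_iso_Zp F L p.
Proof.
(* ['Z_p] has [(Zp_trunc p).+2] elements; with [p] written as [q.+2] it unfolds to ['I_p]. *)
have [q pE] : exists q, p = q.+2 by case: (p) pp => [|[|q]] //; exists q.
have aut : forall t, F_automorphism F L t -> exists i : 'I_p, forall y, L y -> t y = s i y.
  exact: galois_power.
have sepp := power_sep; have modp := power_mod; move: aut sepp modp; rewrite pE.
move=> aut sepp modp; exists (fun i => s (nat_of_ord i)); split.
- by move=> i; apply: (F_automorphism_cj hD); exact: normz_power.
- exact: aut.
- move=> i j h; apply/eqP; apply: contraT => ij.
  by have [y /h ->] := sepp i j (ltn_ord i) (ltn_ord j) ij; rewrite eqxx.
- by move=> i j y Ly; rewrite -powerD -[RHS]modp.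
Qed.

End CyclicField.

(** * The structure of the maximal subgroup *)

Section Index.
Variables (D : unitRingType) (hD : is_division_ring D).
Variables (G M : set D) (n : nat).
Hypotheses (snG : subnorm [set: D] n G) (maxM : maximal_subgroup M G).
Hypotheses (solM : solv M) (nabM : ~ abelian M).
Variable C : set D.
Hypotheses (nC : normal C M) (aC : abelian C).
Hypothesis selfC : M `&` centr C `<=` C.
Implicit Types (N S E : set D) (l : seq D) (m x y z : D).

Local Notation F := (@center D).
Local Notation dF := (divring_center hD).
Local Notation L := (DgenF C).
Let sM : subgroup M := sg_M maxM.
Let sC : subgroup C. Proof. exact: nsgN nC. Qed.
Let CM : C `<=` M. Proof. exact: nsub nC. Qed.
Let Mn0 m : M m -> m != 0. Proof. exact: sgn0. Qed.
Let Cn0 x : C x -> x != 0. Proof. exact: sgn0. Qed.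
Let dL : divring L. Proof. exact: divring_DgenF. Qed.
Let aL : abelian L. Proof. exact: (abelian_DgenF hD aC). Qed.
Let CL : C `<=` L. Proof. exact: DgenF_sub. Qed.

Lemma outside_exists : exists2 x, M x & ~ C x.
Proof.
apply: contrapT => no; apply: nabM => u v Mu Mv; apply: aC.
  by apply: contrapT => nu; apply: no; exists u.
by apply: contrapT => nv; apply: no; exists v.
Qed.

Section Order.
Variables (x : D) (p : nat).
Hypotheses (Mx : M x) (nCx : ~ C x) (pp : prime p).
Hypothesis order : forall z : int, C (x ^ z) <-> (p %| `|z|)%N.
Let x0 : x != 0. Proof. exact: Mn0. Qed.
Let ux : x \is a GRing.unit. Proof. exact: hD. Qed.
Let p0 : (0 < p)%N. Proof. exact: prime_gt0. Qed.

Lemma coset_power m : M m -> exists i : 'I_p, C (m * (x ^+ i)^-1).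
Proof.
move=> Mm.
have [c [z [Cc ->]]] := cyclic_quotient hD snG maxM solM nabM nC aC selfC Mx nCx Mm.
have pz0 : p%:Z != 0 by rewrite -lt0n.
have zp : (`|(z %% p)%Z| < p)%N.
  by rewrite -ltz_nat gez0_abs ?modz_ge0 // ltz_pmod.
exists (Ordinal zp) => /=; rewrite -mulrA; apply: (sgM sC) => //.
have -> : x ^+ `|(z %% p)%Z|%N = x ^ (z %% p)%Z by rewrite exprnP gez0_abs ?modz_ge0.
rewrite invr_expz -exprzDr //; apply/order.
rewrite -[(p %| _)%N]/((p %| _)%Z) {1}(divz_eq z p) addrK; exact: dvdz_mull.
Qed.

Lemma coset_power_uniq m i j : M m -> (i < p)%N -> (j < p)%N ->
  C (m * (x ^+ i)^-1) -> C (m * (x ^+ j)^-1) -> i = j.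
Proof.
move=> Mm; have m0 := Mn0 Mm.
wlog ij : i j / (i <= j)%N => [W ip jp Ci Cj|ip jp Ci Cj].
  by case/orP: (leq_total i j) => ij; [|apply/esym]; apply: W.
have Cd : C (x ^+ (j - i)).
  have -> : x ^+ (j - i) = (m * (x ^+ j)^-1)^-1 * (m * (x ^+ i)^-1).
    have xi := expdn0 hD i x0; rewrite -{2}(subnK ij) exprD.
    by move: (x ^+ i) (x ^+ (j - i)) xi => a b a0; gw.
  by apply: (sgM sC) => //; exact: (sgV sC).
have := (order (j - i)%N).1 Cd => /=; case: (posnP (j - i)) => [e _|d0].
  by apply/eqP; rewrite eqn_leq ij /= -subn_eq0 e.
by rewrite gtnNdvd // (leq_ltn_trans (leq_subr i j)).
Qed.

(** [f m] is the exponent of [x] in the coset of [m]; carries modulo [p] are absorbed because powers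
    of [x ^+ p] lie in [C]. *)
Lemma quotient_cyclic : quot_iso_Zp M C p.
Proof.
have [q pE] : exists q, p = q.+2 by case: (p) pp => [|[|q]] //; exists q.
have rep : forall m, exists i : 'I_p, M m -> C (m * (x ^+ i)^-1).
  move=> m; case: (pselect (M m)) => [/coset_power [i ?]|?]; first by exists i.
  by exists (Ordinal p0).
have uniq := coset_power_uniq; have ord := order.
move: rep uniq ord; rewrite pE => /choice [f hf] uniq ord; exists f; split.
- move=> m m' Mm Mm'; apply/ord_inj.
  apply: (uniq (m * m') _ _ (sgM sM Mm Mm')) => //; first exact: (hf _ (sgM sM Mm Mm')).
  set i : nat := f m; set j : nat := f m'.
  have Ci : C (m * (x ^+ i)^-1) by exact: hf.
  have Cj : C (m' * (x ^+ j)^-1) by exact: hf.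
  have xi0 k : x ^+ k != 0 by exact: expdn0.
  rewrite -[nat_of_ord _]/((i + j) %% q.+2)%N.
  have -> : m * m' * (x ^+ ((i + j) %% q.+2))^-1 = m * (x ^+ i)^-1 *
      (cj (x ^+ i) (m' * (x ^+ j)^-1) * x ^+ ((i + j) %/ q.+2 * q.+2)).
    have -> : x ^+ ((i + j) %/ q.+2 * q.+2) =
        x ^+ i * x ^+ j * (x ^+ ((i + j) %% q.+2))^-1.
      have := xi0 ((i + j) %% q.+2)%N; rewrite -exprD {3}(divn_eq (i + j) q.+2) exprD.
      by move: (x ^+ _) (x ^+ _) => a b b0; gw.
    have := xi0 i; have := xi0 j; rewrite /cj.
    by move: (x ^+ i) (x ^+ j) (x ^+ _) => a b c b0 a0; gw.
  apply: (sgM sC) => //; apply: (sgM sC).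
    by apply: (normal_cj nC) => //; exact: (sgX _ sM).
  by apply/(ord ((i + j) %/ q.+2 * q.+2)%N); rewrite dvdn_mull.
- move=> i; exists (x ^+ (nat_of_ord i)); have Mxi := sgX (nat_of_ord i) sM Mx.
  split=> //; apply/ord_inj; apply: (uniq _ _ _ Mxi) => //; first exact: hf.
  by rewrite muldV ?expdn0 //; exact: (sg1 sC).
- move=> m; split=> [[Mm f0]|Cm].
    by have := hf m Mm; rewrite f0 expr0 invr1 mulr1.
  have Mm := CM Cm; split=> //; apply/ord_inj; apply: (uniq _ _ _ Mm) => //.
    exact: hf.
  by rewrite expr0 invr1 mulr1.
Qed.

Lemma quotient_gens R : divring R -> L `<=` R -> R x -> R = [set: D].
Proof.
move=> dR LR Rx; apply/seteqP; split=> // d _.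
have : DgenF M d.
  by case: (dichotomy hD snG maxM solM (normal_refl sM)) => [//|->].
apply: (DgenF_min dR) => [m /coset_power [i Ci]|z Fz]; last first.
  by apply: LR; exact: DgenF_center.
have xi := expdn0 hD i x0.
have -> : m = m * (x ^+ i)^-1 * x ^+ i by gw.
by apply: (drM dR); [apply: LR; exact: CL|exact: (drX dR)].
Qed.

Let nx : normz L x. Proof. exact: (normz_field hD nC Mx). Qed.

Let Lxp : L (x ^+ p).
Proof. by apply: CL; apply/(order p); rewrite /= dvdnn. Qed.

Let act i : (forall y, L y -> cj (x ^+ i) y = y) -> (p %| i)%N.
Proof.
move=> h; apply/(order i); have xi := expdn0 hD i x0.
apply: selfC; split; first exact: (sgX _ sM).
by move=> y Cy; apply: (cj_idP hD xi); apply: h; exact: CL.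
Qed.

Lemma quotient_combination d : combination L x p d.
Proof. exact: (combinationT hD dL pp nx Lxp quotient_gens). Qed.

Lemma quotient_combination_free (c : 'I_p -> D) : (forall i, L (c i)) ->
  \sum_i c i * x ^+ i = 0 -> forall i, c i = 0.
Proof. exact: (combination_free hD dL aL nx act). Qed.

Lemma quotient_fixed y : L y -> cj x y = y -> F y.
Proof. exact: (fixed_central hD aL nx quotient_gens). Qed.

Lemma power_central : F (x ^+ p).
Proof.
apply: quotient_fixed => //; apply: (cj_id hD x0).
by rewrite -exprS exprSr.
Qed.

Lemma field_structure : [/\ maximal_subfield L, finite_galois F L,
  gal_iso_Zp F L p & dim_over F [set: D] (p ^ 2)].
Proof.
split.
- exact: (maximal_subfield_field hD dL aL pp nx Lxp act quotient_gens).
- exact: (finite_galois_field hD dL aL pp nx Lxp act quotient_gens).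
- exact: (galois_cyclic hD dL aL pp nx Lxp act quotient_gens).
- exact: (dim_square hD dL aL pp nx Lxp act quotient_gens).
Qed.

Lemma finite_dimension : exists l, [set: D] `<=` span F [set` l].
Proof.
have [_ _ _ [b [_ _ sb]]] := field_structure.
exists [seq b i | i <- enum 'I_(p ^ 2)] => d _; have [c [Fc ->]] := sb d I.
apply: span_sum => i _; apply: span1 => //=.
by apply: map_f; rewrite mem_enum.
Qed.

(** [M] is a union of [p] cosets of [C], so it would be finite modulo [F] as well, in finite
    dimension. *)
Lemma finite_core_absurd : ~ finite_mod C F.
Proof.
move=> [l hl]; have [l' Dl'] := finite_dimension.
apply: (finite_stabilizer_absurd hD snG maxM solM nabM Dl').
exists [seq y * x ^+ (nat_of_ord i) | y <- l, i <- enum 'I_p] => m /coset_power [i Ci].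
have [y [z [yl Fz z0 e]]] := hl _ Ci; exists (y * x ^+ i), z; split=> //.
  by apply/allpairsP; exists (y, i); rewrite mem_enum.
have xi := expdn0 hD i x0.
have -> : m = m * (x ^+ i)^-1 * x ^+ i by gw.
by rewrite e -!mulrA Fz.
Qed.

(** Elements of [C] giving the same conjugate of [x] differ by an element of [L] commuting with [x],
    hence central; so [C] would be finite modulo [F]. *)
Lemma finitely_many_conjugates_absurd :
  ~ finite_set [set y^-1 * x * y | y in M].
Proof.
move=> /finite_seqP [l hl]; apply: finite_core_absurd.
pose r y := xget 1 [set c | C c /\ c^-1 * x * c = y].
exists [seq r y | y <- l] => c Cc; have c0 := Cn0 Cc.
have yl : c^-1 * x * c \in l.
  have : [set y^-1 * x * y | y in M] (c^-1 * x * c) by exists c => //; exact: CM.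
  by rewrite hl.
have [Cr er] : C (r (c^-1 * x * c)) /\ (r (c^-1 * x * c))^-1 * x * r (c^-1 * x * c) = c^-1 * x * c.
  by rewrite {1 2 3}/r; case: xgetP => [//|/(_ c) []].
move: (r _) (map_f r yl) Cr er => y yr Cy e; have y0 := Cn0 Cy.
have Fd : F (c * y^-1).
  apply: quotient_fixed; first by apply: CL; apply: (sgM sC) => //; exact: (sgV sC).
  apply: (cj_id hD x0).
  have -> : x * (c * y^-1) = c * (c^-1 * x * c) * y^-1 by gw.
  by rewrite -e; gw.
exists y, (c * y^-1); split=> //; first by rewrite muldn0 ?invdn0.
by rewrite -Fd; gw.
Qed.

(* On [C] the map [c |-> [x, c]] is a nilpotent endomorphism; each of its values
   fixed by [x] has norm [1], hence is a [p]-th root of unity. So its iterated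
   kernels are finite modulo the kernel, which is central. *)
Lemma nilpotent_absurd N : normal N M -> nilpotent N -> ~ N x.
Proof.
move=> nN [sN [k [Z [Z0 Zk hZ]]]] Nx; apply: finite_core_absurd.
pose d c := cmm x c.
have dC c : C c -> C (d c) by move=> Cc; exact: (normal_cmm nC).
have dZ i c : (i < k)%N -> Z i.+1 c -> Z i (d c).
  move=> ik Zc; have [nZ ZZ cZ] := hZ i ik.
  have sZ : subgroup (Z i.+1).
    case: (ltnP i.+1 k) => ik'; first by case: (hZ _ ik') => /nsgN.
    by have -> : i.+1 = k; [apply/eqP; rewrite eqn_leq ik ik'|rewrite Zk].
  by rewrite /d cmm_comm; apply: cZ; [exact: (sgV sN)|exact: (sgV sZ)].
have dN c : C c -> N (d c) by move=> Cc; exact: (normal_cmm' nN (CM Cc) Nx).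
(* The first commutator with [x] falls in [N = Z k] and each further one goes down a step of the
   central series, so [k + 1] iterations reach [1]. *)
have diter j c : C c -> (j <= k)%N -> Z (k - j)%N (iter j.+1 d c).
  move=> Cc; elim: j => [|j IH] jk; first by rewrite subn0 Zk; exact: dN.
  have e : (k - j)%N = (k - j.+1).+1 by lia.
  by have := IH (ltnW jk); rewrite e => /dZ; apply; lia.
have xc c : C c -> cj x c = d c * c by move=> /Cn0 c0; rewrite /d /cmm /cj; gw.
have [vs hvs] := roots_of_unity_finite hD dL aL p0.
have [|c Cc ddc|c Cc|l hl] := @finite_mod_kernel D hD C d vs k.+1 sC dC.
- move=> c c' Cc Cc'; have c0 := Cn0 Cc; have c0' := Cn0 Cc'; have Cdc' := dC _ Cc'.
  have -> : d (c * c') = d c * (c * d c' * c^-1) by rewrite /d /cmm; gw.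
  by move: (d c) (d c') Cdc' => a b Cb; rewrite (aC Cc Cb); gw.
- apply: hvs; first exact: (CL (dC _ Cc)).
  have v0 := Cn0 (dC _ Cc); have c0 := Cn0 Cc.
  have fv : cj x (d c) = d c by rewrite xc ?ddc ?mul1r //; exact: dC.
  have h j : cj (x ^+ j) c = d c ^+ j * c.
    elim: j => [|j IH]; first by rewrite !expr0 mul1r (cj_id hD (oner_neq0 D)) // mul1r mulr1.
    have fvj : cj x (d c ^+ j) = d c ^+ j.
      by apply: (cj_id hD x0); exact: (commrX j (cj_idP hD x0 fv)).
    rewrite exprS (cjJ hD) IH (cjM hD) // fvj (xc c Cc).
    by move: (d c) => a; rewrite exprSr mulrA.
  have := h p; rewrite (cj_id hD (expdn0 hD p x0)); last exact: power_central.
  by rewrite -{1}[c]mul1r => /(mulId hD c0)/esym.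
- by have := diter k c Cc (leqnn k); rewrite subnn Z0.
exists l => c Cc; have [y [yl Cy dy]] := hl c Cc; have y0 := Cn0 Cy; have c0 := Cn0 Cc.
have Fd : F (c * y^-1).
  have Ccy : C (c * y^-1) by apply: (sgM sC) => //; exact: (sgV sC).
  by apply: quotient_fixed; [exact: CL|rewrite xc // dy mul1r].
exists y, (c * y^-1); split=> //; first by rewrite muldn0 ?invdn0.
by rewrite -Fd; gw.
Qed.

Lemma subring_gen_full : subring_gen (M `|` F) = [set: D].
Proof.
set R := subring_gen _; have [l Dl] := finite_dimension.
have sub : M `|` F `<=` R by move=> y My S _; apply.
have rR : subring R.
  split=> [S []//|S []//|y Ry S rS MS|y z Ry Rz S rS MS|y z Ry Rz S rS MS].
  - by case: (rS) => _ _ h _ _; apply: h; exact: Ry.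
  - by case: (rS) => _ _ _ h _; apply: h; [exact: Ry|exact: Rz].
  - by case: (rS) => _ _ _ _ h; apply: h; [exact: Ry|exact: Rz].
have FR : F `<=` R by move=> z Fz; apply: sub; right.
have dR := finite_span_divring hD dF rR FR (fun y _ => Dl y I).
apply/seteqP; split=> // d _; have : DgenF M d.
  by case: (dichotomy hD snG maxM solM (normal_refl sM)) => [//|->].
by apply: (DgenF_min dR) => // m Mm; apply: sub; left.
Qed.

Lemma finitely_many_conjugates c : C c -> finite_set [set y^-1 * c * y | y in M].
Proof.
move=> Cc; apply: sub_finite_set (finite_seq [seq (x ^+ (nat_of_ord i))^-1 * c * x ^+ i | i <- enum 'I_p]).
move=> _ [y /coset_power [i Ci] <-] /=; apply/mapP; exists i; first by rewrite mem_enum.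
have ci0 := Cn0 Ci; have xi := expdn0 hD i x0.
have {2}-> : y = y * (x ^+ i)^-1 * x ^+ i by gw.
have -> : y^-1 = (x ^+ i)^-1 * (y * (x ^+ i)^-1)^-1 by gw.
move: (y * _) Ci ci0 => u Cu u0.
have -> : (x ^+ i)^-1 * u^-1 * c * (u * x ^+ i) = (x ^+ i)^-1 * (u^-1 * (c * u)) * x ^+ i by rewrite !mulrA.
by rewrite (aC Cc Cu) (mulKd hD).
Qed.

(** The powers run from [1] to [p], so the decomposition with exponents from [0] is applied to
    [d * x^-1]. *)
Lemma direct_decomposition d : exists c : 'I_p -> D,
  (forall i, L (c i)) /\ d = \sum_(i < p) c i * x ^+ i.+1.
Proof.
have [c [Lc e]] := quotient_combination (d * x^-1); exists c; split=> //.
have -> : d = d * x^-1 * x by gw.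
by rewrite e mulr_suml; apply: eq_bigr => i _; rewrite exprSr mulrA.
Qed.

Lemma direct_decomposition_free (c : 'I_p -> D) : (forall i, L (c i)) ->
  \sum_(i < p) c i * x ^+ i.+1 = 0 -> forall i, c i * x ^+ i.+1 = 0.
Proof.
move=> Lc e i; rewrite (quotient_combination_free Lc) ?mul0r //.
apply: (mulId hD x0); rewrite mul0r -[RHS]e mulr_suml.
by apply: eq_bigr => j _; rewrite exprSr mulrA.
Qed.

End Order.

(** [x] has some prime order [q] modulo [C], and [p] kills the quotient, so [q = p]; what is proved
    for one generator then holds with the same [p] for every [x] outside [C]. *)
Lemma order_uniform p x : prime p -> quot_iso_Zp M C p -> M x -> ~ C x ->
  forall z : int, C (x ^ z) <-> (p %| `|z|)%N.
Proof.
move=> pp [f [fM _ f0]] Mx nCx.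
have [q [pq ord]] := quotient_order hD snG maxM solM nabM nC aC selfC Mx nCx.
suff -> : p = q by [].
have f1 : f 1 = 0 by case/f0: (sg1 sC).
have fX k : f (x ^+ k) = f x *+ k.
  elim: k => [|k IH]; first by rewrite expr0 f1.
  by rewrite exprS fM ?IH ?mulrS //; exact: (sgX _ sM).
have Cp : C (x ^+ p).
  apply/f0; split; first exact: (sgX _ sM).
  by rewrite fX -mulr_natr pchar_Zp ?mulr0 // prime_gt1.
by have := (ord p).1 Cp => /=; rewrite dvdn_prime2 // => /eqP.
Qed.

Lemma nilpotent_core : nilpotent C.
Proof.
split=> //; exists 1%N, (fun i => if i is 0%N then [set 1] else C); split=> // -[|//] _.
have s1 : subgroup [set 1 : D].
  split.
  - by move=> _ ->; exact: oner_neq0.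
  - by [].
  - by move=> _ _ -> ->; rewrite mulr1.
  - by move=> _ ->; rewrite invr1.
split=> [|_ ->|c d Cc Cd]; last 2 first.
- exact: (sg1 sC).
- rewrite /= comm_cmm; apply: (cmm_eq1 hD); try exact/invdn0/Cn0.
  by apply: aC; exact: (sgV sC).
apply: (normalP s1 sC) => [_ ->|c _ Cc ->]; first exact: (sg1 sC).
by rewrite /= (cj1 hD) // Cn0.
Qed.

End Index.

Theorem theorem3p2 (D : unitRingType) (G M : set D) :
  @is_division_ring D ->
  subgroup G -> subnormal G ->
  maximal_subgroup M G -> solvable M -> ~ abelian M ->
  exists p : nat, prime p /\
  exists K : set D,
    [/\ maximal_subfield K,
        finite_galois (@center D) K,
        gal_iso_Zp (@center D) K p,
        quot_iso_Zp M (K `&` @Dstar D `&` G) p &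
        dim_over (@center D) [set: D] (p ^ 2)%N] /\
    [/\ FC_center M = K `&` @Dstar D `&` G,
        Fitting M = K `&` @Dstar D `&` G,
        forall x, M x -> ~ K x -> @center D (x ^+ p),
        subring_gen (M `|` @center D) = [set: D] &
        forall x, M x -> ~ K x ->
          (forall d : D, exists c : 'I_p -> D,
              (forall i, K (c i)) /\ d = \sum_(i < p) c i * x ^+ i.+1) /\
          (forall c : 'I_p -> D, (forall i, K (c i)) ->
              \sum_(i < p) c i * x ^+ i.+1 = 0 ->
              forall i, c i * x ^+ i.+1 = 0)].
Proof.
move=> hD sG subG maxM /(solvable_solv hD (sg_M maxM)) solM nabM.
have [n snG] := subnormal_subnorm sG subG.
have [A [nA aA ncA]] : exists A, [/\ normal A M, abelian A & ~ A `<=` @center D].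
  apply: contrapT => no; apply: (no_noncentral_abelian_absurd hD snG maxM solM nabM).
  by move=> A nA aA; apply: contrapT => nAF; apply: no; exists A.
have [C [nC aC ncC selfC]] := exists_self_centralizing hD snG maxM solM nA aA ncA.
have sC := nsgN nC; have CM := nsub nC.
pose L := DgenF C.
have CE : L `&` @Dstar D `&` G = C by exact: (field_group hD snG maxM nabM nC aC ncC selfC).
have [x Mx nCx] := outside_exists nabM aC.
have [p [pp ord]] := quotient_order hD snG maxM solM nabM nC aC selfC Mx nCx.
have qp := quotient_cyclic hD snG maxM solM nabM nC aC selfC Mx nCx pp ord.
have uord y := order_uniform hD snG maxM solM nabM nC aC selfC pp qp (x := y).
have CL y : ~ L y -> ~ C y by move=> nL Cy; apply: nL; exact: DgenF_sub.
have [mL gL cL dimD] := field_structure hD snG maxM solM nabM nC aC selfC Mx nCx pp ord.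
exists p; split=> //; exists L; rewrite CE; split=> //; split.
- apply/seteqP; split=> [y [My fy]|c Cc]; last first.
    split; first exact: CM.
    exact: (finitely_many_conjugates hD snG maxM solM nabM nC aC selfC Mx nCx pp ord).
  apply: contrapT => nCy.
  exact: (finitely_many_conjugates_absurd hD snG maxM solM nabM nC aC selfC My nCy pp (uord _ My nCy) fy).
- apply/seteqP; split.
    apply: (gen_min sC) => y [N [nN nilN Ny]]; apply: contrapT => nCy.
    exact: (nilpotent_absurd hD snG maxM solM nabM nC aC selfC (nsub nN Ny) nCy pp (uord _ (nsub nN Ny) nCy) nN nilN Ny).
  by move=> c Cc; apply: sgen_sub; exists C; split=> //; exact: (nilpotent_core hD nC aC).
- move=> y My /CL nCy.
  exact: (power_central hD snG maxM solM nabM nC aC selfC My nCy pp (uord _ My nCy)).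
- exact: (subring_gen_full hD snG maxM solM nabM nC aC selfC Mx nCx pp ord).
move=> y My /CL nCy; have ordy := uord _ My nCy; split=> [d|c Lc e].
  exact: (direct_decomposition hD snG maxM solM nabM nC aC selfC My nCy pp ordy).
exact: (direct_decomposition_free hD maxM nC aC selfC My ordy Lc e).
Qed.
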